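(* Let $\lambda>0$, $\ell>0$ and $n_{\lambda,\ell}:=\left\lceil \sqrt{\lambda\ell^2/\hat\lambda}\,\right\rceil$. Suppose that $\gamma\in A_\ell$ is a penalized pinned elastica. Then either $\gamma$ is (a parametrization of) the line segment from $(0,0)$ to $(\ell,0)$, or, up to reflection across the $x$-axis and reparametrization, $\gamma$ is one of the following: (i) the $(\lambda,\ell,n)$-shorter arc $\gamma_{\rm sarc}^{\lambda,\ell,n}$ for some integer $n\ge n_{\lambda,\ell}$; (ii) the $(\lambda,\ell,n)$-longer arc $\gamma_{\rm larc}^{\lambda,\ell,n}$ for some integer $n\ge n_{\lambda,\ell}$; (iii) the $(\lambda,\ell,n)$-loop $\gamma_{\rm loop}^{\lambda,\ell,n}$ for some integer $n\ge1$.
   Context: Elliptic functions: for $q\in[0,1)$, $x\in\mathbb{R}$, $\mathrm{F}(x,q)=\int_0^x(1-q^2\sin^2\theta)^{-1/2}\,d\theta$, $\mathrm{E}(x,q)=\int_0^x(1-q^2\sin^2\theta)^{1/2}\,d\theta$, $\mathrm{K}(q)=\mathrm{F}(\pi/2,q)$, $\mathrm{E}(q)=\mathrm{E}(\pi/2,q)$; $\mathrm{am}(\cdot,q)$ is the inverse function of $x\mapsto\mathrm{F}(x,q)$, and $\mathrm{cn}(x,q)=\cos\mathrm{am}(x,q)$. The function $q\mapsto2\mathrm{E}(q)-\mathrm{K}(q)$ is strictly decreasing on $[0,1)$ with a unique zero $q_*\in(0,1)$. On $[1/\sqrt2,1)$ let $f(q)=(4q^4-5q^2+1)\mathrm{K}(q)+(-8q^4+8q^2-1)\mathrm{E}(q)$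 and $g(q)=8(2\mathrm{E}(q)-\mathrm{K}(q))^2(2q^2-1)$. The function $f$ has a unique zero $\hat q\in[1/\sqrt2,1)$ (it lies in $(1/\sqrt2,q_* )$, $\hat q\approx0.79257$); set $\hat\lambda:=g(\hat q)\approx0.70107$. One has $g(1/\sqrt2)=0$, $g$ strictly increasing on $[1/\sqrt2,\hat q]$, strictly decreasing on $[\hat q,q_*]$ with $g(q_* )=0$, and strictly increasing on $[q_*,1)$ with $g(q)\to\infty$ as $q\to1$. For $c\in(0,\hat\lambda]$ let $q_1(c)\in(1/\sqrt2,\hat q]$, $q_2(c)\in[\hat q,q_* )$, $q_3(c)\in(q_*,1)$ be the solutions of $g(q)=c$ in these intervals ($q_1(\hat\lambda)=q_2(\hat\lambda)=\hat q$); for $c>\hat\lambda$ let $q_3(c)$ be the unique solution of $g(q)=c$ in $(q_*,1)$. Setting: $W^{2,2}_{\rm imm}(0,1;\mathbb{R}^2)=\{\gamma\in W^{2,2}(0,1;\mathbb{R}^2): |\gamma'(x)|\neq0\ \forall x\in[0,1]\}$, $A_\ell=\{\gamma\in W^{2,2}_{\rm imm}(0,1;\mathbb{R}^2):\gamma(0)=(0,0),\ \gamma(1)=(\ell,0)\}$. For an immersed planar curve, $k$ is its signed curvature, $s$ arclength, $B[\gamma]=\int_\gamma k^2\,ds$, $L[\gamma]$ its length, and $\mathcal{E}_\lambda[\gamma]=B[\gamma]+\lambda L[\gamma]$. A penalized pinned elastica is a $\gamma\in A_\ell$ with $\frac{d}{d\varepsilon}\mathcal{E}_\lambda[\gamma+\varepsilon\eta]\big|_{\varepsilon=0}=0$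 for all $\eta\in W^{2,2}(0,1;\mathbb{R}^2)\cap W^{1,2}_0(0,1;\mathbb{R}^2)$. Special curves (arclength parametrized on $[0,2n\mathrm{K}(q)/\alpha]$): for an integer $n\ge n_{\lambda,\ell}$, $\gamma_{\rm sarc}^{\lambda,\ell,n}(s)=\frac1\alpha\big(2\mathrm{E}(\mathrm{am}(\alpha s-\mathrm{K}(q),q),q)+2\mathrm{E}(q)-\alpha s,\ 2q\,\mathrm{cn}(\alpha s-\mathrm{K}(q),q)\big)$ with $q=q_1(\lambda\ell^2/n^2)$ and $\alpha=\frac{2n}{\ell}(2\mathrm{E}(q)-\mathrm{K}(q))$; $\gamma_{\rm larc}^{\lambda,\ell,n}$ is given by the same formula with $q=q_2(\lambda\ell^2/n^2)$ and $\alpha=\frac{2n}{\ell}(2\mathrm{E}(q)-\mathrm{K}(q))$; for an integer $n\ge1$, $\gamma_{\rm loop}^{\lambda,\ell,n}(s)=\frac1\alpha\big(-2\mathrm{E}(\mathrm{am}(\alpha s-\mathrm{K}(q),q),q)-2\mathrm{E}(q)+\alpha s,\ 2q\,\mathrm{cn}(\alpha s-\mathrm{K}(q),q)\big)$ with $q=q_3(\lambda\ell^2/n^2)$ and $\alpha=\frac{2n}{\ell}(\mathrm{K}(q)-2\mathrm{E}(q))$. *)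

(* Defs.v *)
From HB Require Import structures.
From mathcomp Require Import all_boot all_order all_algebra.
From mathcomp Require Import all_classical all_reals all_analysis.
Set Implicit Arguments. Unset Strict Implicit. Unset Printing Implicit Defensive.
Import Order.TTheory GRing.Theory Num.Theory.
Import numFieldNormedType.Exports.
Local Open Scope classical_set_scope.
Local Open Scope ring_scope.

Section Defs.
Variable R : realType.
Local Notation mu := (@lebesgue_measure R).

Definition oint (a b : R) (f : R -> R) : R :=
  if a <= b then \int[mu]_(x in `[a, b]) f x
  else - \int[mu]_(x in `[b, a]) f x.

Definition EllF (x q : R) : R :=
  oint 0 x (fun t => (Num.sqrt (1 - q ^+ 2 * (sin t) ^+ 2))^-1).
Definition EllE (x q : R) : R :=
  oint 0 x (fun t => Num.sqrt (1 - q ^+ 2 * (sin t) ^+ 2)).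
Definition EllK (q : R) : R := EllF (pi / 2) q.
Definition EllEc (q : R) : R := EllE (pi / 2) q.
Definition am (u q : R) : R := xget 0 [set x | EllF x q = u].
Definition cn (u q : R) : R := cos (am u q).

(* q_* : unique zero of 2E(q) - K(q) in (0,1) *)
Definition qstar : R := xget 0 [set q | 0 < q < 1 /\ 2 * EllEc q - EllK q = 0].

Definition fpol (q : R) : R :=
  (4 * q ^+ 4 - 5 * q ^+ 2 + 1) * EllK q + (- 8 * q ^+ 4 + 8 * q ^+ 2 - 1) * EllEc q.
Definition gpol (q : R) : R :=
  8 * (2 * EllEc q - EllK q) ^+ 2 * (2 * q ^+ 2 - 1).

Definition isqrt2 : R := (Num.sqrt 2)^-1.
(* \hat q : unique zero of f in [1/sqrt 2, 1) *)
Definition qhat : R := xget 0 [set q | isqrt2 <= q < 1 /\ fpol q = 0].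
Definition lamhat : R := gpol qhat.

Definition q1 (c : R) : R := xget 0 [set q | isqrt2 < q <= qhat /\ gpol q = c].
Definition q2 (c : R) : R := xget 0 [set q | qhat <= q < qstar /\ gpol q = c].
Definition q3 (c : R) : R := xget 0 [set q | qstar < q < 1 /\ gpol q = c].

Definition nlam (lam l : R) : int := Num.ceil (Num.sqrt (lam * l ^+ 2 / lamhat)).

(* a planar curve is a map R -> R * R; only its values on [0,1] matter *)
Definition W22_wit (u u1 h : R -> R) : Prop :=
  measurable_fun (`[0%R, 1%R] : set R) h /\
  (\int[mu]_(x in (`[0%R, 1%R] : set R)) ((h x) ^+ 2)%:E < +oo)%E /\
  (forall x, 0 <= x <= 1 -> u1 x = u1 0 + \int[mu]_(t in `[0, x]) h t) /\
  (forall x, 0 <= x <= 1 -> u x = u 0 + \int[mu]_(t in `[0, x]) u1 t).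

(* u in W^{2,2}(0,1) (continuous representative) *)
Definition W22 (u : R -> R) : Prop := exists u1 h, W22_wit u u1 h.
Definition d1 (u : R -> R) : R -> R := xget (fun _ => 0) [set u1 | exists h, W22_wit u u1 h].
Definition d2 (u : R -> R) : R -> R := xget (fun _ => 0) [set h | exists u1, W22_wit u u1 h].

Definition W22c (g : R -> R * R) : Prop :=
  W22 (fun x => (g x).1) /\ W22 (fun x => (g x).2).

Definition W22_imm (g : R -> R * R) : Prop :=
  W22c g /\ forall x, 0 <= x <= 1 ->
    (d1 (fun y => (g y).1) x, d1 (fun y => (g y).2) x) <> (0, 0).

Definition A_ell (l : R) (g : R -> R * R) : Prop :=
  W22_imm g /\ g 0 = (0, 0) /\ g 1 = (l, 0).

Definition speed (g : R -> R * R) (x : R) : R :=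
  Num.sqrt ((d1 (fun y => (g y).1) x) ^+ 2 + (d1 (fun y => (g y).2) x) ^+ 2).
Definition curv (g : R -> R * R) (x : R) : R :=
  (d1 (fun y => (g y).1) x * d2 (fun y => (g y).2) x
   - d1 (fun y => (g y).2) x * d2 (fun y => (g y).1) x) / (speed g x) ^+ 3.
Definition Len (g : R -> R * R) : R := \int[mu]_(x in `[0, 1]) speed g x.
Definition Bend (g : R -> R * R) : R :=
  \int[mu]_(x in `[0, 1]) ((curv g x) ^+ 2 * speed g x).
Definition Elam (lam : R) (g : R -> R * R) : R := Bend g + lam * Len g.

Definition cvar (g eta : R -> R * R) (e : R) : R -> R * R :=
  fun x => ((g x).1 + e * (eta x).1, (g x).2 + e * (eta x).2).

Definition pen_pinned_elastica (lam l : R) (g : R -> R * R) : Prop :=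
  A_ell l g /\
  forall eta : R -> R * R, W22c eta -> eta 0 = (0, 0) -> eta 1 = (0, 0) ->
    is_derive (0 : R) (1 : R) (fun e : R => Elam lam (cvar g eta e)) 0.

Definition arc_curve (q al : R) (s : R) : R * R :=
  ((2 * EllE (am (al * s - EllK q) q) q + 2 * EllEc q - al * s) / al,
   2 * q * cn (al * s - EllK q) q / al).
Definition loop_curve (q al : R) (s : R) : R * R :=
  ((- 2 * EllE (am (al * s - EllK q) q) q - 2 * EllEc q + al * s) / al,
   2 * q * cn (al * s - EllK q) q / al).

Definition sarc_q (lam l : R) (n : nat) : R := q1 (lam * l ^+ 2 / (n%:R) ^+ 2).
Definition larc_q (lam l : R) (n : nat) : R := q2 (lam * l ^+ 2 / (n%:R) ^+ 2).
Definition loop_q (lam l : R) (n : nat) : R := q3 (lam * l ^+ 2 / (n%:R) ^+ 2).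
Definition arc_alpha (l : R) (n : nat) (q : R) : R := 2 * n%:R / l * (2 * EllEc q - EllK q).
Definition loop_alpha (l : R) (n : nat) (q : R) : R := 2 * n%:R / l * (EllK q - 2 * EllEc q).

Definition gam_sarc (lam l : R) (n : nat) : R -> R * R :=
  arc_curve (sarc_q lam l n) (arc_alpha l n (sarc_q lam l n)).
Definition gam_larc (lam l : R) (n : nat) : R -> R * R :=
  arc_curve (larc_q lam l n) (arc_alpha l n (larc_q lam l n)).
Definition gam_loop (lam l : R) (n : nat) : R -> R * R :=
  loop_curve (loop_q lam l n) (loop_alpha l n (loop_q lam l n)).
(* lengths of the parameter intervals [0, 2 n K(q) / alpha] *)
Definition sarc_len (lam l : R) (n : nat) : R :=
  2 * n%:R * EllK (sarc_q lam l n) / arc_alpha l n (sarc_q lam l n).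
Definition larc_len (lam l : R) (n : nat) : R :=
  2 * n%:R * EllK (larc_q lam l n) / arc_alpha l n (larc_q lam l n).
Definition loop_len (lam l : R) (n : nat) : R :=
  2 * n%:R * EllK (loop_q lam l n) / loop_alpha l n (loop_q lam l n).

Definition reflx (p : R * R) : R * R := (p.1, - p.2).

Definition reparam_of (G : R -> R * R) (L : R) (g : R -> R * R) : Prop :=
  exists phi : R -> R,
    {within `[0, 1], continuous phi} /\
    {in `[0, 1] &, forall x y, x < y -> phi x < phi y} /\
    phi 0 = 0 /\ phi 1 = L /\
    forall x, 0 <= x <= 1 -> g x = G (phi x).

Definition reparam_refl (G : R -> R * R) (L : R) (g : R -> R * R) : Prop :=
  reparam_of G L g \/ reparam_of (fun s => reflx (G s)) L g.

Definition segment (s : R) : R * R := (s, 0).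

End Defs.

(* Main.v *)
Require Import Defs.
From HB Require Import structures.
From mathcomp Require Import all_boot all_order all_algebra.
From mathcomp Require Import all_classical all_reals all_analysis.
From mathcomp Require Import measurable_realfun ring lra.
Import Order.TTheory GRing.Theory Num.Theory.
Import numFieldNormedType.Exports.

(* Testing the first variation with [eta] whose second derivative is an
   arbitrary [L2] function gives, in one stroke, the regularity of the
   curvature [k], the natural boundary condition [k = 0] at both ends, and a
   conserved vector [J], with [k = 1/2 J x (g - g 0)] and
   [k ^ 2 - lam = J . T].  Since the end points lie on the x-axis, [J] is
   horizontal, [J = (c, 0)], so the height [y] solves, in arclength, the
   Duffing equation [y'' = lam/2 y - c^2/8 y^3] with [y = 0] and
   [|y'| = sqrt (1 - lam^2 / c^2)] initially.  Uniqueness for this equation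
   identifies [g] with the segment if [|c| = lam], and otherwise with the
   explicit curve of modulus [q] and scale [al], where [|c| = 2 al^2] and
   [lam = 2 al^2 (2 q^2 - 1)]; the sign of [c] decides between arc and loop.
   The position of the second end point turns this into
   [gpol q = lam l^2 / n^2], and the monotonicity of [gpol] on its three
   branches selects [q1], [q2] or [q3]. *)

(** The curve comes with an arbitrary [W22] parametrization, and it is never reparametrized by
    arclength: every equation keeps the given parameter, with the speed [s] as a factor, and the
    explicit curves are pulled back along the arclength function [phi]. Second derivatives exist
    only almost everywhere, so absolute continuity is encoded as being the primitive of an
    integrable function, and identities between continuous functions are upgraded from almost
    everywhere to everywhere. With velocity [(v1, v2)], [N = v1 h2 - v2 h1] and curvature
    [k = N / s ^ 3], the coefficient of [eta''] in the first variation is [A = (2 k / s) nu], where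
    [nu] is the unit normal. Its tangential component vanishes and its normal component carries the
    curvature; differentiating the former gives the force law, differentiating the latter the moment
    law. The height is identified by a Gronwall comparison with the second-order equation. The
    first-order energy equation would be less suitable: its square root is not Lipschitz at the
    turning points of the height. *)

Set Implicit Arguments. Unset Strict Implicit. Unset Printing Implicit Defensive.
Local Open Scope classical_set_scope.
Local Open Scope ring_scope.

(** * Integrals of continuous functions and pointwise derivatives *)

Section RealIntegrals.
Variable R : realType.
Local Notation mu := (@lebesgue_measure R).
Implicit Types (f g F G : R -> R) (a b c x y : R).

Lemma continuous_integrable_itv f a b :
  continuous f -> mu.-integrable `[a, b] (EFin \o f).
Proof.
move=> cf; apply: continuous_compact_integrable; first exact: segment_compact.
exact: continuous_subspaceT.
Qed.

Lemma is_derive_continuous f df x : is_derive x 1 f df -> {for x, continuous f}.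
Proof.
by move=> [df1 _]; apply: differentiable_continuous; apply/derivable1_diffP.
Qed.

Lemma Rintegral_itv_cat f a b c : a <= b -> b <= c ->
  mu.-integrable `[a, c] (EFin \o f) ->
  \int[mu]_(t in `[a, c]) f t =
  \int[mu]_(t in `[a, b]) f t + \int[mu]_(t in `[b, c]) f t.
Proof.
move=> ab bc fi.
have fbc : mu.-integrable `]b, c] (EFin \o f).
  apply: integrableS fi => //; apply: subset_itv; rewrite bnd_simp //.
have := @Rintegral_itvB R f (BLeft a) (BRight c) b fi.
rewrite !bnd_simp => /(_ ab bc).
rewrite (Rintegral_itv_obnd_cbnd fbc) => <-.
by rewrite addrC subrK.
Qed.

Lemma oint_from f c a x : continuous f -> c <= a -> c <= x ->
  oint a x f = \int[mu]_(t in `[c, x]) f t - \int[mu]_(t in `[c, a]) f t.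
Proof.
move=> cf ca cx; rewrite /oint; case: (leP a x) => [ax|/ltW xa].
  by rewrite (Rintegral_itv_cat ca ax (continuous_integrable_itv c x cf)) addrC addKr.
rewrite (Rintegral_itv_cat cx xa (continuous_integrable_itv c a cf)).
by rewrite opprD addrA subrr sub0r.
Qed.

Lemma is_derive_oint f a x : continuous f -> is_derive x 1 (fun y => oint a y f) (f x).
Proof.
(* A base point left of both [a] and [x] puts [x] in the interior of an interval starting at [c], on
   whichever side of [a] it lies. *)
move=> cf; set c := Num.min a x - 1.
have cx : c < x by rewrite /c ltrBlDr (@le_lt_trans _ _ x)// ?ltrDl// ge_min lexx orbT.
have ca : c <= a by rewrite /c lerBlDr (@le_trans _ _ a)// ?lerDl// ge_min lexx.
apply: (@near_eq_is_derive _ _ _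
  (fun y => \int[mu]_(t in `[c, y]) f t - \int[mu]_(t in `[c, a]) f t)).
  near=> y; rewrite (@oint_from f c)//.
  by apply/ltW; near: y; exact: lt_nbhsr.
have [|d1 d2] := @continuous_FTC1_closed R f c x (x + 1) _ (continuous_integrable_itv c _ cf) cx (cf x).
  by rewrite ltrDl.
rewrite -[X in is_derive _ _ _ X]subr0.
apply: is_deriveB.
by apply: DeriveDef; [exact: d1|rewrite -derive1E; exact: d2].
Unshelve. all: by end_near. Qed.

End RealIntegrals.

Section PointwiseDerivatives.
Variable R : realType.
Implicit Types (f g F G : R -> R) (a b c d x y : R).

(* Not a class, so that unification alone drives the rules below. *)
Definition deriv_at f x a : Prop := is_derive x (1 : R) f a.

Lemma deriv_at_eq f x a b : deriv_at f x a -> a = b -> deriv_at f x b.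
Proof. by move=> + <-. Qed.

Lemma deriv_cst c x : deriv_at (fun=> c) x 0.
Proof. exact: is_derive_cst. Qed.

Lemma deriv_id x : deriv_at (fun y => y) x 1.
Proof. exact: is_derive_id. Qed.

Lemma derivD f g x a b : deriv_at f x a -> deriv_at g x b ->
  deriv_at (fun y => f y + g y) x (a + b).
Proof. by move=> df dg; exact: is_deriveD. Qed.

Lemma derivN f x a : deriv_at f x a -> deriv_at (fun y => - f y) x (- a).
Proof. by move=> df; exact: is_deriveN. Qed.

Lemma derivB f g x a b : deriv_at f x a -> deriv_at g x b ->
  deriv_at (fun y => f y - g y) x (a - b).
Proof. by move=> df dg; exact: is_deriveB. Qed.

Lemma derivM f g x a b : deriv_at f x a -> deriv_at g x b ->
  deriv_at (fun y => f y * g y) x (f x * b + g x * a).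
Proof. by move=> df dg; exact: is_deriveM. Qed.

Lemma deriv_comp f g x a b : deriv_at f (g x) a -> deriv_at g x b ->
  deriv_at (fun y => f (g y)) x (a * b).
Proof.
move=> df dg; exact: (is_derive1_comp df dg).
Qed.

Lemma derivX f n x a : deriv_at f x a ->
  deriv_at (fun y => f y ^+ n) x (n%:R * f x ^+ n.-1 * a).
Proof.
move=> df; apply: (deriv_comp (f := fun z => z ^+ n) _ df).
apply: DeriveDef; first exact: exprn_derivable.
by rewrite -derive1E exp_derive1.
Qed.

Lemma deriv_sin f x a : deriv_at f x a ->
  deriv_at (fun y => sin (f y)) x (cos (f x) * a).
Proof. by apply: deriv_comp; exact: is_derive_sin. Qed.

Lemma deriv_cos f x a : deriv_at f x a ->
  deriv_at (fun y => cos (f y)) x (- sin (f x) * a).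
Proof. by apply: deriv_comp; exact: is_derive_cos. Qed.

Lemma deriv_sqrt f x a : 0 < f x -> deriv_at f x a ->
  deriv_at (fun y => Num.sqrt (f y)) x (a / (2 * Num.sqrt (f x))).
Proof.
move=> fx0 df; rewrite mulrC; apply: (deriv_comp _ df).
exact: is_derive1_sqrt.
Qed.

Lemma derivV f x a : f x != 0 -> deriv_at f x a ->
  deriv_at (fun y => (f y)^-1) x (- a / f x ^+ 2).
Proof.
move=> fx0 df; apply: (is_derive_eq (is_deriveV fx0 df)).
by rewrite /GRing.scale /= mulrC mulrN mulNr.
Qed.

End PointwiseDerivatives.

(** * Absolutely continuous functions on [0, 1] *)

Section AC.
Variable R : realType.
Local Notation mu := (@lebesgue_measure R).
Implicit Types (f g h k u v F G : R -> R) (a b c x y : R).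

Definition unit_itv : set R := `[0, 1].
Definition L1 f := mu.-integrable unit_itv (EFin \o f).
Definition cont01 f := {within unit_itv, continuous f}.

Lemma measurable_unit_itv : measurable unit_itv.
Proof. exact: measurable_itv. Qed.
Local Hint Extern 0 (measurable unit_itv) => exact: measurable_unit_itv : core.

Lemma sub_unit_itv a b : 0 <= a -> b <= 1 -> `[a, b] `<=` unit_itv.
Proof. by move=> a0 b1; apply: subset_itv; rewrite bnd_simp. Qed.

Lemma mem_unit_itv x : unit_itv x -> 0 <= x <= 1.
Proof. by rewrite /unit_itv /= in_itv. Qed.

Lemma L1_itv f a b : L1 f -> 0 <= a -> b <= 1 ->
  mu.-integrable `[a, b] (EFin \o f).
Proof. by move=> fi a0 b1; apply: integrableS fi => //; exact: sub_unit_itv. Qed.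

Lemma L1_meas f : L1 f -> measurable_fun unit_itv f.
Proof. by move=> fi; apply/measurable_EFinP; exact: (measurable_int mu). Qed.

Lemma L1D f g : L1 f -> L1 g -> L1 (fun x => f x + g x).
Proof. by move=> fi gi; exact: (integrableD (mu := mu) measurable_unit_itv fi gi). Qed.

Lemma L1N f : L1 f -> L1 (fun x => - f x).
Proof.
move=> fi; have := integrableZl (mu := mu) measurable_unit_itv (-1) fi.
by apply: eq_integrable => // x _ /=; rewrite -EFinM mulN1r.
Qed.

Lemma L1B f g : L1 f -> L1 g -> L1 (fun x => f x - g x).
Proof. by move=> fi gi; apply: L1D => //; exact: L1N. Qed.

Lemma L1_abs f : L1 f -> L1 (fun x => `|f x|).
Proof. by move=> fi; exact: (integrable_norm fi). Qed.

Lemma le_L1 f g : measurable_fun unit_itv f -> L1 g ->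
  (forall x, unit_itv x -> `|f x| <= `|g x|) -> L1 f.
Proof.
move=> mf gi fg; by apply: le_integrable gi => //; exact/measurable_EFinP.
Qed.

Lemma eq_L1 f g : (forall x, unit_itv x -> f x = g x) -> L1 f -> L1 g.
Proof.
move=> fg; by apply: eq_integrable => // x; rewrite inE => Dx /=; rewrite fg.
Qed.

Lemma cont01_meas f : cont01 f -> measurable_fun unit_itv f.
Proof. by move=> cf; apply: measurable_realfun.subspace_continuous_measurable_fun. Qed.

Lemma cont01_L1 f : cont01 f -> L1 f.
Proof. by move=> cf; apply: continuous_compact_integrable => //; exact: segment_compact. Qed.

Lemma cont01_cst c : cont01 (fun=> c).
Proof. by move=> x; exact: cvg_cst. Qed.

Lemma cont01D f g : cont01 f -> cont01 g -> cont01 (fun x => f x + g x).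
Proof. by move=> cf cg x; apply: continuousD; [exact: cf|exact: cg]. Qed.

Lemma cont01M f g : cont01 f -> cont01 g -> cont01 (fun x => f x * g x).
Proof. by move=> cf cg x; apply: continuousM; [exact: cf|exact: cg]. Qed.

Lemma cont01N f : cont01 f -> cont01 (fun x => - f x).
Proof. by move=> cf x; apply: continuousN; exact: cf. Qed.

Lemma cont01B f g : cont01 f -> cont01 g -> cont01 (fun x => f x - g x).
Proof. by move=> cf cg; apply: cont01D => //; exact: cont01N. Qed.

Lemma cont01X f n : cont01 f -> cont01 (fun x => f x ^+ n).
Proof.
move=> cf; elim: n => [|n IH]; first exact: cont01_cst.
rewrite (_ : (fun _ => _) = (fun x => f x * f x ^+ n)); last first.
  by apply/funext => x; rewrite exprS.
exact: cont01M.
Qed.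

Lemma cont01_comp f F : cont01 f -> continuous F -> cont01 (fun x => F (f x)).
Proof.
move=> cf cF x; apply: (@continuous_comp _ _ _ (f : subspace unit_itv -> R) F).
  exact: cf.
exact: cF.
Qed.

Lemma cont01_bounded f : cont01 f ->
  exists2 M, 0 < M & forall x, unit_itv x -> `|f x| <= M.
Proof.
move=> cf; have cg : cont01 (fun x => `|f x|).
  by apply: cont01_comp cf _ => x; exact: norm_continuous.
have [c c01 fc] := EVT_max (@ler01 R) cg.
exists (`|f c| + 1); first by rewrite ltr_wpDl.
by move=> x Dx; rewrite (le_trans (fc x Dx))// lerDl.
Qed.

Lemma L1M f h : cont01 f -> L1 h -> L1 (fun x => f x * h x).
Proof.
move=> cf hi; have [M M0 fM] := cont01_bounded cf.
have Mi : L1 (fun x => M * h x).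
  by exact: (integrableZl (mu := mu) measurable_unit_itv M hi).
apply: le_L1 Mi _.
  by apply: measurable_funM; [exact: cont01_meas|exact: L1_meas].
move=> x Dx; rewrite !normrM (gtr0_norm M0).
by rewrite ler_wpM2r// fM.
Qed.

Lemma L1Z c h : L1 h -> L1 (fun x => c * h x).
Proof. by move=> hi; apply: L1M => //; exact: cont01_cst. Qed.

Lemma cont01V f : cont01 f -> (forall x, unit_itv x -> f x != 0) ->
  cont01 (fun x => (f x)^-1).
Proof.
move=> /subspace_continuousP cf f0; apply/subspace_continuousP => x Dx.
by apply: cvgV; [exact: f0|exact: cf].
Qed.

Lemma cont01_sqrt f : cont01 f -> cont01 (fun x => Num.sqrt (f x)).
Proof. by move=> cf; apply: cont01_comp => //; exact: sqrt_continuous. Qed.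

Lemma eq_cont01 f g : (forall x, unit_itv x -> f x = g x) -> cont01 f -> cont01 g.
Proof.
by move=> fg; apply: subspace_eq_continuous => x; rewrite inE; exact: fg.
Qed.

(** A nonzero value persists on a nondegenerate subinterval of the unit interval, which would then
    lie in the exceptional null set. *)
Lemma ae_cont01_eq0 f : cont01 f -> {ae mu, forall x, unit_itv x -> f x = 0} ->
  forall x, unit_itv x -> f x = 0.
Proof.
move=> cf [N [mN N0 fN]] x Dx; apply/eqP/negPn/negP => fx0.
have := cf; move=> /subspace_continuousP/(_ x Dx)/cvgrPdist_lt/(_ `|f x|).
rewrite normr_gt0 => /(_ fx0); rewrite /within /=. move=> [e /= e0 He].
have /andP[x0 x1] := mem_unit_itv Dx.
(* Clipping handles [x = 0] and [x = 1], where only one side of [x] is available. *)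
pose c := Num.max 0 (x - e / 2); pose d := Num.min 1 (x + e / 2).
have cd : c < d.
  by rewrite /c /d gt_max !lt_min; apply/andP; split; apply/andP; split; lra.
have sN : `[c, d] `<=` N.
  move=> y /=; rewrite in_itv /= => /andP[cy yd]; apply: fN => /= fy.
  move: cy yd; rewrite /c /d ge_max le_min => /andP[y0 cy] /andP[y1 yd].
  have Dy : unit_itv y by rewrite /unit_itv /= in_itv /= y0.
  have := He y; rewrite /ball /= /from_subspace /= (fy Dy) subr0 ltxx => H; suff: false by []; apply: H => //.
  rewrite ltr_distlC; apply/andP; split; lra.
have := le_measure mu.
move=> /(_ [set` `[c, d]%R] N); rewrite !inE => /(_ (measurable_itv _) mN sN).
by rewrite /= N0 lebesgue_measure_itv /= lte_fin cd -EFinB lee_fin subr_le0 leNgt cd.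
Qed.

(** Absolute continuity on the unit interval, in integral form. Only the class of [h] up to null
    sets matters, and [u] is unconstrained outside the interval. *)
Definition ac u h := L1 h /\
  forall x, unit_itv x -> u x = u 0 + \int[mu]_(t in `[0, x]) h t.

Lemma ac_incr u h x y : ac u h -> 0 <= x -> x <= y -> y <= 1 ->
  u y - u x = \int[mu]_(t in `[x, y]) h t.
Proof.
move=> [hi uh] x0 xy y1.
rewrite (uh y) ?(uh x) /unit_itv /= ?in_itv /= ?x0 ?y1 ?(le_trans x0 xy) ?(le_trans xy y1)//.
rewrite (Rintegral_itv_cat x0 xy (L1_itv hi _ y1))//.
by rewrite opprD addrACA subrr add0r addrC addKr.
Qed.

Lemma ac_cont01 u h : ac u h -> cont01 u.
Proof.
move=> [hi uh].
have := parameterized_integral_continuous (@ler01 R) hi.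
move=> ch; have : cont01 (fun x => u 0 + \int[mu]_(t in `[0, x]) h t).
  by apply: cont01D ch; exact: cont01_cst.
by apply: eq_cont01 => x Dx; rewrite -uh.
Qed.

Lemma cont01_prim h : L1 h -> cont01 (fun x => \int[mu]_(t in `[0, x]) h t).
Proof. exact: parameterized_integral_continuous ler01. Qed.

Lemma le_L1_itv f g a b : L1 f -> L1 g -> 0 <= a -> b <= 1 ->
  (forall x, a <= x <= b -> f x <= g x) ->
  \int[mu]_(t in `[a, b]) f t <= \int[mu]_(t in `[a, b]) g t.
Proof.
move=> fi gi a0 b1 fg; apply: le_Rintegral; [by []|exact: L1_itv|exact: L1_itv|].
by move=> x /=; rewrite in_itv /=; exact: fg.
Qed.

Lemma norm_L1_itv f a b : L1 f -> 0 <= a -> b <= 1 ->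
  `|\int[mu]_(t in `[a, b]) f t| <= \int[mu]_(t in `[a, b]) `|f t|.
Proof. by move=> fi a0 b1; apply: le_normr_Rintegral => //; exact: L1_itv. Qed.

Lemma RintD01 f g a b : L1 f -> L1 g -> 0 <= a -> b <= 1 ->
  \int[mu]_(t in `[a, b]) (f t + g t) =
  \int[mu]_(t in `[a, b]) f t + \int[mu]_(t in `[a, b]) g t.
Proof. by move=> fi gi a0 b1; apply: RintegralD => //; exact: L1_itv. Qed.

Lemma RintB01 f g a b : L1 f -> L1 g -> 0 <= a -> b <= 1 ->
  \int[mu]_(t in `[a, b]) (f t - g t) =
  \int[mu]_(t in `[a, b]) f t - \int[mu]_(t in `[a, b]) g t.
Proof. by move=> fi gi a0 b1; apply: RintegralB => //; exact: L1_itv. Qed.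

Lemma RintZ01 f c a b : L1 f -> 0 <= a -> b <= 1 ->
  \int[mu]_(t in `[a, b]) (c * f t) = c * \int[mu]_(t in `[a, b]) f t.
Proof. by move=> fi a0 b1; apply: RintegralZl => //; exact: L1_itv. Qed.

(* Halving the increment of [H] halves the square bound at each step. *)
Lemma quadratic_increment_cst u H : cont01 H ->
  (forall x y, 0 <= x -> x <= y -> y <= 1 -> H x <= H y /\ `|u y - u x| <= (H y - H x) ^+ 2) ->
  forall x, unit_itv x -> u x = u 0.
Proof.
move=> cH HH.
have step (n : nat) : forall x y, 0 <= x -> x <= y -> y <= 1 ->
    `|u y - u x| <= (H y - H x) ^+ 2 / 2 ^+ n.
  elim: n => [|n IH] x y x0 xy y1; first by rewrite expr0 divr1; apply: (HH x y x0 xy y1).2.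
  have [Hxy _] := HH _ _ x0 xy y1.
  have [|z] := @IVT R H x y ((H x + H y) / 2) xy (continuous_subspaceW (sub_unit_itv x0 y1) cH).
    by rewrite min_l// max_r//; apply/andP; split; lra.
  rewrite in_itv /= => /andP[xz zy] Hz.
  have b1 := IH _ _ x0 xz (le_trans zy y1).
  have b2 := IH _ _ (le_trans x0 xz) zy y1.
  have -> : u y - u x = (u y - u z) + (u z - u x) by ring.
  apply: le_trans (ler_normD _ _) _; apply: le_trans (lerD b2 b1) _.
  rewrite Hz (exprS 2 n) le_eqVlt; apply/orP; left; apply/eqP.
  have : (2 : R) ^+ n != 0 by rewrite expf_neq0.
  by move=> n0; field.
move=> x /mem_unit_itv/andP[x0 x1].
apply/eqP; rewrite -subr_eq0 -normr_le0; apply/ler_addgt0Pr => e e0; rewrite add0r.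
set D := (H x - H 0) ^+ 2.
have D0 : 0 <= D by exact: sqr_ge0.
pose n := Num.truncn (D / e).
have := step n.+1 0 x (lexx _) x0 x1; move=> /le_trans; apply.
rewrite ler_pdivrMr ?exprn_gt0// -/D.
have Dn : D / e <= n.+1%:R by apply/ltW; rewrite truncnS_gt.
rewrite -ler_pdivrMl// mulrC; apply: le_trans Dn _.
rewrite -natrX ler_nat; exact/ltnW/ltn_expl.
Qed.

(** The increments of [u] minus the primitive of [k] are bounded by squared increments of a
    continuous nondecreasing function, so this difference is constant. The product and chain rules
    below rest on it. *)
Lemma ac_of_quadratic u k th C : L1 k -> L1 th -> 0 <= C ->
  (forall x, unit_itv x -> 0 <= th x) ->
  (forall x y, 0 <= x -> x <= y -> y <= 1 ->
    `|u y - u x - \int[mu]_(t in `[x, y]) k t| <=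
      C * (\int[mu]_(t in `[x, y]) th t) ^+ 2) ->
  ac u k.
Proof.
move=> ki thi C0 th0 Hq; split=> //.
pose H x := Num.sqrt C * \int[mu]_(t in `[0, x]) th t.
pose w x := u x - \int[mu]_(t in `[0, x]) k t.
suff Hw : forall x, unit_itv x -> w x = w 0.
  move=> x Dx; have := Hw x Dx; rewrite /w set_itv1 Rintegral_set1 subr0 => <-.
  by rewrite subrK.
apply: (@quadratic_increment_cst w H).
  by apply: cont01M; [exact: cont01_cst|exact: cont01_prim].
move=> x y x0 xy y1.
have y0 := le_trans x0 xy.
have E f : L1 f -> \int[mu]_(t in `[0, y]) f t - \int[mu]_(t in `[0, x]) f t =
    \int[mu]_(t in `[x, y]) f t.
  by move=> fi; rewrite (Rintegral_itv_cat x0 xy (L1_itv fi _ y1))// addrC addKr.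
rewrite /H -mulrBr exprMn sqr_sqrtr// E//; split.
  rewrite -subr_ge0 -mulrBr E// mulr_ge0 ?sqrtr_ge0//.
  apply: Rintegral_ge0 => t /=; rewrite in_itv /= => /andP[xt ty]; apply: th0.
  by rewrite /unit_itv /= in_itv /= (le_trans x0 xt) (le_trans ty y1).
rewrite (_ : w y - w x = u y - u x - \int[mu]_(t in `[x, y]) k t); first exact: Hq.
by rewrite -E// /w; ring.
Qed.

End AC.
Arguments unit_itv {R}.
Arguments cont01_cst {R} c.
Arguments cont01X {R f} n.
Arguments L1Z {R} c {h}.

(** * Product and chain rules, and almost everywhere uniqueness of the derivative *)

Section ACcalculus.
Variable R : realType.
Local Notation mu := (@lebesgue_measure R).
Implicit Types (f g h k u v w p F G : R -> R) (a b c d x y C : R).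
Local Hint Extern 0 (measurable unit_itv) => exact: measurable_unit_itv : core.

Lemma ae_imp (P Q : R -> Prop) : (forall x, P x -> Q x) ->
  {ae mu, forall x, P x} -> {ae mu, forall x, Q x}.
Proof.
by move=> PQ; apply: filterS; first exact: (ae_filter_ringOfSetsType mu).
Qed.

Lemma ae_imp2 (P1 P2 Q : R -> Prop) : (forall x, P1 x -> P2 x -> Q x) ->
  {ae mu, forall x, P1 x} -> {ae mu, forall x, P2 x} -> {ae mu, forall x, Q x}.
Proof.
by move=> PQ; apply: filterS2; first exact: (ae_filter_ringOfSetsType mu).
Qed.

Lemma unit_itvP x : 0 <= x -> x <= 1 -> unit_itv x.
Proof. by move=> x0 x1; rewrite /unit_itv /= in_itv /= x0. Qed.

Lemma unit_itv0 : unit_itv (0 : R).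
Proof. by apply: unit_itvP; [exact: lexx|exact: ler01]. Qed.

Lemma unit_itv1 : unit_itv (1 : R).
Proof. by apply: unit_itvP; [exact: ler01|exact: lexx]. Qed.

Lemma eq_ac u v h : (forall x, unit_itv x -> u x = v x) -> ac u h -> ac v h.
Proof.
move=> uv [hi uh]; split=> // x Dx.
by rewrite -(uv x Dx) -(uv 0 unit_itv0); exact: uh.
Qed.

Lemma ac_prim c h : L1 h -> ac (fun x => c + \int[mu]_(t in `[0, x]) h t) h.
Proof. by move=> hi; split=> // x Dx; rewrite set_itv1 Rintegral_set1 addr0. Qed.

Lemma ac_cst c : ac (fun=> c) (fun=> 0).
Proof.
split; first exact/cont01_L1/cont01_cst.
by move=> x _; rewrite Rintegral_cst//= mul0r addr0.
Qed.

Lemma ac_id : ac id (fun=> 1 : R).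
Proof.
split; first exact/cont01_L1/cont01_cst.
move=> x /mem_unit_itv/andP[x0 x1].
rewrite Rintegral_cst//= mul1r add0r lebesgue_measure_itv /= lte_fin.
by move: x0; rewrite le_eqVlt => /predU1P[<-|->]; rewrite ?ltxx //= oppr0 addr0.
Qed.

Lemma acD u h v k : ac u h -> ac v k -> ac (fun x => u x + v x) (fun x => h x + k x).
Proof.
move=> [hi uh] [ki vk]; split; first exact: L1D.
move=> x Dx; have /andP[x0 x1] := mem_unit_itv Dx.
by rewrite RintD01// uh// vk//; ring.
Qed.

Lemma ac_sub u h x y : ac u h -> 0 <= x -> x <= y -> y <= 1 ->
  `|u y - u x| <= \int[mu]_(t in `[x, y]) `|h t|.
Proof.
move=> uh x0 xy y1; rewrite (ac_incr uh)//.
by apply: norm_L1_itv => //; case: uh.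
Qed.

Lemma le_sub_itv h a b c d : L1 h -> (forall x, unit_itv x -> 0 <= h x) ->
  0 <= a -> a <= c -> c <= d -> d <= b -> b <= 1 ->
  \int[mu]_(t in `[c, d]) h t <= \int[mu]_(t in `[a, b]) h t.
Proof.
move=> hi h0 a0 ac cd db b1.
have hge x y : 0 <= x -> y <= 1 -> 0 <= \int[mu]_(t in `[x, y]) h t.
  move=> x0 y1; apply: Rintegral_ge0 => t /=; rewrite in_itv /= => /andP[xt ty].
  by apply/h0/unit_itvP; [exact: le_trans xt|exact: le_trans y1].
rewrite (Rintegral_itv_cat ac (le_trans cd db) (L1_itv hi a0 b1)).
rewrite (Rintegral_itv_cat cd db (L1_itv hi (le_trans a0 ac) b1)).
have h1 : 0 <= \int[mu]_(t in `[a, c]) h t.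
  by apply: hge => //; rewrite (le_trans cd)// (le_trans db).
have h2 : 0 <= \int[mu]_(t in `[d, b]) h t.
  by apply: hge => //; rewrite (le_trans a0)// (le_trans ac).
by rewrite addrCA lerDl addr_ge0.
Qed.

(** Freezing [f] at the left end point costs its oscillation times the mass of [h]. *)
Lemma norm_osc_itv f h M a b : cont01 f -> L1 h -> 0 <= a -> a <= b -> b <= 1 ->
  (forall t, a <= t <= b -> `|f t - f a| <= M) ->
  `|\int[mu]_(t in `[a, b]) (f t * h t) - f a * \int[mu]_(t in `[a, b]) h t| <=
  M * \int[mu]_(t in `[a, b]) `|h t|.
Proof.
move=> cf hi a0 ab b1 fM.
have fhi := L1M cf hi.
rewrite -RintZ01// -RintB01//; last exact: L1Z.
apply: le_trans (norm_L1_itv _ a0 b1) _; first by apply: L1B => //; exact: L1Z.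
rewrite -RintZ01//; last exact: L1_abs.
apply: le_L1_itv => //.
- by apply/L1_abs/L1B => //; exact: L1Z.
- exact/L1Z/L1_abs.
move=> x xab; rewrite -mulrBl normrM ler_wpM2r// fM//.
Qed.

(** The defect in the product rule is the product of the two increments minus two freezing errors.
    Each of the three is at most [H * K], and [3 H K <= 3 (H + K) ^ 2], whence the constant 3. *)
Lemma acM u h v k : ac u h -> ac v k ->
  ac (fun x => u x * v x) (fun x => u x * k x + v x * h x).
Proof.
move=> uh vk; have [hi _] := uh; have [ki _] := vk.
have cu := ac_cont01 uh; have cv := ac_cont01 vk.
apply: (@ac_of_quadratic _ _ _ (fun x => `|h x| + `|k x|) 3) => //.
- by apply: L1D; exact: L1M.
- by apply: L1D; exact: L1_abs.
move=> x y x0 xy y1.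
rewrite RintD01//; try exact: L1M.
rewrite RintD01//; try exact: L1_abs.
have hu := ac_sub uh x0 xy y1; have hv := ac_sub vk x0 xy y1.
set H := \int[mu]_(t in `[x, y]) `|h t| in hu *.
set K := \int[mu]_(t in `[x, y]) `|k t| in hv *.
have ou : forall t, x <= t <= y -> `|u t - u x| <= H.
  move=> t /andP[xt ty]; apply: le_trans (ac_sub uh x0 xt (le_trans ty y1)) _.
  by apply: le_sub_itv => //; exact: L1_abs.
have ov : forall t, x <= t <= y -> `|v t - v x| <= K.
  move=> t /andP[xt ty]; apply: le_trans (ac_sub vk x0 xt (le_trans ty y1)) _.
  by apply: le_sub_itv => //; exact: L1_abs.
have h1 := norm_osc_itv cu ki x0 xy y1 ou.
have h2 := norm_osc_itv cv hi x0 xy y1 ov.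
rewrite -(ac_incr vk x0 xy y1) in h1; rewrite -(ac_incr uh x0 xy y1) in h2.
move: h1 h2; set P := \int[mu]_(t in `[x, y]) (u t * k t).
set Q := \int[mu]_(t in `[x, y]) (v t * h t) => h1 h2.
have -> : u y * v y - u x * v x - (P + Q) = (u y - u x) * (v y - v x)
  - (P - u x * (v y - v x)) - (Q - v x * (u y - u x)) by ring.
have h3 : `|(u y - u x) * (v y - v x)| <= H * K by rewrite normrM ler_pM.
have H0 : 0 <= H by exact: le_trans hu.
have K0 : 0 <= K by exact: le_trans hv.
apply: le_trans (ler_normB _ _) _.
apply: le_trans (lerD (ler_normB _ _) (lexx _)) _.
apply: le_trans (lerD (lerD h3 h1) h2) _.
by rewrite -/H -/K; nra.
Qed.

(** One [C] pays for the Taylor remainder of [F], the other for freezing [F'] at the left end point;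
    hence [2 * C]. The bounds are only asked between values of [u], so [F] may be singular
    elsewhere, as [1 / sqrt] is at 0. *)
Lemma ac_comp u h F F' C : ac u h -> cont01 (fun x => F' (u x)) -> 0 <= C ->
  (forall x y, unit_itv x -> unit_itv y ->
    `|F (u y) - F (u x) - F' (u x) * (u y - u x)| <= C * `|u y - u x| ^+ 2 /\
    `|F' (u y) - F' (u x)| <= C * `|u y - u x|) ->
  ac (fun x => F (u x)) (fun x => F' (u x) * h x).
Proof.
move=> uh cF C0 HF; have [hi _] := uh.
apply: (@ac_of_quadratic _ _ _ (fun x => `|h x|) (2 * C)) => //.
- exact: L1M.
- exact: L1_abs.
- by rewrite mulr_ge0.
move=> x y x0 xy y1.
have Dx : unit_itv x by apply: unit_itvP => //; exact: le_trans y1.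
have Dy : unit_itv y by apply: unit_itvP => //; exact: le_trans xy.
set H := \int[mu]_(t in `[x, y]) `|h t|.
have ou : forall t, x <= t <= y -> `|u t - u x| <= H.
  move=> t /andP[xt ty]; apply: le_trans (ac_sub uh x0 xt (le_trans ty y1)) _.
  by apply: le_sub_itv => //; exact: L1_abs.
have oF : forall t, x <= t <= y -> `|F' (u t) - F' (u x)| <= C * H.
  move=> t /andP[xt ty].
  have Dt : unit_itv t by apply: unit_itvP; [exact: le_trans xt|exact: le_trans y1].
  apply: le_trans (HF _ _ Dx Dt).2 _; rewrite ler_wpM2l// ou ?xt//.
have h1 := norm_osc_itv cF hi x0 xy y1 oF.
rewrite -(ac_incr uh x0 xy y1) -/H in h1.
have [h2 _] := HF _ _ Dx Dy.
have hy : `|u y - u x| <= H by rewrite ou// xy lexx.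
have H0 : 0 <= H by exact: le_trans hy.
have h3 : `|u y - u x| ^+ 2 <= H ^+ 2 by rewrite lerXn2r ?nnegrE.
set P := \int[mu]_(t in `[x, y]) _ in h1 *.
have -> : F (u y) - F (u x) - P = (F (u y) - F (u x) - F' (u x) * (u y - u x))
  - (P - F' (u x) * (u y - u x)) by ring.
apply: le_trans (ler_normB _ _) _; apply: le_trans (lerD h2 h1) _.
have h4 := ler_wpM2l C0 h3.
rewrite expr2 in h4 *; lra.
Qed.

Lemma acZ c u h : ac u h -> ac (fun x => c * u x) (fun x => c * h x).
Proof.
move=> uh; have [hi _] := uh; split; first exact: L1Z.
move=> x /mem_unit_itv/andP[x0 x1].
by rewrite RintZ01// -mulrDr; congr (_ * _); case: uh => _; apply; exact: unit_itvP.
Qed.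

(** The difference [h - k] has zero primitive. Extended by zero to the line, it is recovered almost
    everywhere from that primitive by Lebesgue's differentiation theorem. *)
Lemma ac_ae_unique u h k : ac u h -> ac u k ->
  {ae mu, forall x, unit_itv x -> h x = k x}.
Proof.
move=> [hi uh] [ki uk].
pose f := (fun x => h x - k x); have fi : L1 f by exact: L1B.
have f0 x : x <= 1 -> \int[mu]_(t in `[0, x]) f t = 0.
  move=> x1; case: (leP 0 x) => x0; last first.
    by rewrite set_itv_ge ?bnd_simp -?ltNge// Rintegral_set0.
  rewrite RintB01//; apply/eqP; rewrite subr_eq0; apply/eqP.
  apply: (@addrI _ (u 0)); have Dx := unit_itvP x0 x1; by rewrite -(uh x Dx) -(uk x Dx).
pose f1 := f \_ unit_itv.
have f1i : mu.-integrable setT (EFin \o f1).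
  by rewrite -restrict_EFin; apply/integrable_restrict; [exact: measurable_unit_itv|exact: measurableT|rewrite setTI].
have F0 : (fun x => \int[mu]_(t in [set` `]-oo, x]]) f1 t) = cst 0.
  apply/funext => x; rewrite /f1 -Rintegral_mkcondr.
  rewrite (_ : _ `&` _ = `[0, Num.min x 1]%classic); first by apply: f0; rewrite ge_min lexx orbT.
  apply/seteqP; split => t /=; rewrite !in_itv /= le_min.
    by move=> [-> /mem_unit_itv/andP[-> ->]].
  by move=> /andP[t0 /andP[-> t1]]; split=> //; exact: unit_itvP.
have := @FTC1Ny R f1; rewrite /= F0.
have f1y y : mu.-integrable `]-oo, y] (EFin \o f1) by apply: integrableS f1i.
move=> /(_ f1y).
move=> /(_ (integrable_locally (@measurable_unit_itv R) fi)).
apply: ae_imp => x [_]; rewrite derive1_cst /f1 patchE => + Dx.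
by rewrite mem_set// => /esym/eqP; rewrite subr_eq0 => /eqP.
Qed.

Lemma ae_Rint_eq f g : L1 f -> measurable_fun unit_itv g ->
  {ae mu, forall x, unit_itv x -> f x = g x} ->
  L1 g /\ forall a b, 0 <= a -> b <= 1 ->
  \int[mu]_(t in `[a, b]) f t = \int[mu]_(t in `[a, b]) g t.
Proof.
move=> fi mg fg; split.
  apply/integrableP; split; first exact/measurable_EFinP.
  have /integrableP[_] := fi.
  rewrite (@ae_eq_integral _ _ _ mu unit_itv (fun x => `|(g x)%:E|%E))//.
  - apply/measurableT_comp => //; apply/measurable_EFinP; exact: L1_meas.
  - by apply/measurableT_comp => //; apply/measurable_EFinP.
  - by move: fg; apply: ae_imp => x fgx Dx; rewrite /= fgx.
move=> a b a0 b1; congr fine; apply: ae_eq_integral => //.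
- apply: measurable_funS (sub_unit_itv a0 b1) _ => //; apply/measurable_EFinP; exact: L1_meas.
- by apply: measurable_funS (sub_unit_itv a0 b1) _ => //; apply/measurable_EFinP.
- by move: fg; apply: ae_imp => x fgx Dx; rewrite fgx//; exact: (sub_unit_itv a0 b1).
Qed.

Lemma ac_ae u h k : ac u h -> measurable_fun unit_itv k ->
  {ae mu, forall x, unit_itv x -> h x = k x} -> ac u k.
Proof.
move=> [hi uh] mk hk; have [ki E] := ae_Rint_eq hi mk hk; split=> // x Dx.
by rewrite uh// E//; case/andP: (mem_unit_itv Dx).
Qed.

End ACcalculus.

(** * First variation of the energy *)

Section Variation.
Variable R : realType.
Local Notation mu := (@lebesgue_measure R).
Local Hint Extern 0 (measurable unit_itv) => exact: measurable_unit_itv : core.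
Implicit Types (f g h k u v w p F G : R -> R) (a b c d x y e C : R).

Lemma is_derive_under_integral (D : set R) (f f' : R -> R -> R) (G : R -> R) a b c :
  measurable D -> a < c < b ->
  (forall e, a < e < b -> mu.-integrable D (EFin \o f e)) ->
  (forall e x, a < e < b -> D x -> is_derive e 1 (f ^~ x) (f' e x)) ->
  (forall x, 0 <= G x) -> mu.-integrable D (EFin \o G) ->
  (forall e x, a < e < b -> D x -> `|f' e x| <= G x) ->
  is_derive c 1 (fun e => \int[mu]_(x in D) f e x) (\int[mu]_(x in D) f' c x).
Proof.
move=> mD acb fi fd G0 Gi fG.
have I e : e \in `]a, b[ -> a < e < b by rewrite in_itv.
have dE e x : a < e < b -> D x -> partial1of2 f e x = f' e x.
  by move=> eI Dx; rewrite partial1of2E; have [_ ->] := fd e x eI Dx.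
have fi' e : e \in `]a, b[ -> mu.-integrable D (EFin \o f e) by move=> /I; exact: fi.
have fd' e x : e \in `]a, b[ -> D x -> derivable (f ^~ x) e 1.
  by move=> /I eI Dx; have [] := fd e x eI Dx.
have fG' e x : e \in `]a, b[ -> D x -> `|partial1of2 f e x| <= G x.
  by move=> /I eI Dx; rewrite dE// fG.
have Ic : c \in `]a, b[ by rewrite in_itv.
have H1 : derivable (fun e => \int[mu]_(x in D) f e x) c 1.
  exact: (@derivable_under_integral R _ _ mu f D mD c a b Ic fi' fd' G G0 Gi fG').
apply: DeriveDef; first exact: H1.
rewrite -derive1E (@differentiation_under_integral R _ _ mu f D mD c a b Ic fi' fd' G G0 Gi fG').
by apply: eq_Rintegral => x; rewrite inE => Dx; exact: dE.
Qed.

Definition L2 f := measurable_fun unit_itv f /\ L1 (fun x => f x ^+ 2).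

Lemma L2_mul f g : L2 f -> L2 g -> L1 (fun x => f x * g x).
Proof.
move=> [mf f2] [mg g2]; apply: le_L1 (L1D f2 g2) _.
  exact: measurable_funM.
move=> x _; rewrite (ger0_norm (addr_ge0 (sqr_ge0 _) (sqr_ge0 _))) normrM.
rewrite -(ger0_norm (sqr_ge0 (f x))) -(ger0_norm (sqr_ge0 (g x))) !normrX.
have := sqr_ge0 (`|f x| - `|g x|); have := normr_ge0 (f x); have := normr_ge0 (g x).
by nra.
Qed.

Lemma cont01_L2 f : cont01 f -> L2 f.
Proof. by move=> cf; split; [exact: cont01_meas|exact/cont01_L1/cont01X]. Qed.

Lemma L2_L1 f : L2 f -> L1 f.
Proof.
move=> f2; have := L2_mul (cont01_L2 (cont01_cst 1)) f2.
by apply: eq_L1 => x _; rewrite mul1r.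
Qed.

Lemma L2M f g : cont01 f -> L2 g -> L2 (fun x => f x * g x).
Proof.
move=> cf [mg g2]; split.
  by apply: measurable_funM => //; exact: cont01_meas.
have := L1M (cont01X 2 cf) g2; apply: eq_L1 => x _; by rewrite exprMn.
Qed.

Lemma L2D f g : L2 f -> L2 g -> L2 (fun x => f x + g x).
Proof.
move=> f2 g2; have fg := L2_mul f2 g2; move: f2 g2 => [mf f2] [mg g2].
split; first exact: measurable_funD.
have := L1D (L1D f2 g2) (L1Z 2 fg); apply: eq_L1 => x _; by ring.
Qed.

Lemma L2Z c f : L2 f -> L2 (fun x => c * f x).
Proof. by apply: L2M; exact: cont01_cst. Qed.

Lemma L2B f g : L2 f -> L2 g -> L2 (fun x => f x - g x).
Proof.
move=> f2 g2; have := L2D f2 (L2Z (-1) g2).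
by rewrite (_ : (fun x => f x + -1 * g x) = (fun x => f x - g x))//; apply/funext => x; rewrite mulN1r.
Qed.

Lemma L2_abs f : L2 f -> L2 (fun x => `|f x|).
Proof.
move=> [mf f2]; split; first exact: measurableT_comp.
by apply: eq_L1 f2 => x _; rewrite -normrX ger0_norm// sqr_ge0.
Qed.

Lemma W22_witP u v h : W22_wit u v h <-> [/\ L2 h, ac v h & ac u v].
Proof.
split=> [[mh [h2 [vh uv]]]|[[mh h2] [hi vh] [vi uv]]].
  have l2 : L2 h.
    split=> //; apply/integrableP; split.
      by apply/measurable_EFinP; exact: measurable_funX.
    apply: le_lt_trans h2; rewrite le_eqVlt; apply/orP; left; apply/eqP.
    by apply: eq_integral => x _; rewrite /= ger0_norm// sqr_ge0.
  have avh : ac v h.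
    split; first exact: L2_L1.
    by move=> x /mem_unit_itv; exact: vh.
  split=> //; split; first exact/cont01_L1/(ac_cont01 avh).
  by move=> x /mem_unit_itv; exact: uv.
split=> //; split; last by split=> x /andP[x0 x1]; [apply: vh|apply: uv]; exact: unit_itvP.
have /integrableP[_] := h2; apply: le_lt_trans.
rewrite le_eqVlt; apply/orP; left; apply/eqP.
by apply: eq_integral => x _; rewrite /= ger0_norm// sqr_ge0.
Qed.

Lemma ac_derive_unique u v w : ac u v -> ac u w -> cont01 v -> cont01 w ->
  forall x, unit_itv x -> v x = w x.
Proof.
move=> uv uw cv cw x Dx; apply/eqP; rewrite -subr_eq0; apply/eqP.
apply: (@ae_cont01_eq0 R (fun x => v x - w x)) Dx => //; first exact: cont01B.
have := ac_ae_unique uv uw.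
by apply: ae_imp => y vw Dy; rewrite vw// subrr.
Qed.

Lemma W22_wit_eq u v h w k : W22_wit u v h -> W22_wit u w k ->
  (forall x, unit_itv x -> v x = w x) /\ {ae mu, forall x, unit_itv x -> h x = k x}.
Proof.
move=> /W22_witP[h2 vh uv] /W22_witP[k2 wk uw].
have vw := ac_derive_unique uv uw (ac_cont01 vh) (ac_cont01 wk).
split=> //; apply: ac_ae_unique vh _.
by apply: eq_ac wk => x Dx; rewrite vw.
Qed.

(** [d1] and [d2] are chosen independently of each other, so a priori they belong to two different
    witnesses; uniqueness of the continuous first derivative lets them be combined. *)
Lemma W22_wit_d u : W22 u -> W22_wit u (d1 u) (d2 u).
Proof.
move=> [v [h w]].
have [k dk] : exists h, W22_wit u (d1 u) h.
  have := @xgetPex _ (fun=> 0) [set u1 | exists h, W22_wit u u1 h].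
  by apply; exists v, h.
have [v' dv] : exists v, W22_wit u v (d2 u).
  have := @xgetPex _ (fun=> 0) [set h | exists u1, W22_wit u u1 h].
  by apply; exists h, v.
have [E _] := W22_wit_eq dv dk.
apply/W22_witP; have /W22_witP[? ? ?] := dk; have /W22_witP[? vd ?] := dv.
by split; [|exact: eq_ac E vd|].
Qed.

Lemma W22_wit_add u v h u' v' h' e : W22_wit u v h -> W22_wit u' v' h' ->
  W22_wit (fun x => u x + e * u' x) (fun x => v x + e * v' x) (fun x => h x + e * h' x).
Proof.
move=> /W22_witP[h2 vh uv] /W22_witP[h2' vh' uv']; apply/W22_witP.
by split; [apply: L2D => //; exact: L2Z|apply: acD => //; exact: acZ|apply: acD => //; exact: acZ].
Qed.

Lemma L2_cross v1 v2 h1 h2 : cont01 v1 -> cont01 v2 -> L2 h1 -> L2 h2 ->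
  L2 (fun x => v1 x * h2 x - v2 x * h1 x).
Proof. by move=> *; apply: L2B; exact: L2M. Qed.

(** The choices [d1] and [d2] made for [cvar g eta e] have no formula in [e]. Computing the energy
    from any witness turns [Elam lam (cvar g eta e)] into an explicit function of [e]. *)
Lemma Elam_wit (lam : R) (g : R -> R * R) v1 v2 h1 h2 :
  W22_wit (fun x => (g x).1) v1 h1 -> W22_wit (fun x => (g x).2) v2 h2 ->
  (forall x, unit_itv x -> 0 < v1 x ^+ 2 + v2 x ^+ 2) ->
  Elam lam g =
  \int[mu]_(x in `[0, 1]) (((v1 x * h2 x - v2 x * h1 x) / Num.sqrt (v1 x ^+ 2 + v2 x ^+ 2) ^+ 3) ^+ 2
     * Num.sqrt (v1 x ^+ 2 + v2 x ^+ 2))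
  + lam * \int[mu]_(x in `[0, 1]) Num.sqrt (v1 x ^+ 2 + v2 x ^+ 2).
Proof.
move=> W1 W2 imm.
have bendL1 w1 w2 k1 k2 : cont01 w1 -> cont01 w2 -> L2 k1 -> L2 k2 ->
    (forall x, unit_itv x -> 0 < w1 x ^+ 2 + w2 x ^+ 2) ->
    L1 (fun x => ((w1 x * k2 x - w2 x * k1 x) / Num.sqrt (w1 x ^+ 2 + w2 x ^+ 2) ^+ 3) ^+ 2
     * Num.sqrt (w1 x ^+ 2 + w2 x ^+ 2)).
  move=> c1 c2 k12 k22 w0.
  have cs : cont01 (fun x => Num.sqrt (w1 x ^+ 2 + w2 x ^+ 2)).
    by apply: cont01_sqrt; apply: cont01D; exact: cont01X.
  have cv : cont01 (fun x => (Num.sqrt (w1 x ^+ 2 + w2 x ^+ 2) ^+ 3)^-1).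
    apply: cont01V; first exact: cont01X.
    by move=> x Dx; rewrite expf_neq0// gt_eqF// sqrtr_gt0 w0.
  have := L1M cs (L2M cv (L2_cross c1 c2 k12 k22)).2.
  by apply: eq_L1 => x _; rewrite mulrC; congr (_ ^+ 2 * _); rewrite mulrC.
have D1 := W22_wit_d (ex_intro _ v1 (ex_intro _ h1 W1)).
have D2 := W22_wit_d (ex_intro _ v2 (ex_intro _ h2 W2)).
have [E1 H1] := W22_wit_eq W1 D1; have [E2 H2] := W22_wit_eq W2 D2.
move: W1 W2 D1 D2 => /W22_witP[h12 /ac_cont01 c1 _] /W22_witP[h22 /ac_cont01 c2 _].
move=> /W22_witP[dh12 /ac_cont01 dc1 _] /W22_witP[dh22 /ac_cont01 dc2 _].
rewrite /Elam; congr (_ + lam * _); last first.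
  by apply: eq_Rintegral => x; rewrite inE => Dx; rewrite /speed -E1// -E2.
have dimm x : unit_itv x -> 0 < d1 (fun x => (g x).1) x ^+ 2 + d1 (fun x => (g x).2) x ^+ 2.
  by move=> Dx; rewrite -E1// -E2// imm.
have mb := L1_meas (bendL1 _ _ _ _ dc1 dc2 dh12 dh22 dimm).
have /(_ _ mb)[|_ /(_ 0 1 (lexx _) (lexx _)) //] := ae_Rint_eq (bendL1 _ _ _ _ c1 c2 h12 h22 imm).
move: H1 H2; apply: ae_imp2 => x H1 H2 Dx.
by rewrite E1// E2// H1// H2.
Qed.

End Variation.

(** * Pointwise derivatives of the energy densities, and their domination *)

Section FirstVariation.
Variable R : realType.
Local Notation mu := (@lebesgue_measure R).
Local Hint Extern 0 (measurable unit_itv) => exact: measurable_unit_itv : core.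
Implicit Types (f g h k u v w p F G : R -> R) (a b c d x y e C M : R).

(* At one parameter: [(a, b)] stands for the first two derivatives of the curve,
   [(c, d)] for those of the variation. *)
Definition vlen (a1 a2 c1 c2 e : R) : R :=
  Num.sqrt ((a1 + e * c1) ^+ 2 + (a2 + e * c2) ^+ 2).
Definition vcross (a1 a2 b1 b2 c1 c2 d1 d2 e : R) : R :=
  (a1 + e * c1) * (b2 + e * d2) - (a2 + e * c2) * (b1 + e * d1).
Definition dvlen (a1 a2 c1 c2 e : R) : R :=
  ((a1 + e * c1) * c1 + (a2 + e * c2) * c2) / vlen a1 a2 c1 c2 e.
Definition dvcross (a1 a2 b1 b2 c1 c2 d1 d2 e : R) : R :=
  ((a1 + e * c1) * d2 + (b2 + e * d2) * c1) -
  ((a2 + e * c2) * d1 + (b1 + e * d1) * c2).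
(** The bending density [(N / r ^ 3) ^ 2 * r] is [N ^ 2 / r ^ 5]; this is its derivative in [e]. *)
Definition dvbend (a1 a2 b1 b2 c1 c2 d1 d2 e : R) : R :=
  let N := vcross a1 a2 b1 b2 c1 c2 d1 d2 e in
  let r := vlen a1 a2 c1 c2 e in
  2 * N * dvcross a1 a2 b1 b2 c1 c2 d1 d2 e / r ^+ 5
  - 5 * N ^+ 2 * dvlen a1 a2 c1 c2 e / r ^+ 6.

Lemma is_derive_affine a c e : deriv_at (fun e => a + e * c) e c.
Proof.
apply: deriv_at_eq.
  by apply: derivD; [exact: deriv_cst|apply: derivM; [exact: deriv_id|exact: deriv_cst]].
by rewrite /=; ring.
Qed.

Lemma is_derive_vlen a1 a2 c1 c2 e : 0 < (a1 + e * c1) ^+ 2 + (a2 + e * c2) ^+ 2 ->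
  deriv_at (vlen a1 a2 c1 c2) e (dvlen a1 a2 c1 c2 e).
Proof.
move=> S0; apply: deriv_at_eq.
  apply: deriv_sqrt; first exact: S0.
  by apply: derivD; apply: derivX; exact: is_derive_affine.
rewrite /dvlen /vlen.
have r0 : Num.sqrt ((a1 + e * c1) ^+ 2 + (a2 + e * c2) ^+ 2) != 0.
  by rewrite gt_eqF// sqrtr_gt0.
by rewrite /= !expr1; field.
Qed.

Lemma is_derive_vbend a1 a2 b1 b2 c1 c2 d1 d2 e :
  0 < (a1 + e * c1) ^+ 2 + (a2 + e * c2) ^+ 2 ->
  deriv_at (fun e => (vcross a1 a2 b1 b2 c1 c2 d1 d2 e / vlen a1 a2 c1 c2 e ^+ 3) ^+ 2
     * vlen a1 a2 c1 c2 e) e (dvbend a1 a2 b1 b2 c1 c2 d1 d2 e).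
Proof.
move=> S0.
have r0 : vlen a1 a2 c1 c2 e != 0 by rewrite gt_eqF// sqrtr_gt0.
have dN : deriv_at (vcross a1 a2 b1 b2 c1 c2 d1 d2) e (dvcross a1 a2 b1 b2 c1 c2 d1 d2 e).
  by apply: derivB; apply: derivM; exact: is_derive_affine.
have dr := is_derive_vlen S0.
apply: deriv_at_eq.
  apply: derivM; last exact: dr.
  apply: derivX; apply: derivM; first exact: dN.
  apply: derivV; first by rewrite expf_neq0.
  apply: derivX; exact: dr.
rewrite /dvbend /=.
move: r0; set r := vlen _ _ _ _ _; set N := vcross _ _ _ _ _ _ _ _ _.
set N' := dvcross _ _ _ _ _ _ _ _ _; set r' := dvlen _ _ _ _ _ => r0.
by field.
Qed.

(** The bound is uniform in [e]: [N] is at most [4 M Q], its derivative at most [6 M Q], and the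
    numerator [V] of [dvlen] at most [4 M ^ 2]. It is quadratic in the second derivatives, hence
    integrable when these are square integrable. *)
Lemma dvbend_bound M (r0 : R) a1 a2 b1 b2 c1 c2 d1 d2 e : 0 < r0 ->
  `|a1| <= M -> `|a2| <= M -> `|c1| <= M -> `|c2| <= M -> `|e| <= 1 ->
  r0 <= vlen a1 a2 c1 c2 e ->
  `|dvbend a1 a2 b1 b2 c1 c2 d1 d2 e| <=
  (48 * M ^+ 2 / r0 ^+ 5 + 320 * M ^+ 4 / r0 ^+ 7) * (`|b1| + `|b2| + `|d1| + `|d2|) ^+ 2.
Proof.
move=> r00 a1M a2M c1M c2M e1 r0r.
set Q := `|b1| + `|b2| + `|d1| + `|d2|.
set r := vlen _ _ _ _ _ in r0r *.
have M0 : 0 <= M by exact: le_trans a1M.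
have rp : 0 < r by exact: lt_le_trans r0r.
have ac' a c : `|a| <= M -> `|c| <= M -> `|a + e * c| <= 2 * M.
  move=> aM cM; apply: le_trans (ler_normD _ _) _; rewrite normrM.
  have : `|e| * `|c| <= 1 * M by apply: ler_pM.
  by lra.
have bd b d : `|b + e * d| <= `|b| + `|d|.
  apply: le_trans (ler_normD _ _) _; rewrite normrM lerD2l.
  by have := ler_wpM2r (normr_ge0 d) e1; rewrite mul1r.
have Q0 : 0 <= Q by rewrite !addr_ge0.
have [k1 k2] : `|b1 + e * d1| <= Q /\ `|b2 + e * d2| <= Q.
  have := bd b1 d1; have := bd b2 d2; rewrite /Q.
  have := normr_ge0 b1; have := normr_ge0 b2; have := normr_ge0 d1; have := normr_ge0 d2.
  by split; lra.
have [q1 q2] : `|d1| <= Q /\ `|d2| <= Q.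
  rewrite /Q; have := normr_ge0 b1; have := normr_ge0 b2; have := normr_ge0 d1.
  have := normr_ge0 d2; by split; lra.
have l1 := ac' _ _ a1M c1M; have l2 := ac' _ _ a2M c2M.
have mm (x y A B : R) : `|x| <= A -> `|y| <= B -> `|x * y| <= A * B.
  by move=> xA yB; rewrite normrM ler_pM.
rewrite /dvbend -/r.
set N := vcross _ _ _ _ _ _ _ _ _; set N' := dvcross _ _ _ _ _ _ _ _ _.
have N4 : `|N| <= 4 * M * Q.
  apply: le_trans (ler_normB _ _) _.
  have := mm _ _ _ _ l1 k2; have := mm _ _ _ _ l2 k1; lra.
have N6 : `|N'| <= 6 * M * Q.
  apply: le_trans (ler_normB _ _) _.
  apply: le_trans (lerD (ler_normD _ _) (ler_normD _ _)) _.
  have := mm _ _ _ _ l1 q2; have := mm _ _ _ _ l2 q1.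
  have := mm _ _ _ _ k2 c1M; have := mm _ _ _ _ k1 c2M; lra.
pose V := (a1 + e * c1) * c1 + (a2 + e * c2) * c2.
have V4 : `|V| <= 4 * M ^+ 2.
  apply: le_trans (ler_normD _ _) _.
  have := mm _ _ _ _ l1 c1M; have := mm _ _ _ _ l2 c2M; rewrite expr2; lra.
have -> : 2 * N * N' / r ^+ 5 - 5 * N ^+ 2 * dvlen a1 a2 c1 c2 e / r ^+ 6 =
    2 * (N * N') / r ^+ 5 - 5 * (N * N * V) / r ^+ 7.
  rewrite /dvlen -/r -/V; have r0' : r != 0 by rewrite gt_eqF.
  by field.
have ir n : 0 <= (r ^+ n)^-1 <= (r0 ^+ n)^-1.
  rewrite invr_ge0 exprn_ge0 ?(ltW rp)//= lef_pV2 ?posrE ?exprn_gt0//.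
  by rewrite lerXn2r// nnegrE ltW.
have fr (x A : R) n : `|x| <= A -> `|x / r ^+ n| <= A / r0 ^+ n.
  move=> xA; have /andP[i0 i1] := ir n.
  by rewrite normrM (ger0_norm i0) ler_pM.
have B1 : `|2 * (N * N')| <= 48 * M ^+ 2 * Q ^+ 2.
  rewrite normrM (@ger0_norm _ 2)//.
  have := mm _ _ _ _ N4 N6; rewrite !expr2; lra.
have B2 : `|5 * (N * N * V)| <= 320 * M ^+ 4 * Q ^+ 2.
  rewrite normrM (@ger0_norm _ 5)//.
  have := mm _ _ _ _ (mm _ _ _ _ N4 N4) V4.
  rewrite (_ : 4 * M * Q * (4 * M * Q) * (4 * M ^+ 2) = 64 * M ^+ 4 * Q ^+ 2); last by ring.
  lra.
apply: le_trans (ler_normB _ _) _.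
apply: le_trans (lerD (fr _ _ 5%N B1) (fr _ _ 7%N B2)) _.
by rewrite le_eqVlt; apply/orP; left; apply/eqP; ring.
Qed.

End FirstVariation.

(** * Differentiation of the energy under the integral sign, and the du Bois-Reymond lemma *)

Section EulerLagrange.
Variable R : realType.
Local Notation mu := (@lebesgue_measure R).
Local Hint Extern 0 (measurable unit_itv) => exact: measurable_unit_itv : core.
Implicit Types (f g h k u v w p F G : R -> R) (a b c d x y e C M : R).

Lemma cont01_pos_min f : cont01 f -> (forall x, unit_itv x -> 0 < f x) ->
  exists2 m : R, 0 < m & forall x, unit_itv x -> m <= f x.
Proof.
move=> cf f0; have [c c01 fc] := EVT_min (@ler01 R) cf.
by exists (f c); [exact: f0|move=> x Dx; exact: fc].
Qed.

(** The cross term in the expanded squares is at most [4 |e| M ^ 2], that is, at most [m / 2]. *)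
Lemma perturbed_speed_ge m M a1 a2 c1 c2 e : 
  m <= a1 ^+ 2 + a2 ^+ 2 -> `|a1| <= M -> `|a2| <= M -> `|c1| <= M -> `|c2| <= M ->
  `|e| * (8 * M ^+ 2) <= m ->
  m / 2 <= (a1 + e * c1) ^+ 2 + (a2 + e * c2) ^+ 2.
Proof.
move=> hm a1M a2M c1M c2M em.
have M0 : 0 <= M by exact: le_trans a1M.
have h (x y : R) : `|x| <= M -> `|y| <= M -> `|e| * `|x * y| <= `|e| * M ^+ 2.
  by move=> xM yM; rewrite ler_wpM2l// normrM expr2 ler_pM.
have := h _ _ a1M c1M; have := h _ _ a2M c2M; rewrite -!normrM.
rewrite !ler_norml => /andP[h1 _] /andP[h2 _].
have := sqr_ge0 (e * c1); have := sqr_ge0 (e * c2).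
by nra.
Qed.

Lemma dvbend_const_ge0 M (r : R) : 0 < M -> 0 < r ->
  0 <= 48 * M ^+ 2 / r ^+ 5 + 320 * M ^+ 4 / r ^+ 7.
Proof.
move=> M0 r0.
have hM n : 0 <= M ^+ n by apply/exprn_ge0/ltW.
have hr n : 0 <= (r ^+ n)^-1 by rewrite invr_ge0; apply/exprn_ge0/ltW.
apply: addr_ge0; apply: mulr_ge0; [|exact: hr| |exact: hr];
  by apply: mulr_ge0; [exact: ler0n|exact: hM].
Qed.

Lemma dvlen_const_ge0 M (r : R) : 0 < r -> 0 <= 4 * M ^+ 2 / r.
Proof.
move=> r0; apply: mulr_ge0; last by rewrite invr_ge0 ltW.
by apply: mulr_ge0; [exact: ler0n|exact: sqr_ge0].
Qed.

Lemma first_variation (lam : R) (g eta : R -> R * R) v1 v2 h1 h2 w1 w2 p1 p2 :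
  W22_wit (fun x => (g x).1) v1 h1 -> W22_wit (fun x => (g x).2) v2 h2 ->
  W22_wit (fun x => (eta x).1) w1 p1 -> W22_wit (fun x => (eta x).2) w2 p2 ->
  (forall x, unit_itv x -> 0 < v1 x ^+ 2 + v2 x ^+ 2) ->
  is_derive (0 : R) 1 (fun e => Elam lam (cvar g eta e))
   (\int[mu]_(x in `[0, 1])
      dvbend (v1 x) (v2 x) (h1 x) (h2 x) (w1 x) (w2 x) (p1 x) (p2 x) 0 +
    lam * \int[mu]_(x in `[0, 1]) dvlen (v1 x) (v2 x) (w1 x) (w2 x) 0).
Proof.
move=> W1 W2 E1 E2 imm.
have /W22_witP[h12 /ac_cont01 cv1 _] := W1; have /W22_witP[h22 /ac_cont01 cv2 _] := W2.
have /W22_witP[p12 /ac_cont01 cw1 _] := E1; have /W22_witP[p22 /ac_cont01 cw2 _] := E2.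
have [m m0 vm] := cont01_pos_min (cont01D (cont01X 2 cv1) (cont01X 2 cv2)) imm.
have [M [M0 Mv1 Mv2 Mw1 Mw2]] : exists M, [/\ 0 < M,
   forall x, unit_itv x -> `|v1 x| <= M, forall x, unit_itv x -> `|v2 x| <= M,
   forall x, unit_itv x -> `|w1 x| <= M & forall x, unit_itv x -> `|w2 x| <= M].
  have [M1 M10 B1] := cont01_bounded cv1; have [M2 M20 B2] := cont01_bounded cv2.
  have [M3 M30 B3] := cont01_bounded cw1; have [M4 M40 B4] := cont01_bounded cw2.
  exists (M1 + M2 + M3 + M4); split; first by rewrite !addr_gt0.
  - by move=> x /B1; lra.
  - by move=> x /B2; lra.
  - by move=> x /B3; lra.
  - by move=> x /B4; lra.
(* Within [e0] of 0 the squared speed stays above [m / 2], so the varied curves remain immersed; the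
   cap 1 provides [|e| <= 1] for the dominations. *)
pose e0 := Num.min 1 (m / (8 * M ^+ 2)).
have M2 : 0 < 8 * M ^+ 2 by rewrite mulr_gt0// exprn_gt0.
have e00 : 0 < e0 by rewrite lt_min ltr01 divr_gt0.
have Sge e x : - e0 < e < e0 -> unit_itv x ->
    m / 2 <= (v1 x + e * w1 x) ^+ 2 + (v2 x + e * w2 x) ^+ 2.
  rewrite -ltr_norml lt_min => /andP[_ /ltW em] Dx.
  apply: (@perturbed_speed_ge m M); rewrite ?Mv1 ?Mv2 ?Mw1 ?Mw2 ?vm//.
  by rewrite -ler_pdivlMr.
have m20 : 0 < m / 2 by rewrite divr_gt0.
have Sgt e x : - e0 < e < e0 -> unit_itv x ->
    0 < (v1 x + e * w1 x) ^+ 2 + (v2 x + e * w2 x) ^+ 2.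
  by move=> eI Dx; apply: lt_le_trans (Sge e x eI Dx).
pose r0 := Num.sqrt (m / 2).
have r00 : 0 < r0 by rewrite sqrtr_gt0.
have rge e x : - e0 < e < e0 -> unit_itv x -> r0 <= vlen (v1 x) (v2 x) (w1 x) (w2 x) e.
  by move=> eI Dx; rewrite ler_wsqrtr// Sge.
have cS e : cont01 (fun x => vlen (v1 x) (v2 x) (w1 x) (w2 x) e).
  apply: cont01_sqrt; apply: cont01D; apply: cont01X; apply: cont01D => //;
    apply: cont01M => //; exact: cont01_cst.
have E0 e : - e0 < e < e0 -> Elam lam (cvar g eta e) =
   \int[mu]_(x in `[0, 1]) ((vcross (v1 x) (v2 x) (h1 x) (h2 x) (w1 x) (w2 x) (p1 x) (p2 x) e
     / vlen (v1 x) (v2 x) (w1 x) (w2 x) e ^+ 3) ^+ 2 * vlen (v1 x) (v2 x) (w1 x) (w2 x) e)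
   + lam * \int[mu]_(x in `[0, 1]) vlen (v1 x) (v2 x) (w1 x) (w2 x) e.
  move=> eI.
  by rewrite (@Elam_wit _ lam (cvar g eta e) _ _ _ _ (W22_wit_add e W1 E1) (W22_wit_add e W2 E2)
    (fun x Dx => Sgt e x eI Dx)).
have dbend : is_derive (0 : R) 1 (fun e =>
   \int[mu]_(x in `[0, 1]) ((vcross (v1 x) (v2 x) (h1 x) (h2 x) (w1 x) (w2 x) (p1 x) (p2 x) e
     / vlen (v1 x) (v2 x) (w1 x) (w2 x) e ^+ 3) ^+ 2 * vlen (v1 x) (v2 x) (w1 x) (w2 x) e))
   (\int[mu]_(x in `[0, 1])
      dvbend (v1 x) (v2 x) (h1 x) (h2 x) (w1 x) (w2 x) (p1 x) (p2 x) 0).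
  apply: (@is_derive_under_integral R unit_itv
    (fun e x => (vcross (v1 x) (v2 x) (h1 x) (h2 x) (w1 x) (w2 x) (p1 x) (p2 x) e
     / vlen (v1 x) (v2 x) (w1 x) (w2 x) e ^+ 3) ^+ 2 * vlen (v1 x) (v2 x) (w1 x) (w2 x) e)
    (fun e x => dvbend (v1 x) (v2 x) (h1 x) (h2 x) (w1 x) (w2 x) (p1 x) (p2 x) e)
    (fun x => (48 * M ^+ 2 / r0 ^+ 5 + 320 * M ^+ 4 / r0 ^+ 7) *
       (`|h1 x| + `|h2 x| + `|p1 x| + `|p2 x|) ^+ 2) (- e0) e0 0).
  - exact: measurable_unit_itv.
  - by rewrite oppr_lt0 e00.
  - move=> e eI.
    have cv : cont01 (fun x => (vlen (v1 x) (v2 x) (w1 x) (w2 x) e ^+ 3)^-1).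
      apply: cont01V; first exact: cont01X.
      by move=> x Dx; rewrite expf_neq0// gt_eqF// (lt_le_trans r00)// rge.
    have l2 : L2 (fun x => vcross (v1 x) (v2 x) (h1 x) (h2 x) (w1 x) (w2 x) (p1 x) (p2 x) e).
      apply: L2_cross; [| |exact: L2D (L2Z _ _)|exact: L2D (L2Z _ _)];
      by apply: cont01D => //; apply: cont01M => //; exact: cont01_cst.
    have := L1M (cS e) (L2M cv l2).2.
    apply: eq_L1 => x _; rewrite mulrC; congr (_ ^+ 2 * _); by rewrite mulrC.
  - by move=> e x eI Dx; apply: is_derive_vbend; exact: Sgt.
  - move=> x; apply: mulr_ge0; last exact: sqr_ge0.
    exact: dvbend_const_ge0 M0 r00.
  - by apply: L1Z; apply: (proj2 (L2D (L2D (L2D (L2_abs h12) (L2_abs h22)) (L2_abs p12)) (L2_abs p22))).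
  - move=> e x eI Dx; apply: dvbend_bound => //; rewrite ?Mv1 ?Mv2 ?Mw1 ?Mw2 ?rge//.
    by apply/ltW; move: eI; rewrite -ltr_norml lt_min => /andP[].
have dlen : is_derive (0 : R) 1 (fun e =>
   \int[mu]_(x in `[0, 1]) vlen (v1 x) (v2 x) (w1 x) (w2 x) e)
   (\int[mu]_(x in `[0, 1]) dvlen (v1 x) (v2 x) (w1 x) (w2 x) 0).
  apply: (@is_derive_under_integral R unit_itv
    (fun e x => vlen (v1 x) (v2 x) (w1 x) (w2 x) e)
    (fun e x => dvlen (v1 x) (v2 x) (w1 x) (w2 x) e)
    (fun x => 4 * M ^+ 2 / r0) (- e0) e0 0).
  - exact: measurable_unit_itv.
  - by rewrite oppr_lt0 e00.
  - by move=> e eI; exact: cont01_L1.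
  - by move=> e x eI Dx; apply: is_derive_vlen; exact: Sgt.
  - by move=> x; exact: dvlen_const_ge0 r00.
  - exact/cont01_L1/cont01_cst.
  - move=> e x eI Dx; have rg := rge e x eI Dx; have rp := lt_le_trans r00 rg.
    rewrite /dvlen normrM normfV (gtr0_norm rp); apply: ler_pM => //.
      by rewrite invr_ge0 ltW.
      have e1 : `|e| <= 1 by apply/ltW; move: eI; rewrite -ltr_norml lt_min => /andP[].
      have bb a c : `|a| <= M -> `|c| <= M -> `|(a + e * c) * c| <= 2 * M ^+ 2.
        move=> aM cM; rewrite normrM expr2 mulrA; apply: ler_pM => //.
        apply: le_trans (ler_normD _ _) _; rewrite normrM.
        have : `|e| * `|c| <= 1 * M by apply: ler_pM.
        by lra.
      apply: le_trans (ler_normD _ _) _.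
      by have := bb _ _ (Mv1 x Dx) (Mw1 x Dx); have := bb _ _ (Mv2 x Dx) (Mw2 x Dx); lra.
    by rewrite lef_pV2 ?posrE.
have dE := deriv_at_eq (derivD dbend (derivM (deriv_cst lam 0) dlen)) (erefl _).
rewrite mulr0 addr0 in dE.
apply: (near_eq_is_derive _ dE).
near=> e; rewrite E0//.
apply/andP; split; near: e; [apply: lt_nbhsr|apply: lt_nbhsl].
  by rewrite oppr_lt0.
by [].
Unshelve. all: by end_near. Qed.

(* The test function has second derivative [A - At] itself. *)
Lemma du_bois_reymond A B : L2 A -> L1 B ->
  (forall u w p, W22_wit u w p -> u 0 = 0 -> u 1 = 0 ->
     \int[mu]_(x in `[0, 1]) (A x * p x + B x * w x) = 0) ->
  exists c At, [/\ ac At (fun x => B x + c), At 0 = 0, At 1 = 0 &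
     {ae mu, forall x, unit_itv x -> A x = At x}].
Proof.
move=> A2 Bi H.
pose C x := \int[mu]_(t in `[0, x]) B t.
have C0 : C 0 = 0 by rewrite /C set_itv1 Rintegral_set1.
have aC : ac C B.
  by have := ac_prim 0 Bi; apply: eq_ac => x _; rewrite add0r.
(* The primitive of [B - C 1], with the constant that makes it vanish at both end points. *)
pose At x := C x - x * C 1.
have aAt : ac At (fun x => B x + (- C 1)).
  have := acD aC (acZ (- C 1) (ac_id R)).
  rewrite (_ : (fun x => C x + _) = At); last by apply/funext => x; rewrite /At mulNr mulrC.
  by rewrite (_ : (fun x => B x + - C 1 * 1) = (fun x => B x + - C 1))//; apply/funext => x; rewrite mulr1.
exists (- C 1), At; split => //.
- by rewrite /At C0 mul0r subrr.
- by rewrite /At mul1r subrr.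
have cAt := ac_cont01 aAt.
pose p x := A x - At x.
have p2 : L2 p by apply: L2B => //; exact: cont01_L2.
have p1 := L2_L1 p2.
pose P x := \int[mu]_(t in `[0, x]) p t.
have cP : cont01 P by exact: cont01_prim.
(* This initial slope gives [w] mean zero, so that [u] returns to 0 at 1. *)
pose w0 := - \int[mu]_(x in `[0, 1]) P x.
pose w x := w0 + P x.
have aw : ac w p by exact: ac_prim.
have cw := ac_cont01 aw.
pose u x := 0 + \int[mu]_(t in `[0, x]) w t.
have au : ac u w by exact/ac_prim/cont01_L1.
have iw : \int[mu]_(t in `[0, 1]) w t = 0.
  rewrite RintD01//; [|exact/cont01_L1/cont01_cst|exact: cont01_L1].
  rewrite Rintegral_cst//= lebesgue_measure_itv /= lte_fin ltr01 /= oppr0 addr0 mulr1.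
  by rewrite /w0 addNr.
have Ww : W22_wit u w p by apply/W22_witP.
have := H u w p Ww.
rewrite /u set_itv1 Rintegral_set1 addr0 => /(_ erefl).
rewrite iw addr0 => /(_ erefl) H0.
have C1 := (acM aC aw).2 1 (unit_itv1 R).
have W1 := (acM (ac_id R) aw).2 1 (unit_itv1 R).
have i1 : L1 (fun x => A x * p x + B x * w x).
  apply: L1D; first exact: L2_mul.
  by have := L1M cw Bi; apply: eq_L1 => x _; rewrite mulrC.
have i2 := (acM aC aw).1.
have i3 := (acM (ac_id R) aw).1.
(* [p ^ 2] is the tested expression, minus the derivative of [C * w], plus [C 1] times the
   difference of the derivative of [x * w] and [w]. The two boundary terms [C 1 * w 1] cancel and
   [w] has mean zero. *)
have I0 : \int[mu]_(x in `[0, 1]) (p x ^+ 2) = 0.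
  have -> : \int[mu]_(x in `[0, 1]) (p x ^+ 2) = \int[mu]_(x in `[0, 1])
     (((A x * p x + B x * w x) - (C x * p x + w x * B x)) + C 1 * (id x * p x + w x * 1 - w x)).
    by apply: eq_Rintegral => x _; rewrite /p /At; ring.
  rewrite RintD01//; [|exact: L1B|by apply/L1Z/L1B => //; exact: cont01_L1].
  rewrite RintB01// RintZ01//; last by apply: L1B => //; exact: cont01_L1.
  rewrite RintB01//; last exact: cont01_L1.
  move: C1 W1; rewrite C0 !mul0r !add0r mul1r => <- <-.
  by rewrite H0 iw; ring.
have mp : measurable_fun unit_itv (EFin \o (fun x => p x ^+ 2)).
  by apply/measurable_EFinP; exact: (L1_meas p2.2).
have := (@ae_eq_integral_abs _ _ _ mu unit_itv (@measurable_unit_itv R) _ mp).1.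
have pge : (\int[mu]_(x in unit_itv) `|(EFin \o (fun x => p x ^+ 2)%R) x| = 0)%E.
  have -> : (\int[mu]_(x in unit_itv) `|(EFin \o (fun x => p x ^+ 2)%R) x| =
     \int[mu]_(x in unit_itv) (p x ^+ 2)%:E)%E.
    by apply: eq_integral => x _; rewrite /= ger0_norm// sqr_ge0.
  rewrite -[LHS]fineK; first by rewrite -/(Rintegral _ _ _) I0.
  exact: (integrable_fin_num _ p2.2).
move=> /(_ pge); apply: ae_imp => x + Dx => /(_ Dx) [] /eqP.
by rewrite sqrf_eq0 /p subr_eq0 => /eqP.
Qed.

End EulerLagrange.

(** * Conservation laws *)

Section Pendulum.
Variable R : realType.
Local Notation mu := (@lebesgue_measure R).
Local Hint Extern 0 (measurable unit_itv) => exact: measurable_unit_itv : core.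
Implicit Types (f g h k u v w p F G : R -> R) (a b c d x y e C M : R).

(** Taylor bounds for the inverse square root between [a ^ 2] and [b ^ 2], written in the roots so
    that both differences factor rationally: the first contains [(b - a) ^ 2], the second
    [b - a]. *)
Lemma invsqrt_taylor (m a b : R) : 0 < m -> m <= a -> m <= b ->
  `|b^-1 - a^-1 - (- (2 * a ^+ 3)^-1) * (b ^+ 2 - a ^+ 2)| <=
    (m ^+ 5)^-1 * `|b ^+ 2 - a ^+ 2| ^+ 2 /\
  `|- (2 * b ^+ 3)^-1 - - (2 * a ^+ 3)^-1| <= (m ^+ 5)^-1 * `|b ^+ 2 - a ^+ 2|.
Proof.
move=> m0 ma mb.
have a0 : 0 < a by exact: lt_le_trans ma.
have b0 : 0 < b by exact: lt_le_trans mb.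
have an : a != 0 by rewrite gt_eqF.
have bn : b != 0 by rewrite gt_eqF.
have mn : m != 0 by rewrite gt_eqF.
have abn : a + b != 0 by rewrite gt_eqF// addr_gt0.
have mX n : m ^+ n <= a ^+ n by rewrite lerXn2r// nnegrE ltW.
have mY n : m ^+ n <= b ^+ n by rewrite lerXn2r// nnegrE ltW.
have p0 (c : R) n : 0 < c -> 0 < c ^+ n by exact: exprn_gt0.
have m50 : 0 < m ^+ 5 by exact: p0.
split.
- have -> : b^-1 - a^-1 - (- (2 * a ^+ 3)^-1) * (b ^+ 2 - a ^+ 2) =
    (b - a) ^+ 2 * ((b + 2 * a) / (2 * a ^+ 3 * b)) by field; rewrite an bn.
  rewrite -normrX (_ : (b ^+ 2 - a ^+ 2) ^+ 2 = (b - a) ^+ 2 * (a + b) ^+ 2); last by ring.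
  rewrite ger0_norm; last first.
    apply: mulr_ge0; first exact: sqr_ge0.
    by apply/ltW/divr_gt0; [lra|rewrite !pmulr_rgt0// p0].
  rewrite ger0_norm; last by apply: mulr_ge0; exact: sqr_ge0.
  rewrite [X in _ <= X]mulrCA; apply: ler_wpM2l; first exact: sqr_ge0.
  rewrite ler_pdivrMr; last by rewrite !pmulr_rgt0// p0.
  rewrite -(mulrA (m ^+ 5)^-1) ler_pdivlMl//.
  have h1 : m ^+ 5 <= a ^+ 3 * b * (a + b).
    rewrite (exprD m 4 1) (exprD m 3 1) expr1.
    apply: ler_pM; [|exact: ltW| |lra].
      by apply: mulr_ge0; [exact/ltW/p0|exact: ltW].
    by apply: ler_pM; [exact/ltW/p0|exact: ltW|exact: mX|].
  have h2 : m ^+ 5 * (b + 2 * a) <= (a ^+ 3 * b * (a + b)) * (2 * (a + b)).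
    by apply: ler_pM; [exact: ltW|lra| |lra].
  by apply: (le_trans h2); rewrite le_eqVlt; apply/orP; left; apply/eqP; ring.
- have -> : - (2 * b ^+ 3)^-1 - - (2 * a ^+ 3)^-1 =
    (b - a) * ((a ^+ 2 + a * b + b ^+ 2) / (2 * a ^+ 3 * b ^+ 3)) by field; rewrite an bn.
  rewrite (_ : b ^+ 2 - a ^+ 2 = (b - a) * (a + b)); last by ring.
  rewrite !normrM (mulrCA (m ^+ 5)^-1); apply: ler_wpM2l; first exact: normr_ge0.
  have ab0 : 0 < a * b by exact: mulr_gt0.
  have a20 := p0 a 2%N a0; have b20 := p0 b 2%N b0.
  have D0 : 0 < 2 * a ^+ 3 * b ^+ 3 by rewrite !pmulr_rgt0// p0.
  rewrite normfV !gtr0_norm//; [|lra|lra].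
  rewrite ler_pdivrMr// -(mulrA (m ^+ 5)^-1) ler_pdivlMl//.
  have h1 : m ^+ 5 * (a + b) <= 2 * (a ^+ 3 * b ^+ 3).
    have k1 : m ^+ 5 * a <= a ^+ 3 * b ^+ 3.
      rewrite (exprD m 2 3) (_ : a ^+ 3 * b ^+ 3 = a ^+ 2 * b ^+ 3 * a); last by ring.
      apply: ler_wpM2r; first exact: ltW.
      by apply: ler_pM; [exact/ltW/p0|exact/ltW/p0|exact: mX|exact: mY].
    have k2 : m ^+ 5 * b <= a ^+ 3 * b ^+ 3.
      rewrite (exprD m 3 2) (_ : a ^+ 3 * b ^+ 3 = a ^+ 3 * b ^+ 2 * b); last by ring.
      apply: ler_wpM2r; first exact: ltW.
      by apply: ler_pM; [exact/ltW/p0|exact/ltW/p0|exact: mX|exact: mY].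
    by rewrite mulrDr; lra.
  have h2 : (a ^+ 2 + a * b + b ^+ 2) <= (a + b) * (a + b) by rewrite !expr2; lra.
  have h3 := ler_wpM2l (ltW m50) h2.
  have h4 : m ^+ 5 * (a + b) * (a + b) <= 2 * (a ^+ 3 * b ^+ 3) * (a + b).
    by apply: ler_wpM2r => //; lra.
  apply: (le_trans h3); rewrite mulrA; apply: (le_trans h4).
  by rewrite le_eqVlt; apply/orP; left; apply/eqP; ring.
Qed.

(** Applied to the squared speed, this differentiates the unit tangent. *)
Lemma ac_invsqrt u h : ac u h -> (forall x, unit_itv x -> 0 < u x) ->
  ac (fun x => (Num.sqrt (u x))^-1) (fun x => - (2 * Num.sqrt (u x) ^+ 3)^-1 * h x).
Proof.
move=> uh u0; have cu := ac_cont01 uh.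
have [m m0 um] := cont01_pos_min cu u0.
have sm x : unit_itv x -> Num.sqrt m <= Num.sqrt (u x) by move=> Dx; rewrite ler_wsqrtr// um.
have sm0 : 0 < Num.sqrt m by rewrite sqrtr_gt0.
apply: (@ac_comp R u h (fun z => (Num.sqrt z)^-1) (fun z => - (2 * Num.sqrt z ^+ 3)^-1) (Num.sqrt m ^+ 5)^-1) => //.
- apply: cont01N; apply: cont01V.
    by apply: cont01M; [exact: cont01_cst|apply: cont01X; exact: cont01_sqrt].
  move=> x Dx; rewrite mulf_neq0 ?pnatr_eq0// expf_neq0// gt_eqF//.
  exact: lt_le_trans (sm x Dx).
move=> x y Dx Dy.
have sq z : unit_itv z -> Num.sqrt (u z) ^+ 2 = u z by move=> Dz; rewrite sqr_sqrtr// ltW// u0.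
have := invsqrt_taylor sm0 (sm x Dx) (sm y Dy).
by rewrite !sq.
Qed.

End Pendulum.

(** * The weak Euler-Lagrange equations *)

Section Elastica.
Variable R : realType.
Local Notation mu := (@lebesgue_measure R).
Local Hint Extern 0 (measurable unit_itv) => exact: measurable_unit_itv : core.
Implicit Types (f g h k u v w p F G : R -> R) (a b c d x y e C M : R).

Lemma W22_wit0 : W22_wit (fun=> 0 : R) (fun=> 0) (fun=> 0).
Proof.
by apply/W22_witP; split; [exact/cont01_L2/cont01_cst|exact: ac_cst|exact: ac_cst].
Qed.

Lemma Rint01_lin f1 f2 g a : L1 f1 -> L1 f2 ->
  (forall x, unit_itv x -> f1 x + a * f2 x = g x) ->
  \int[mu]_(x in `[0, 1]) f1 x + a * \int[mu]_(x in `[0, 1]) f2 x =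
  \int[mu]_(x in `[0, 1]) g x.
Proof.
move=> i1 i2 E.
rewrite -RintZ01 ?lexx// -RintD01 ?lexx//; last exact: L1Z.
by apply: eq_Rintegral => x; rewrite inE; exact: E.
Qed.

(* [A] and [B] are the coefficients of [eta''] and [eta'] in the first variation. *)
Lemma weak_form (lam : R) (X Y v1 v2 h1 h2 : R -> R) :
  W22_wit X v1 h1 -> W22_wit Y v2 h2 ->
  (forall x, unit_itv x -> 0 < v1 x ^+ 2 + v2 x ^+ 2) ->
  (forall eta : R -> R * R, W22c eta -> eta 0 = (0, 0) -> eta 1 = (0, 0) ->
    is_derive (0 : R) (1 : R) (fun e : R => Elam lam (cvar (fun x => (X x, Y x)) eta e)) 0) ->
  let N := (fun x => v1 x * h2 x - v2 x * h1 x) in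
  let k := (fun x => (Num.sqrt (v1 x ^+ 2 + v2 x ^+ 2))^-1) in
  let A1 := (fun x => (-2 * v2 x * k x ^+ 5) * N x) in
  let A2 := (fun x => (2 * v1 x * k x ^+ 5) * N x) in
  let B1 := (fun x => (2 * k x ^+ 5) * (N x * h2 x) - (5 * v1 x * k x ^+ 7) * (N x * N x)
                      + lam * v1 x * k x) in
  let B2 := (fun x => - (2 * k x ^+ 5) * (N x * h1 x) - (5 * v2 x * k x ^+ 7) * (N x * N x)
                      + lam * v2 x * k x) in
  [/\ cont01 k, L2 N, L2 A1 /\ L2 A2, L1 B1 /\ L1 B2 &
  (forall u w p, W22_wit u w p -> u 0 = 0 -> u 1 = 0 ->
     \int[mu]_(x in `[0, 1]) (A1 x * p x + B1 x * w x) = 0) /\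
  (forall u w p, W22_wit u w p -> u 0 = 0 -> u 1 = 0 ->
     \int[mu]_(x in `[0, 1]) (A2 x * p x + B2 x * w x) = 0)].
Proof.
move=> W1 W2 imm crit N k A1 A2 B1 B2.
have /W22_witP[h12 /ac_cont01 c1 _] := W1; have /W22_witP[h22 /ac_cont01 c2 _] := W2.
have s0 x : unit_itv x -> Num.sqrt (v1 x ^+ 2 + v2 x ^+ 2) != 0.
  by move=> Dx; rewrite gt_eqF// sqrtr_gt0; exact: imm.
have ck : cont01 k.
  by apply: cont01V s0; apply: cont01_sqrt; apply: cont01D; exact: cont01X.
have N2 : L2 N by exact: L2_cross.
have cc a f n : cont01 f -> cont01 (fun x => a * f x * k x ^+ n).
  by move=> cf; apply: cont01M; [apply: cont01M => //; exact: cont01_cst|exact: cont01X].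
have ck5 a : cont01 (fun x => a * k x ^+ 5).
  by apply: cont01M; [exact: cont01_cst|exact: cont01X].
have ck5N a : cont01 (fun x => - (a * k x ^+ 5)) by exact: cont01N.
have clam f : cont01 f -> cont01 (fun x => lam * f x * k x).
  by move=> cf; apply: cont01M => //; apply: cont01M => //; exact: cont01_cst.
have A12 : L2 A1 by exact: L2M (cc (-2) v2 5%N c2) N2.
have A22 : L2 A2 by exact: L2M (cc 2 v1 5%N c1) N2.
have NN := L2_mul N2 N2.
have b1 : L1 (fun x => (2 * k x ^+ 5) * (N x * h2 x) - (5 * v1 x * k x ^+ 7) * (N x * N x)).
  by apply: L1B; [exact: L1M (ck5 2) (L2_mul N2 h22)|exact: L1M (cc 5 v1 7%N c1) NN].
have b2 : L1 (fun x => - (2 * k x ^+ 5) * (N x * h1 x) - (5 * v2 x * k x ^+ 7) * (N x * N x)).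
  by apply: L1B; [exact: L1M (ck5N 2) (L2_mul N2 h12)|exact: L1M (cc 5 v2 7%N c2) NN].
split=> //.
  by split; apply: L1D => //; apply: cont01_L1; exact: clam.
(* Horizontal and vertical test fields split the vector equation into two scalar ones. *)
split=> u w p W u0 u1.
- have /W22_witP[p2 /ac_cont01 cw _] := W.
  have Wu : W22c (fun x => (u x, 0) : R * R).
    by split; [exists w, p|exists (fun=> 0), (fun=> 0); exact: W22_wit0].
  have [_ D0] := crit _ Wu (congr1 (fun z => (z, 0)) u0) (congr1 (fun z => (z, 0)) u1).
  have [_] := @first_variation R lam (fun x => (X x, Y x)) (fun x => (u x, 0)) _ _ _ _ _ _ _ _ W1 W2 W W22_wit0 imm.
  rewrite D0 => /esym.
  have E1 x : unit_itv x -> A1 x * p x + w x * ((2 * k x ^+ 5) * (N x * h2 x) - (5 * v1 x * k x ^+ 7) * (N x * N x)) =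
      dvbend (v1 x) (v2 x) (h1 x) (h2 x) (w x) 0 (p x) 0 0.
    move=> Dx; have := s0 x Dx.
    rewrite /dvbend /dvcross /dvlen /vcross /vlen !mul0r !addr0 !mulr0 /A1 /N /k.
    set s := Num.sqrt _ => sn; by field.
  have E2 x : unit_itv x -> v1 x * k x * w x = dvlen (v1 x) (v2 x) (w x) 0 0.
    move=> Dx; have := s0 x Dx.
    rewrite /dvlen /vlen !mul0r !addr0 !mulr0 /k.
    set s := Num.sqrt _ => sn; by field.
  rewrite (@Rint01_lin _ _ (fun x => A1 x * p x + B1 x * w x)) //.
  + by apply: (eq_L1 E1); apply: L1D; [exact: L2_mul|exact: L1M].
  + by apply: (eq_L1 E2); apply: cont01_L1; apply: cont01M => //; exact: cont01M.
  + by move=> x Dx; rewrite -E1// -E2// /B1; ring.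
- have /W22_witP[p2 /ac_cont01 cw _] := W.
  have Wu : W22c (fun x => (0, u x) : R * R).
    by split; [exists (fun=> 0), (fun=> 0); exact: W22_wit0|exists w, p].
  have [_ D0] := crit _ Wu (congr1 (fun z => (0, z)) u0) (congr1 (fun z => (0, z)) u1).
  have [_] := @first_variation R lam (fun x => (X x, Y x)) (fun x => (0, u x)) _ _ _ _ _ _ _ _ W1 W2 W22_wit0 W imm.
  rewrite D0 => /esym.
  have E1 x : unit_itv x -> A2 x * p x + w x * (- (2 * k x ^+ 5) * (N x * h1 x) - (5 * v2 x * k x ^+ 7) * (N x * N x)) =
      dvbend (v1 x) (v2 x) (h1 x) (h2 x) 0 (w x) 0 (p x) 0.
    move=> Dx; have := s0 x Dx.
    rewrite /dvbend /dvcross /dvlen /vcross /vlen !mul0r !addr0 !mulr0 /A2 /N /k.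
    set s := Num.sqrt _ => sn; by field.
  have E2 x : unit_itv x -> v2 x * k x * w x = dvlen (v1 x) (v2 x) 0 (w x) 0.
    move=> Dx; have := s0 x Dx.
    rewrite /dvlen /vlen !mul0r !addr0 !mulr0 /k.
    set s := Num.sqrt _ => sn; by field.
  rewrite (@Rint01_lin _ _ (fun x => A2 x * p x + B2 x * w x)) //.
  + by apply: (eq_L1 E1); apply: L1D; [exact: L2_mul|exact: L1M].
  + by apply: (eq_L1 E2); apply: cont01_L1; apply: cont01M => //; exact: cont01M.
  + by move=> x Dx; rewrite -E1// -E2// /B2; ring.
Qed.

End Elastica.

(** * Force and moment balance, and the equation for the height *)

Section Conservation.
Variable R : realType.
Local Notation mu := (@lebesgue_measure R).
Local Hint Extern 0 (measurable unit_itv) => exact: measurable_unit_itv : core.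
Implicit Types (f g h k u v w p F G : R -> R) (a b c d x y e C M : R).

Lemma ac_unique_prim u v h : ac u h -> ac v h -> u 0 = v 0 ->
  forall x, unit_itv x -> u x = v x.
Proof. by move=> [_ uh] [_ vh] uv x Dx; rewrite uh// vh// uv. Qed.

(** The integration constants [(a1, a2)] of the du Bois-Reymond lemma are the components of the
    force, and [c] is [a1]. The last clause is the Frenet equation, curvature times [v1], with the
    moment law [kap = - (a1 / 2) Y] and the force law inserted. *)
Lemma elastica_pendulum (lam l : R) (X Y v1 v2 h1 h2 : R -> R) :
  0 < lam -> 0 < l ->
  W22_wit X v1 h1 -> W22_wit Y v2 h2 ->
  (forall x, unit_itv x -> 0 < v1 x ^+ 2 + v2 x ^+ 2) ->
  (forall eta : R -> R * R, W22c eta -> eta 0 = (0, 0) -> eta 1 = (0, 0) ->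
    is_derive (0 : R) (1 : R) (fun e : R => Elam lam (cvar (fun x => (X x, Y x)) eta e)) 0) ->
  X 0 = 0 -> Y 0 = 0 -> X 1 = l -> Y 1 = 0 ->
  let s := (fun x => Num.sqrt (v1 x ^+ 2 + v2 x ^+ 2)) in
  exists c, [/\ c != 0,
    forall x, unit_itv x -> c * v1 x = (c ^+ 2 / 4 * Y x ^+ 2 - lam) * s x &
    ac (fun x => v2 x / s x) (fun x => s x * (lam / 2 * Y x - c ^+ 2 / 8 * Y x ^+ 3))].
Proof.
move=> lam0 l0 W1 W2 imm crit X0 Y0 X1 Y1 s.
have [ck N2 [A12 A22] [B11 B21] [crit1 crit2]] := weak_form W1 W2 imm crit.
have [a1 [At1 [aAt1 At10 At11 AE1]]] := du_bois_reymond A12 B11 crit1.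
have [a2 [At2 [aAt2 At20 At21 AE2]]] := du_bois_reymond A22 B21 crit2.
have /W22_witP[h12 ah1 aX] := W1; have /W22_witP[h22 ah2 aY] := W2.
have c1 := ac_cont01 ah1; have c2 := ac_cont01 ah2; have cY := ac_cont01 aY.
have ss x : unit_itv x -> s x ^+ 2 = v1 x ^+ 2 + v2 x ^+ 2.
  by move=> Dx; rewrite sqr_sqrtr// ltW// imm.
have s0 x : unit_itv x -> 0 < s x by move=> Dx; rewrite sqrtr_gt0 imm.
have sn x : unit_itv x -> s x != 0 by move=> Dx; rewrite gt_eqF// s0.
have cs : cont01 s by apply: cont01_sqrt; apply: cont01D; exact: cont01X.
(* [A] is [2 kap / s] times the unit normal, so this combination of its continuous representatives
   is the signed curvature. *)
pose kap x := 2^-1 * (v1 x * At2 x + (-1) * (v2 x * At1 x)).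
(* The moment of the force: [kap] is affine in the position. *)
have kapE : forall x, unit_itv x -> kap x = 2^-1 * (a2 * X x + (- a1) * Y x).
  apply: (@ac_unique_prim kap (fun x => 2^-1 * (a2 * X x + (- a1) * Y x)) (fun x => 2^-1 * (a2 * v1 x + (- a1) * v2 x))).
  - have := acZ 2^-1 (acD (acM ah1 aAt2) (acZ (-1) (acM ah2 aAt1))).
    move=> /ac_ae; apply.
      apply: cont01_meas; apply: cont01M (cont01_cst 2^-1) _.
      by apply: cont01D; apply: cont01M => //; exact: cont01_cst.
    move: AE1 AE2; apply: ae_imp2 => x AE1 AE2 Dx.
    by rewrite -AE1// -AE2//; field; exact: sn.
  - exact: acZ (acD (acZ a2 aX) (acZ (- a1) aY)).
  - by rewrite /kap At10 At20 X0 Y0 !mulr0 addr0.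
(* At the far end the natural boundary condition gives zero curvature, while the abscissa [l] is
   nonzero. *)
have a20 : a2 = 0.
  have := kapE 1 (unit_itv1 R).
  rewrite /kap At11 At21 X1 Y1 !mulr0 !addr0 mulr0 => /esym/eqP.
  by rewrite !mulf_eq0 invr_eq0 pnatr_eq0 (gt_eqF l0) orbF /= => /eqP.
have kapY x : unit_itv x -> kap x = - (a1 / 2) * Y x.
  by move=> Dx; rewrite kapE// a20; ring.
have kapN : {ae mu, forall x, unit_itv x -> v1 x * h2 x - v2 x * h1 x = kap x * s x ^+ 3}.
  move: AE1 AE2; apply: ae_imp2 => x AE1 AE2 Dx.
  have sx := sn x Dx.
  rewrite /kap -AE1// -AE2// -/(s x).
  set N := v1 x * h2 x - _.
  transitivity (N * (v1 x ^+ 2 + v2 x ^+ 2) * (s x)^-1 ^+ 5 * s x ^+ 3); last by field.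
  by rewrite -ss//; field.
(* The tangential component of [A], times the speed. It vanishes because [A] is normal, and the
   vanishing of its derivative is the force law. *)
pose D x := v1 x * At1 x + v2 x * At2 x.
have cD : cont01 D.
  by apply: cont01D; apply: cont01M => //; [exact: ac_cont01 aAt1|exact: ac_cont01 aAt2].
have D0 : forall x, unit_itv x -> D x = 0.
  apply: ae_cont01_eq0 cD _.
  move: AE1 AE2; apply: ae_imp2 => x AE1 AE2 Dx.
  by rewrite /D -AE1// -AE2//; ring.
have aD := acD (acM ah1 aAt1) (acM ah2 aAt2).
have aD0 := eq_ac (fun x Dx => esym (D0 x Dx)) (ac_cst (0 : R)).
have dD0 := ac_ae_unique aD aD0.
have force : forall x, unit_itv x -> a1 * v1 x - (kap x ^+ 2 - lam) * s x = 0.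
  apply: (ae_cont01_eq0 (f := fun x => a1 * v1 x - (kap x ^+ 2 - lam) * s x)).
    apply: cont01B; first by apply: cont01M => //; exact: cont01_cst.
    apply: cont01M => //; apply: cont01B; last exact: cont01_cst.
    apply: cont01X; apply: eq_cont01 (fun x Dx => esym (kapY x Dx)) _.
    by apply: cont01M => //; exact: cont01_cst.
  have AE12 : {ae mu, forall x, (unit_itv x -> (-2 * v2 x * (s x)^-1 ^+ 5) * (v1 x * h2 x - v2 x * h1 x) = At1 x)
     /\ (unit_itv x -> (2 * v1 x * (s x)^-1 ^+ 5) * (v1 x * h2 x - v2 x * h1 x) = At2 x)}.
    by move: AE1 AE2; apply: ae_imp2 => x.
  have := ae_imp2 (fun x P Q => conj P Q) AE12 kapN.
  move: dD0; apply: ae_imp2 => x dD [[AE1x AE2x] kN] Dx.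
  move: dD => /(_ Dx); rewrite -AE1x// -AE2x// a20 -/(s x) kN//.
  have sx := sn x Dx => E.
  have : 2 * kap x * kap x * s x * 2 - 5 * kap x ^+ 2 * (v1 x ^+ 2 + v2 x ^+ 2) / s x
      + lam * (v1 x ^+ 2 + v2 x ^+ 2) / s x + a1 * v1 x = 0.
    have e1 : v1 x * h2 x = kap x * s x ^+ 3 + v2 x * h1 x by rewrite -kN//; ring.
    rewrite -E.
    transitivity (2 * kap x / s x ^+ 2 * (v1 x * h2 x - v2 x * h1 x) * 2 - 5 * kap x ^+ 2 * (v1 x ^+ 2 + v2 x ^+ 2) / s x
      + lam * (v1 x ^+ 2 + v2 x ^+ 2) / s x + a1 * v1 x); first by rewrite kN//; field.
    by field.
  rewrite -ss// => E2; rewrite -[RHS]E2; by field.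
(* The curvature is zero at the start, so [a1 = 0] would leave [lam * s 0 = 0]. *)
have a1n : a1 != 0.
  apply/eqP => a10; have := force 0 (unit_itv0 R).
  rewrite kapY ?Y0 ?a10; last exact: unit_itv0.
  move=> /eqP; rewrite mulr0 mul0r expr0n /= !sub0r mulNr opprK mulf_eq0.
  by rewrite (gt_eqF lam0) (gt_eqF (s0 0 (unit_itv0 R))).
exists a1; split=> //.
  move=> x Dx; have := force x Dx; rewrite kapY// => /eqP.
  rewrite subr_eq0 => /eqP ->.
  by congr ((_ - _) * _); field.
have aS : ac (fun x => v1 x ^+ 2 + v2 x ^+ 2) (fun x => (v1 x * h1 x + v1 x * h1 x) + (v2 x * h2 x + v2 x * h2 x)).
  by have := acD (acM ah1 ah1) (acM ah2 ah2).
have aT := acM ah2 (ac_invsqrt aS imm).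
apply: (ac_ae aT).
  apply: cont01_meas; apply: cont01M => //; apply: cont01B; apply: cont01M; try exact: cont01_cst => //.
    exact: cY.
  exact: cont01X.
move: kapN; apply: ae_imp => x kN Dx; have sx := sn x Dx.
rewrite -/(s x).
transitivity ((- v2 x * (v1 x * h1 x + v2 x * h2 x) + h2 x * (v1 x ^+ 2 + v2 x ^+ 2)) / s x ^+ 3).
  by rewrite -ss//; field.
transitivity (v1 x * (v1 x * h2 x - v2 x * h1 x) / s x ^+ 3); first by field.
rewrite kN// kapY//.
have := force x Dx; rewrite kapY// => /eqP; rewrite subr_eq0 => /eqP fx.
transitivity (- (2^-1) * (a1 * v1 x) * Y x); first by field.
by rewrite fx; field.
Qed.

End Conservation.

(** * Elliptic functions and the explicit curves *)

Section Elliptic.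
Variable R : realType.
Implicit Types (f g h k : R -> R) (a b c d x y e t q u v : R).

Definition modul q t : R := Num.sqrt (1 - q ^+ 2 * sin t ^+ 2).

Lemma sin2_le1 t : sin t ^+ 2 <= 1.
Proof. by rewrite sin2cos2 gerBl sqr_ge0. Qed.

Lemma continuous_deriv f (df : R -> R) : (forall x, deriv_at f x (df x)) -> continuous f.
Proof. by move=> d x; exact: is_derive_continuous (d x). Qed.

Lemma deriv_shift f c x a : deriv_at f (x + c) a -> deriv_at (fun y => f (y + c)) x a.
Proof.
move=> df; apply: deriv_at_eq.
  by apply: (deriv_comp (g := fun y => y + c) df); apply: derivD; [exact: deriv_id|exact: deriv_cst].
by rewrite addr0 mulr1.
Qed.

Lemma deriv_pos_increasing f (df : R -> R) : (forall x, deriv_at f x (df x)) ->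
  (forall x, 0 < df x) -> forall x y, x < y -> f x < f y.
Proof.
move=> d d0 x y xy.
apply: (@gtr0_derive1_incr R f x y) => //.
- by move=> z _; have [] := d z.
- by move=> z _; rewrite derive1E; have [_ ->] := d z.
- exact: continuous_subspaceT (continuous_deriv d).
Qed.

Lemma deriv_zero_const f : (forall x, deriv_at f x 0) -> forall x y, f x = f y.
Proof. by move=> d x y; apply: is_derive_0_is_cst. Qed.

Lemma sin_zero_pos x : 0 < x -> sin x = 0 -> exists2 n : nat, (0 < n)%N & x = n%:R * pi.
Proof.
move=> x0 sx; have p0 := pi_gt0 R.
have xp : 0 <= x / pi by rewrite divr_ge0// ltW.
have := truncn_itv xp; set n := Num.truncn (x / pi) => /andP[n1 n2].
rewrite ler_pdivlMr// in n1; rewrite ltr_pdivrMr// -natr1 mulrDl mul1r in n2.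
have sn : forall (m : nat) y, sin (y + m%:R * pi) = 0 -> sin y = 0.
  elim=> [|m IH] y; first by rewrite mul0r addr0.
  rewrite -natr1 mulrDl mul1r addrA sinDpi => /eqP; rewrite oppr_eq0 => /eqP; exact: IH.
have sr : sin (x - n%:R * pi) = 0 by apply: (sn n); rewrite subrK.
have r0 : x = n%:R * pi.
  apply/eqP; rewrite eq_le n1 andbT leNgt; apply/negP => lt.
  have h : 0 < sin (x - n%:R * pi) by apply: sin_gt0_pi; apply/andP; split; lra.
  by move: h; rewrite sr ltxx.
exists n => //; rewrite lt0n; apply/eqP => n0.
by move: x0; rewrite r0 n0 mul0r ltxx.
Qed.

Section FixedModulus.
Variable q : R.
Hypothesis q01 : 0 <= q < 1.

Lemma q2_lt1 : q ^+ 2 < 1.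
Proof. by have /andP[q0 q1] := q01; rewrite expr_lt1. Qed.

Lemma modul_sq_gt0 t : 0 < 1 - q ^+ 2 * sin t ^+ 2.
Proof.
rewrite subr_gt0; apply: le_lt_trans q2_lt1.
by rewrite ler_piMr ?sqr_ge0// sin2_le1.
Qed.

Lemma modul_gt0 t : 0 < modul q t.
Proof. by rewrite sqrtr_gt0 modul_sq_gt0. Qed.

Lemma sqr_modul t : modul q t ^+ 2 = 1 - q ^+ 2 * sin t ^+ 2.
Proof. by rewrite sqr_sqrtr// ltW// modul_sq_gt0. Qed.

Lemma modul_le1 t : modul q t <= 1.
Proof.
rewrite -(@sqrtr1 R); apply: ler_wsqrtr.
by rewrite gerBl mulr_ge0// sqr_ge0.
Qed.

Lemma deriv_modul t : deriv_at (modul q) t (- (q ^+ 2 * sin t * cos t) / modul q t).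
Proof.
apply: deriv_at_eq.
  apply: deriv_sqrt; first exact: modul_sq_gt0.
  apply: derivB; first exact: deriv_cst.
  apply: derivM; first exact: deriv_cst.
  apply: derivX; exact: is_derive_sin.
by rewrite /= expr1 -/(modul q t); have := modul_gt0 t => m0; field; rewrite gt_eqF.
Qed.

Lemma continuous_modul : continuous (modul q).
Proof. exact: continuous_deriv deriv_modul. Qed.

Lemma continuous_modulV : continuous (fun t => (modul q t)^-1).
Proof.
by move=> t; apply: cvgV; [rewrite gt_eqF// modul_gt0|exact: continuous_modul].
Qed.

Lemma modul_shift t : modul q (t + pi) = modul q t.
Proof. by rewrite /modul sinDpi sqrrN. Qed.

Lemma deriv_EllF x : deriv_at (fun x => EllF x q) x (modul q x)^-1.
Proof. exact: (is_derive_oint 0 x continuous_modulV). Qed.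

Lemma deriv_EllE x : deriv_at (fun x => EllE x q) x (modul q x).
Proof. exact: (is_derive_oint 0 x continuous_modul). Qed.

Lemma oint0 a f : oint a a f = 0.
Proof. by rewrite /oint lexx set_itv1 Rintegral_set1. Qed.

Lemma odd_primitive f (df : R -> R) : f 0 = 0 -> (forall x, deriv_at f x (df x)) ->
  (forall x, df (- x) = df x) -> forall x, f (- x) = - f x.
Proof.
move=> f0 d ev x.
have H y : deriv_at (fun y => f (- y) + f y) y 0.
  apply: deriv_at_eq.
    apply: derivD; last exact: d.
    by apply: (deriv_comp (d _)); apply: derivN; exact: deriv_id.
  by rewrite ev; ring.
have := deriv_zero_const H x 0.
by rewrite oppr0 f0 addr0 => /eqP; rewrite addr_eq0 => /eqP.
Qed.

(** A derivative of period [pi] makes each shift add [f pi]; evaluating at [- pi / 2], oddness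
    identifies this with [2 f (pi / 2)], which is how the complete integrals enter. *)
Lemma quasi_periodic f (df : R -> R) : f 0 = 0 -> (forall x, deriv_at f x (df x)) ->
  (forall x, df (- x) = df x) -> (forall x, df (x + pi) = df x) ->
  forall n : nat, f (- (pi / 2) + n%:R * pi) = - f (pi / 2) + n%:R * (2 * f (pi / 2)).
Proof.
move=> f0 d ev per.
have sh x : f (x + pi) = f x + f pi.
  have H y : deriv_at (fun y => f (y + pi) - f y) y 0.
    apply: deriv_at_eq.
      by apply: derivB; [exact: deriv_shift (d _)|exact: d].
    by rewrite per subrr.
  have := deriv_zero_const H x 0.
  by rewrite add0r f0 subr0 => /eqP; rewrite subr_eq => /eqP ->; rewrite addrC.
have od := odd_primitive f0 d ev.
have fpi : f pi = 2 * f (pi / 2).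
  have := sh (- (pi / 2)); rewrite od (_ : - (pi / 2) + pi = pi / 2 :> R); last by field.
  by move=> H; lra.
elim=> [|n IH]; first by rewrite !mul0r !addr0 od.
rewrite (_ : - (pi / 2) + n.+1%:R * pi = - (pi / 2) + n%:R * pi + pi).
  by rewrite sh IH fpi -natr1; ring.
by rewrite -natr1; ring.
Qed.

Lemma modul_even t : modul q (- t) = modul q t.
Proof. by rewrite /modul sinN sqrrN. Qed.

Lemma EllF_npi (n : nat) :
  EllF (- (pi / 2) + n%:R * pi) q = - EllK q + n%:R * (2 * EllK q).
Proof.
apply: (@quasi_periodic (fun x => EllF x q) (fun x => (modul q x)^-1)).
- exact: oint0.
- exact: deriv_EllF.
- by move=> x; rewrite modul_even.
- by move=> x; rewrite modul_shift.
Qed.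

Lemma EllE_npi (n : nat) :
  EllE (- (pi / 2) + n%:R * pi) q = - EllEc q + n%:R * (2 * EllEc q).
Proof.
apply: (@quasi_periodic (fun x => EllE x q) (modul q)).
- exact: oint0.
- exact: deriv_EllE.
- exact: modul_even.
- exact: modul_shift.
Qed.

Lemma EllF_incr x y : x < y -> EllF x q < EllF y q.
Proof.
apply: (deriv_pos_increasing deriv_EllF) => z.
by rewrite invr_gt0 modul_gt0.
Qed.

Lemma EllF_ltE x y : (EllF x q < EllF y q) = (x < y).
Proof.
case: (ltgtP x y) => [/EllF_incr//|/EllF_incr h|->]; last by rewrite ltxx.
by apply/negbTE; rewrite -leNgt ltW.
Qed.

Lemma EllF_inj x y : EllF x q = EllF y q -> x = y.
Proof.
by move=> E; case: (ltgtP x y) => // /EllF_incr; rewrite E ltxx.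
Qed.

(** The integrand is at least 1. With oddness this makes [EllF] onto, so that [am] is a true
    inverse. *)
Lemma EllF_ge x : 0 <= x -> x <= EllF x q.
Proof.
move=> x0.
have d y : deriv_at (fun y => EllF y q - y) y ((modul q y)^-1 - 1).
  by apply: derivB; [exact: deriv_EllF|exact: deriv_id].
have : EllF 0 q - 0 <= EllF x q - x.
  apply: (@ger0_derive1_ndecr R (fun y => EllF y q - y) 0 x) => //.
  - by move=> y _; have [] := d y.
  - move=> y _; rewrite derive1E; have [_ ->] := d y.
    by rewrite subr_ge0 -invr1 lef_pV2 ?posrE ?modul_gt0// modul_le1.
  - exact: continuous_subspaceT (continuous_deriv d).
by rewrite [EllF 0 q]oint0 subrr subr_ge0.
Qed.

Lemma EllF_odd x : EllF (- x) q = - EllF x q.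
Proof.
apply: (@odd_primitive (fun x => EllF x q) (fun x => (modul q x)^-1)).
- exact: oint0.
- exact: deriv_EllF.
- by move=> y; rewrite modul_even.
Qed.

Lemma EllF_surj y : exists x, EllF x q = y.
Proof.
have a0 := normr_ge0 y.
have h1 := EllF_ge a0.
have h2 : EllF (- `|y|) q <= - `|y| by rewrite EllF_odd lerN2.
have n2 : - `|y| <= `|y| by lra.
have [|x _ xy] := @IVT R (fun x => EllF x q) (- `|y|) `|y| y n2
  (continuous_subspaceT (continuous_deriv deriv_EllF)).
  rewrite ge_min le_max.
  have := ler_norm y; have := ler_norm (- y); rewrite normrN => k1 k2.
  by rewrite (le_trans h2) ?(le_trans k2 h1) ?orbT//; lra.
by exists x.
Qed.

Lemma am_spec u : EllF (am u q) q = u.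
Proof.
have [x ex] := EllF_surj u.
by have := @xgetPex _ 0 [set x | EllF x q = u]; apply; exists x.
Qed.

Lemma am_unique u x : EllF x q = u -> am u q = x.
Proof. by move=> xu; apply: EllF_inj; rewrite am_spec. Qed.

Lemma deriv_am u : deriv_at (fun u => am u q) u (modul q (am u q)).
Proof.
rewrite -[in X in deriv_at _ X](am_spec u) -[modul _ _]invrK.
apply: (@is_derive_inverse R (fun x => EllF x q) (fun u => am u q)).
- by near=> z; exact: am_unique.
- near=> z; exact: (continuous_deriv deriv_EllF).
- exact: deriv_EllF.
- by rewrite invr_neq0// gt_eqF// modul_gt0.
Unshelve. all: by end_near. Qed.

Lemma am_lt u v : u < v -> am u q < am v q.
Proof. by move=> uv; rewrite -EllF_ltE !am_spec. Qed.

Lemma am_NK : am (- EllK q) q = - (pi / 2).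
Proof. by apply: am_unique; rewrite EllF_odd. Qed.

Lemma EllK_gt0 : 0 < EllK q.
Proof.
have := @EllF_incr 0 (pi / 2); rewrite [EllF 0 q]oint0; apply.
by rewrite divr_gt0// pi_gt0.
Qed.

(** Where [cn] vanishes, [am u + pi / 2] is a positive zero of the sine, hence [n * pi], and
    quasi-periodicity evaluates [EllF] and [EllE] there. On the curve, [n] counts half-periods. *)
Lemma cn_zero u : - EllK q < u -> cn u q = 0 ->
  exists2 n : nat, (0 < n)%N & u = - EllK q + n%:R * (2 * EllK q) /\
    EllE (am u q) q = - EllEc q + n%:R * (2 * EllEc q).
Proof.
move=> Ku c0.
have hu : 0 < am u q + pi / 2.
  by have := am_lt Ku; rewrite am_NK; lra.
have [|n n0 E] := sin_zero_pos hu.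
  by rewrite sinD cos_pihalf mulr0 add0r -/(cn u q) c0 mul0r.
exists n => //.
have au : am u q = - (pi / 2) + n%:R * pi by lra.
by rewrite -EllE_npi -EllF_npi -au am_spec.
Qed.

End FixedModulus.
End Elliptic.

(** * Uniqueness for the Duffing equation along a change of parameter *)

Section Comparison.
Variable R : realType.
Local Notation mu := (@lebesgue_measure R).
Implicit Types (f g h u v s phi D dD X Y T Xh Yh Th : R -> R) (a b c x y A B C : R).

Lemma ac_deriv u h x : ac u h -> cont01 h -> 0 < x -> x < 1 -> deriv_at u x (h x).
Proof.
move=> [hi uh] ch x0 x1.
have hx : {for x, continuous h}.
  have [ci _ _] := (continuous_within_itvP h (@ltr01 R)).1 ch.
  by apply: ci; rewrite in_itv /= x0.
have [d1 d2] := @continuous_FTC1_closed R h 0 x 1 x1 hi x0 hx.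
have dF : deriv_at (fun y => \int[mu]_(t in `[0, y]) h t) x (h x).
  by apply: DeriveDef; [exact: d1|rewrite -derive1E; exact: d2].
have dG := derivD (deriv_cst (u 0) x) dF; rewrite add0r in dG.
apply: (near_eq_is_derive _ dG).
near=> y; rewrite -uh//; apply: unit_itvP; apply/ltW; near: y.
  exact: lt_nbhsr.
exact: lt_nbhsl.
Unshelve. all: by end_near. Qed.

(** [D] times [exp (- C x)] is nonincreasing and starts at 0. *)
Lemma gronwall D dD C : cont01 D -> (forall x, 0 < x -> x < 1 -> deriv_at D x (dD x)) ->
  (forall x, 0 < x -> x < 1 -> dD x <= C * D x) ->
  D 0 = 0 -> (forall x, unit_itv x -> 0 <= D x) -> forall x, unit_itv x -> D x = 0.
Proof.
move=> cD dDx dC D0 Dge x Dx; have /andP[x0 x1] := mem_unit_itv Dx.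
pose E y := D y * expR (- C * y).
have dexp y : deriv_at (fun y => expR (- C * y)) y (- C * expR (- C * y)).
  apply: deriv_at_eq.
    apply: deriv_comp; first exact: is_derive_expR.
    by apply: derivM; [exact: deriv_cst|exact: deriv_id].
  by rewrite /=; ring.
have dE y : 0 < y -> y < 1 -> deriv_at E y ((dD y - C * D y) * expR (- C * y)).
  move=> y0 y1; apply: deriv_at_eq; first by apply: derivM; [exact: dDx|exact: dexp].
  by rewrite /=; ring.
have cE : cont01 E.
  apply: cont01M => //; apply: continuous_subspaceT.
  by move=> y; exact: is_derive_continuous (dexp y).
have : E x <= E 0.
  apply: (@ler0_derive1_nincr R E 0 1) => //.
  - by move=> y; rewrite in_itv /= => /andP[y0 y1]; have [] := dE y y0 y1.
  - move=> y; rewrite in_itv /= => /andP[y0 y1]; rewrite derive1E; have [_ ->] := dE y y0 y1.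
    by rewrite mulr_le0_ge0 ?expR_ge0// subr_le0 dC.
rewrite /E D0 mul0r pmulr_lle0 ?expR_gt0// => le0.
by apply/eqP; rewrite eq_le le0 Dge.
Qed.

(** Gronwall for the squared phase-plane distance between [(Y, T)] and the model solution at time
    [phi x]. Since [y ^ 3 - z ^ 3] factors through [y - z], the two right-hand sides differ by
    [s * L] times the difference of heights, and this factor is bounded on the compact interval. *)
Lemma ode_unique A B s Y T Yh Th phi : cont01 s -> (forall x, unit_itv x -> 0 <= s x) ->
  ac Y (fun x => s x * T x) -> ac T (fun x => s x * (A * Y x - B * Y x ^+ 3)) ->
  (forall z, deriv_at Yh z (Th z)) ->
  (forall z, deriv_at Th z (A * Yh z - B * Yh z ^+ 3)) ->
  ac phi s -> phi 0 = 0 -> Y 0 = Yh 0 -> T 0 = Th 0 ->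
  forall x, unit_itv x -> Y x = Yh (phi x) /\ T x = Th (phi x).
Proof.
move=> cs s0 aY aT dYh dTh aphi phi0 Y0 T0.
have cY := ac_cont01 aY; have cT := ac_cont01 aT; have cphi := ac_cont01 aphi.
have cYh : cont01 (fun x => Yh (phi x)).
  by apply: cont01_comp cphi _; exact: continuous_deriv dYh.
have cTh : cont01 (fun x => Th (phi x)).
  by apply: cont01_comp cphi _; exact: continuous_deriv dTh.
pose D x := (Y x - Yh (phi x)) ^+ 2 + (T x - Th (phi x)) ^+ 2.
pose L x := A - B * (Y x ^+ 2 + Y x * Yh (phi x) + Yh (phi x) ^+ 2).
pose dD x := 2 * s x * (1 + L x) * ((Y x - Yh (phi x)) * (T x - Th (phi x))).
have cL : cont01 L.
  apply: cont01B; first exact: cont01_cst.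
  apply: cont01M; first exact: cont01_cst.
  apply: cont01D; last exact: cont01X.
  by apply: cont01D; [exact: cont01X|exact: cont01M].
have [M M0 LM] := cont01_bounded (cont01M cs (cont01D (cont01_cst 1) cL)).
suff D0 : forall x, unit_itv x -> D x = 0.
  move=> x Dx; have /eqP := D0 x Dx.
  rewrite paddr_eq0 ?sqr_ge0// !sqrf_eq0 !subr_eq0.
  by move=> /andP[/eqP ? /eqP ?].
apply: (@gronwall D dD M).
- by apply: cont01D; apply: cont01X; exact: cont01B.
- move=> x x0 x1.
  have dphi := ac_deriv aphi cs x0 x1.
  have dY := ac_deriv aY (cont01M cs cT) x0 x1.
  have cR : cont01 (fun x => s x * (A * Y x - B * Y x ^+ 3)).
    apply: cont01M => //; apply: cont01B; apply: cont01M; [exact: cont01_cst|by []|exact: cont01_cst|exact: cont01X].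
  have dT := ac_deriv aT cR x0 x1.
  apply: deriv_at_eq.
    apply: derivD; apply: derivX; apply: derivB;
      [exact: dY|exact: deriv_comp (dYh _) dphi|exact: dT|exact: deriv_comp (dTh _) dphi].
  by rewrite /= !expr1 /dD /L; ring.
- move=> x x0 x1; have Dx : unit_itv x by apply: unit_itvP; exact: ltW.
  have := LM x Dx; rewrite /dD /D.
  set a := Y x - _; set b := T x - _; set k := s x * _ => kM.
  have -> : 2 * s x * (1 + L x) * (a * b) = 2 * k * (a * b) by rewrite /k; ring.
  have h : `|2 * k * (a * b)| <= M * (a ^+ 2 + b ^+ 2).
    rewrite (normrM (2 * k)) (normrM 2 k) (normrM a b) (@ger0_norm _ 2)// -(real_normK (num_real a)) -(real_normK (num_real b)).
    have a0 := normr_ge0 a; have b0 := normr_ge0 b; have k0 := normr_ge0 k.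
    have h1 := ler_wpM2r (mulr_ge0 a0 b0) kM.
    have h2 : 0 <= M * (`|a| - `|b|) ^+ 2 by rewrite mulr_ge0 ?sqr_ge0// ltW.
    by move: h1 h2; rewrite !expr2; lra.
  exact: le_trans (ler_norm _) h.
- by rewrite /D phi0 Y0 T0 !subrr expr0n addr0.
- by move=> x _; rewrite addr_ge0// sqr_ge0.
Qed.

(** Gronwall with constant 0. It is applied to the squared difference because it asks for a
    nonnegative function. *)
Lemma cont01_deriv0 u v h phi s du : cont01 s -> cont01 h ->
  ac u (fun x => s x * h x) -> ac phi s ->
  (forall z, deriv_at v z (du z)) -> (forall x, unit_itv x -> h x = du (phi x)) ->
  u 0 = v (phi 0) -> forall x, unit_itv x -> u x = v (phi x).
Proof.
move=> cs ch au aphi dv hd u0.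
have cv : cont01 (fun x => v (phi x)).
  by apply: cont01_comp (ac_cont01 aphi) _; exact: continuous_deriv dv.
have cu := ac_cont01 au.
move=> x Dx; apply/eqP; rewrite -subr_eq0 -sqrf_eq0; apply/eqP.
apply: (@gronwall (fun x => (u x - v (phi x)) ^+ 2) (fun=> 0) 0) Dx.
- by apply: cont01X; exact: cont01B.
- move=> y y0 y1; have Dy : unit_itv y by apply: unit_itvP; exact: ltW.
  apply: deriv_at_eq.
    apply: derivX; apply: derivB; first exact: ac_deriv au (cont01M cs ch) y0 y1.
    exact: deriv_comp (dv _) (ac_deriv aphi cs y0 y1).
  by rewrite /= hd//; ring.
- by move=> y _ _; rewrite mul0r.
- by rewrite u0 subrr expr0n.
- by move=> y _; exact: sqr_ge0.
Qed.

End Comparison.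

(** * The explicit curve solves the Duffing equation *)

Section ExplicitCurve.
Variable R : realType.
Implicit Types (x z : R).
Variables (q al : R).
Hypothesis q01 : 0 <= q < 1.
Hypothesis al0 : 0 < al.

Definition arc_amp z : R := am (al * z - EllK q) q.
(** In Jacobi notation, [- 2 q sn dn] at the argument [al * z - K(q)]. *)
Definition arc_slope z : R := - (2 * q * sin (arc_amp z) * modul q (arc_amp z)).

Lemma deriv_arc_amp z : deriv_at arc_amp z (al * modul q (arc_amp z)).
Proof.
apply: deriv_at_eq.
  apply: (deriv_comp (deriv_am q01 _)); apply: derivB; last exact: deriv_cst.
  by apply: derivM; [exact: deriv_cst|exact: deriv_id].
by rewrite /= -/(arc_amp z); ring.
Qed.

Lemma deriv_arc_y z : deriv_at (fun z => (arc_curve q al z).2) z (arc_slope z).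
Proof.
have aln : al != 0 by rewrite gt_eqF.
apply: deriv_at_eq.
  rewrite /arc_curve /=; apply: derivM; last exact: deriv_cst.
  apply: derivM; first exact: deriv_cst.
  exact: deriv_cos (deriv_arc_amp z).
by rewrite /arc_slope /= -/(arc_amp z); field.
Qed.

(** This is [cn'' = (2 q ^ 2 - 1) cn - 2 q ^ 2 cn ^ 3], rescaled by [al]. It matches the equation
    for the height when [lam = 2 al ^ 2 (2 q ^ 2 - 1)] and [c ^ 2 = 4 al ^ 4]. *)
Lemma deriv_arc_slope z : deriv_at arc_slope z
  (al ^+ 2 * (2 * q ^+ 2 - 1) * (arc_curve q al z).2
   - al ^+ 4 / 2 * (arc_curve q al z).2 ^+ 3).
Proof.
have aln : al != 0 by rewrite gt_eqF.
have mn : modul q (arc_amp z) != 0 by rewrite gt_eqF// modul_gt0.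
apply: deriv_at_eq.
  apply: derivN; apply: derivM.
    by apply: derivM; [exact: deriv_cst|exact: deriv_sin (deriv_arc_amp z)].
  exact: deriv_comp (deriv_modul q01 _) (deriv_arc_amp z).
rewrite /arc_curve /= /cn -/(arc_amp z).
transitivity (- (2 * q * al * cos (arc_amp z)) * (modul q (arc_amp z) ^+ 2 - q ^+ 2 * sin (arc_amp z) ^+ 2)).
  by field.
rewrite sqr_modul// sin2cos2.
by field.
Qed.

Lemma deriv_arc_x z : deriv_at (fun z => (arc_curve q al z).1) z
  (1 - 2 * q ^+ 2 * sin (arc_amp z) ^+ 2).
Proof.
have aln : al != 0 by rewrite gt_eqF.
apply: deriv_at_eq.
  rewrite /arc_curve /=; apply: derivM; last exact: deriv_cst.
  apply: derivB; last by apply: derivM; [exact: deriv_cst|exact: deriv_id].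
  apply: derivD; last exact: deriv_cst.
  apply: derivM; first exact: deriv_cst.
  exact: deriv_comp (deriv_EllE q01 _) (deriv_arc_amp z).
rewrite /= -/(arc_amp z).
transitivity (2 * modul q (arc_amp z) ^+ 2 - 1); first by field.
by rewrite sqr_modul//; ring.
Qed.

Lemma arc_amp0 : arc_amp 0 = - (pi / 2).
Proof. by rewrite /arc_amp mulr0 sub0r am_NK. Qed.

Lemma arc_curve0 : arc_curve q al 0 = (0, 0).
Proof.
have aln : al != 0 by rewrite gt_eqF.
rewrite /arc_curve /cn mulr0 sub0r subr0 am_NK// cosN cos_pihalf mulr0 mul0r.
have := EllE_npi q01 0; rewrite !mul0r !addr0 => ->.
by rewrite (_ : 2 * - EllEc q + 2 * EllEc q = 0) ?mul0r//; ring.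
Qed.

Lemma arc_slope0 : arc_slope 0 = 2 * q * modul q (pi / 2).
Proof. by rewrite /arc_slope arc_amp0 modul_even sinN sin_pihalf; ring. Qed.

Lemma arc_curve_end z : 0 < z -> (arc_curve q al z).2 = 0 -> q != 0 ->
  exists2 n : nat, (0 < n)%N & al * z = 2 * n%:R * EllK q /\
    (arc_curve q al z).1 = 2 * n%:R * (2 * EllEc q - EllK q) / al.
Proof.
move=> z0 + qn; have aln : al != 0 by rewrite gt_eqF.
rewrite /arc_curve /= => /eqP; rewrite !mulf_eq0 invr_eq0 (negbTE aln) (negbTE qn) pnatr_eq0 /= orbF => /eqP c0.
have [|n n0 [E1 E2]] := cn_zero q01 _ c0.
  by have := mulr_gt0 al0 z0; lra.
exists n => //; rewrite E2; split; first by lra.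
have -> : al * z = n%:R * (2 * EllK q) by lra.
by field.
Qed.

End ExplicitCurve.

(** * Identification of the elastica with a segment, an arc or a loop *)

Section Shape.
Variable R : realType.
Local Notation mu := (@lebesgue_measure R).
Implicit Types (f h k u v s phi X Y T : R -> R) (a b c e x y q al lam l : R).

Lemma eq_ac_d u h k : (forall x, unit_itv x -> h x = k x) -> ac u h -> ac u k.
Proof.
move=> hk [hi uh]; split; first exact: eq_L1 hk hi.
move=> x Dx; rewrite uh//; congr (_ + _); apply: eq_Rintegral => t.
rewrite inE /= in_itv /= => /andP[t0 tx]; apply: hk; apply: unit_itvP => //.
by apply: le_trans tx _; have /andP[] := mem_unit_itv Dx.
Qed.

Lemma ac_strict_incr u h : ac u h -> cont01 h -> (forall x, unit_itv x -> 0 < h x) ->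
  {in `[0, 1] &, forall x y, x < y -> u x < u y}.
Proof.
move=> uh ch h0 x y; rewrite !in_itv /= => /andP[x0 _] /andP[_ y1] xy.
have d z : z \in `]0, 1[ -> deriv_at u z (h z) /\ 0 < h z.
  rewrite in_itv /= => /andP[z0 z1]; split; first exact: ac_deriv.
  by apply: h0; apply: unit_itvP; exact: ltW.
apply: (@gtr0_derive1_incr R u 0 1) => //.
- by move=> z /d[[]].
- by move=> z /d[[_ dz] hz]; rewrite derive1E dz.
- exact: ac_cont01 uh.
Qed.

Lemma reparam_intro (G : R -> R * R) (L : R) (g : R -> R * R) phi s :
  ac phi s -> cont01 s -> (forall x, unit_itv x -> 0 < s x) ->
  phi 0 = 0 -> phi 1 = L -> (forall x, unit_itv x -> g x = G (phi x)) -> reparam_of G L g.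
Proof.
move=> aphi cs s0 p0 p1 E; exists phi; split; first exact: ac_cont01 aphi.
split; first exact: ac_strict_incr aphi cs s0.
by split=> //; split=> // x /andP[x0 x1]; apply: E; exact: unit_itvP.
Qed.

Lemma isqrt2_gt0 : 0 < isqrt2 R.
Proof. by rewrite invr_gt0 sqrtr_gt0. Qed.

Lemma isqrt2_sq : isqrt2 R ^+ 2 = 2^-1.
Proof. by rewrite /isqrt2 exprVn sqr_sqrtr. Qed.

Lemma isqrt2_ltE q : 0 <= q -> (isqrt2 R < q) = (2^-1 < q ^+ 2).
Proof. by move=> q0; rewrite -isqrt2_sq ltr_pXn2r// nnegrE ltW// isqrt2_gt0. Qed.

Lemma modulus_of_force lam c : 0 < lam -> lam < `|c| ->
  exists q al, [/\ isqrt2 R < q < 1, 0 < al, `|c| = 2 * al ^+ 2 &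
    lam = 2 * al ^+ 2 * (2 * q ^+ 2 - 1)].
Proof.
move=> lam0 lc; have c0 : 0 < `|c| by exact: lt_trans lc.
have r0 : 0 < lam / `|c| by rewrite divr_gt0.
have r1 : lam / `|c| < 1 by rewrite ltr_pdivrMr// mul1r.
exists (Num.sqrt ((1 + lam / `|c|) / 2)), (Num.sqrt (`|c| / 2)).
have q2 : Num.sqrt ((1 + lam / `|c|) / 2) ^+ 2 = (1 + lam / `|c|) / 2.
  by rewrite sqr_sqrtr//; lra.
have a2 : Num.sqrt (`|c| / 2) ^+ 2 = `|c| / 2 by rewrite sqr_sqrtr//; lra.
rewrite q2 a2; split.
- rewrite isqrt2_ltE ?sqrtr_ge0// q2; apply/andP; split; first by lra.
  by rewrite -(@ltr_pXn2r _ 2)// ?nnegrE ?sqrtr_ge0// q2 expr1n; lra.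
- by rewrite sqrtr_gt0 divr_gt0.
- by field.
- by field; rewrite gt_eqF.
Qed.

Lemma elastica_shape lam l (g : R -> R * R) : 0 < lam -> 0 < l ->
  pen_pinned_elastica lam l g ->
  reparam_of (@segment R) l g \/
  exists n q, [/\ (0 < n)%N, isqrt2 R < q < 1, gpol q = lam * l ^+ 2 / n%:R ^+ 2 &
    (0 < 2 * EllEc q - EllK q /\
      reparam_refl (arc_curve q (arc_alpha l n q)) (2 * n%:R * EllK q / arc_alpha l n q) g) \/
    (2 * EllEc q - EllK q < 0 /\
      reparam_refl (loop_curve q (loop_alpha l n q)) (2 * n%:R * EllK q / loop_alpha l n q) g)].
Proof.
move=> lam0 l0 [[[[WX WY] imm0] [g0 g1]] crit]; move: WX WY imm0 g0 g1.
pose X x := (g x).1; pose Y x := (g x).2.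
rewrite -/X -/Y => WX WY imm0 g0 g1.
have X0 : X 0 = 0 by rewrite /X g0.
have Y0 : Y 0 = 0 by rewrite /Y g0.
have X1 : X 1 = l by rewrite /X g1.
have Y1 : Y 1 = 0 by rewrite /Y g1.
have W1 := W22_wit_d WX; have W2 := W22_wit_d WY.
pose v1 := d1 X; pose v2 := d1 Y.
have imm x : unit_itv x -> 0 < v1 x ^+ 2 + v2 x ^+ 2.
  move=> Dx; rewrite lt0r addr_ge0 ?sqr_ge0// andbT paddr_eq0 ?sqr_ge0//.
  rewrite !sqrf_eq0; apply/negP => /andP[/eqP e1 /eqP e2].
  by apply: (imm0 x (mem_unit_itv Dx)); rewrite -/v1 -/v2 e1 e2.
have [c [c0 force aT]] := elastica_pendulum lam0 l0 W1 W2 imm crit X0 Y0 X1 Y1.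
pose s x := Num.sqrt (v1 x ^+ 2 + v2 x ^+ 2); pose T x := v2 x / s x.
have {}force x : unit_itv x -> c * v1 x = (c ^+ 2 / 4 * Y x ^+ 2 - lam) * s x by exact: force.
have {}aT : ac T (fun x => s x * (lam / 2 * Y x - c ^+ 2 / 8 * Y x ^+ 3)) by exact: aT.
have /W22_witP[_ /ac_cont01 cv1 aX] := W1; have /W22_witP[_ /ac_cont01 cv2 aY] := W2.
have s0 x : unit_itv x -> 0 < s x by move=> Dx; rewrite sqrtr_gt0 imm.
have ss x : unit_itv x -> s x ^+ 2 = v1 x ^+ 2 + v2 x ^+ 2.
  by move=> Dx; rewrite sqr_sqrtr// ltW// imm.
have cs : cont01 s by apply: cont01_sqrt; apply: cont01D; exact: cont01X.
have sT x : unit_itv x -> v2 x = s x * T x.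
  by move=> Dx; rewrite /T mulrCA mulfV ?mulr1// gt_eqF// s0.
have aYT : ac Y (fun x => s x * T x) by exact: eq_ac_d sT aY.
pose phi x := 0 + \int[mu]_(t in `[0, x]) s t.
have aphi : ac phi s by exact/ac_prim/cont01_L1.
have phi0 : phi 0 = 0 by rewrite /phi set_itv1 Rintegral_set1 addr0.
have phi1 : 0 < phi 1.
  rewrite -phi0; apply: (ac_strict_incr aphi cs s0); rewrite ?in_itv /= ?lexx ?ler01//.
have s00 := s0 0 (unit_itv0 R).
(* The height is 0 at the start, so the force law makes [- lam / c] the first component of the unit
   tangent there. This also yields [lam <= |c|]. *)
have T0 : T 0 ^+ 2 = 1 - (lam / c) ^+ 2.
  have := force 0 (unit_itv0 R); rewrite Y0 expr0n mulr0 sub0r => f0.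
  have f1 : v1 0 = - (lam / c) * s 0.
    by apply: (mulfI c0); rewrite f0; field.
  have := ss 0 (unit_itv0 R); rewrite f1 (sT 0 (unit_itv0 R)) => E.
  apply: (mulfI (x := s 0 ^+ 2)); first by rewrite expf_neq0// gt_eqF.
  move: E; rewrite exprMn (exprMn _ (s 0)) sqrrN => E.
  by rewrite mulrBr mulr1 {2}E; ring.
have lc : lam <= `|c|.
  have : (lam / c) ^+ 2 <= 1 by have := sqr_ge0 (T 0); rewrite T0; lra.
  rewrite expr_div_n ler_pdivrMr ?mul1r ?exprn_even_gt0// => h.
  suff : lam ^+ 2 <= `|c| ^+ 2 by rewrite ler_pXn2r ?nnegrE ?(ltW lam0).
  by rewrite real_normK ?num_real.
pose h x := (c ^+ 2 / 4 * Y x ^+ 2 - lam) / c.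
have ch : cont01 h.
  apply: cont01M; last exact: cont01_cst.
  apply: cont01B; last exact: cont01_cst.
  by apply: cont01M; [exact: cont01_cst|apply: cont01X; exact: ac_cont01 aY].
have sh x : unit_itv x -> v1 x = s x * h x.
  by move=> Dx; apply: (mulfI c0); rewrite force// /h; field.
have aXh : ac X (fun x => s x * h x) by exact: eq_ac_d sh aX.
have s0' x : unit_itv x -> 0 <= s x by move=> Dx; exact/ltW/s0.
(* In the equality case the initial slope is zero, so the height vanishes identically and the curve
   stays on the axis. *)
move: lc; rewrite le_eqVlt => /predU1P[lc|lc].
  left.
  have T00 : T 0 = 0.
    apply/eqP; rewrite -sqrf_eq0 T0 expr_div_n lc real_normK ?num_real// divff ?subrr//.
    by rewrite sqrf_eq0.
  have dz (z : R) : deriv_at (fun=> 0 : R) z ((fun=> 0) z) by exact: deriv_cst.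
  have dz' (z : R) : deriv_at (fun=> 0 : R) z (lam / 2 * 0 - c ^+ 2 / 8 * 0 ^+ 3).
    by apply: deriv_at_eq (deriv_cst 0 z) _; rewrite expr0n /= !mulr0 subrr.
  have YT := ode_unique cs s0' aYT aT dz dz' aphi phi0 Y0 T00.
  have dX (z : R) : deriv_at (fun z => - (lam / c) * z) z (- (lam / c)).
    apply: deriv_at_eq; first by apply: derivM; [exact: deriv_cst|exact: deriv_id].
    by rewrite /=; ring.
  have hd x : unit_itv x -> h x = - (lam / c).
    by move=> Dx; rewrite /h (YT x Dx).1 expr0n /=; field.
  have XE := cont01_deriv0 cs ch aXh aphi dX hd.
  rewrite X0 phi0 mulr0 in XE; have {}XE := XE erefl.
  (* Arriving at [l > 0] forces [c] to be negative. *)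
  have lc1 : - (lam / c) = 1.
    have := XE 1 (unit_itv1 R); rewrite X1 => E.
    have : 0 < - (lam / c) by rewrite -(pmulr_lgt0 _ phi1) -E.
    rewrite lc; case: (ltP c 0) => cs0; first by rewrite ltr0_norm// mulNr opprK divff.
    by rewrite ger0_norm// divff// oppr_gt0 ltr10.
  apply: (reparam_intro aphi cs s0 phi0).
    by have := XE 1 (unit_itv1 R); rewrite lc1 mul1r X1.
  move=> x Dx; rewrite /segment [g x]surjective_pairing -/(X x) -/(Y x).
  by rewrite XE// lc1 mul1r (YT x Dx).1.
right.
have [q [al [/andP[qs q1] al0 cE lamE]]] := modulus_of_force lam0 lc.
have q0 : 0 < q by exact: lt_trans isqrt2_gt0 qs.
have q01 : 0 <= q < 1 by rewrite ltW.
have qn : q != 0 by rewrite gt_eqF.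
have aln : al != 0 by rewrite gt_eqF.
have c2 : c ^+ 2 = 4 * al ^+ 4.
  by rewrite -(real_normK (num_real c)) cE; ring.
have dS (z : R) : deriv_at (arc_slope q al) z (lam / 2 * (arc_curve q al z).2 - c ^+ 2 / 8 * (arc_curve q al z).2 ^+ 3).
  apply: deriv_at_eq (deriv_arc_slope q01 al0 z) _.
  by rewrite c2 lamE; congr (_ * _ - _ * _); field.
(* Only the square of the initial slope is known. The Duffing equation is odd in the height, so [e]
   absorbs the sign; it becomes the reflection across the axis. *)
have [e [e2 Te]] : exists e, (e = 1 \/ e = -1) /\ e * T 0 = arc_slope q al 0.
  have : T 0 ^+ 2 = arc_slope q al 0 ^+ 2.
    rewrite arc_slope0// T0 (exprMn _ (2 * q)) sqr_modul// sin_pihalf expr_div_n c2 lamE.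
    by field.
  move=> /eqP; rewrite eqf_sqr => /orP[/eqP E|/eqP E].
    by exists 1; split; [left|rewrite mul1r].
  by exists (-1); split; [right|rewrite mulN1r E opprK].
have ee : e * e = 1 by case: e2 => ->; rewrite ?mulrNN mulr1.
have aY' : ac (fun x => e * Y x) (fun x => s x * (e * T x)).
  by apply: eq_ac_d (acZ e aYT) => x _; ring.
have aT' : ac (fun x => e * T x) (fun x => s x * (lam / 2 * (e * Y x) - c ^+ 2 / 8 * (e * Y x) ^+ 3)).
  apply: eq_ac_d (acZ e aT) => x _.
  transitivity (s x * (lam / 2 * (e * Y x) - c ^+ 2 / 8 * ((e * e) * e * Y x ^+ 3))); last by ring.
  by rewrite ee; ring.
have YT x (Dx : unit_itv x) : e * Y x = (arc_curve q al (phi x)).2.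
  have H := ode_unique cs s0' aY' aT' (deriv_arc_y q01 al0) dS aphi phi0.
  have H1 : e * Y 0 = (arc_curve q al 0).2 by rewrite Y0 mulr0 arc_curve0.
  by have [] := H H1 Te x Dx.
have YE x (Dx : unit_itv x) : Y x = e * (arc_curve q al (phi x)).2.
  by rewrite -YT// mulrA ee mul1r.
(* The sign of [c] reverses the horizontal velocity but not the equation for the height, where [c]
   is squared. *)
have [d [d2 cd]] : exists d, (d = 1 \/ d = -1) /\ c = d * (2 * al ^+ 2).
  rewrite -cE; case: (ltP c 0) => cs0.
    by exists (-1); split; [right|rewrite ltr0_norm// mulN1r opprK].
  by exists 1; split; [left|rewrite ger0_norm// mul1r].
have dd : d * d = 1 by case: d2 => ->; rewrite ?mulrNN mulr1.
have dn : d != 0 by apply/eqP => dz; move: dd; rewrite dz mul0r => /eqP; rewrite eq_sym oner_eq0.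
have XE x (Dx : unit_itv x) : X x = d * (arc_curve q al (phi x)).1.
  have dX (z : R) : deriv_at (fun z => d * (arc_curve q al z).1) z
      (d * (1 - 2 * q ^+ 2 * sin (arc_amp q al z) ^+ 2)).
    apply: deriv_at_eq; first by apply: derivM; [exact: deriv_cst|exact: deriv_arc_x].
    by rewrite /=; ring.
  have hd y : unit_itv y -> h y = d * (1 - 2 * q ^+ 2 * sin (arc_amp q al (phi y)) ^+ 2).
    move=> Dy; rewrite /h YE// exprMn (expr2 e) ee mul1r.
    rewrite /arc_curve /= /cn -/(arc_amp q al (phi y)) sin2cos2 c2 cd lamE.
    have dV : d^-1 = d by apply: (mulfI dn); rewrite mulfV.
    by rewrite invfM dV; field.
  apply: (cont01_deriv0 cs ch aXh aphi dX hd) Dx.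
  by rewrite phi0 arc_curve0// mulr0.
(* The far end is again on the axis, so [cn] vanishes there and the curve consists of a whole number
   [n] of half-periods. *)
have [|//|n n0 [aphi1 Xend]] := arc_curve_end q01 al0 phi1.
  by rewrite -YT ?Y1 ?mulr0//; exact: unit_itv1.
have nn : n%:R != 0 :> R by rewrite pnatr_eq0 -lt0n.
have n0' : 0 < n%:R :> R by rewrite ltr0n.
have ln : l != 0 by rewrite gt_eqF.
(* The abscissa of the far end fixes the scale. *)
have lE : al = d * (2 * n%:R / l * (2 * EllEc q - EllK q)).
  have := XE 1 (unit_itv1 R); rewrite X1 Xend => E.
  apply: (mulfI ln); rewrite {1}E.
  transitivity (d * (2 * n%:R * (2 * EllEc q - EllK q))); first by field.
  by field.
have phiE : phi 1 = 2 * n%:R * EllK q / al by rewrite -aphi1; field.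
(* Inserting this scale into [lam = 2 al ^ 2 (2 q ^ 2 - 1)] eliminates [al], and the sign [d]
   disappears in the square. *)
have gq : gpol q = lam * l ^+ 2 / n%:R ^+ 2.
  rewrite lamE /gpol {1}lE.
  transitivity ((d * d) * 8 * (2 * EllEc q - EllK q) ^+ 2 * (2 * q ^+ 2 - 1)).
    by rewrite dd; ring.
  by field; rewrite nn ln.
exists n, q; rewrite qs q1; split=> //.
have gE x : g x = (X x, Y x) by rewrite /X /Y -surjective_pairing.
(* Since [al] is positive, [d] has the sign of [2 E - K]. *)
case: d2 => dv; rewrite dv ?mul1r ?mulN1r in lE XE.
- left; rewrite /arc_alpha -lE; split.
    by move: al0; rewrite {1}lE pmulr_rgt0// divr_gt0// mulr_gt0.
  case: e2 => ev; [left|right]; apply: (reparam_intro aphi cs s0 phi0 phiE) => x Dx;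
    rewrite gE XE// YE// ev ?mul1r ?mulN1r.
    by rewrite -surjective_pairing.
  by rewrite /reflx.
- right; have lE' : loop_alpha l n q = al by rewrite lE /loop_alpha; ring.
  rewrite lE'; split.
    by move: al0; rewrite {1}lE oppr_gt0 pmulr_rlt0// divr_gt0// mulr_gt0.
  have loopE z : loop_curve q al z = (- (arc_curve q al z).1, (arc_curve q al z).2).
    by rewrite /loop_curve /arc_curve /=; congr (_, _); ring.
  case: e2 => ev; [left|right]; apply: (reparam_intro aphi cs s0 phi0 phiE) => x Dx;
    by rewrite gE XE// YE// ev ?mul1r ?mulN1r loopE.
Qed.

End Shape.

(** * Dependence on the modulus *)

Section Modulus.
Variable R : realType.
Local Notation mu := (@lebesgue_measure R).
Implicit Types (f g h F : R -> R) (a b c e x y t q p : R).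

Lemma oint_antideriv f F a x : continuous f -> (forall y, deriv_at F y (f y)) ->
  oint a x f = F x - F a.
Proof.
move=> cf dF.
have d0 y : deriv_at (fun z => oint a z f - F z) y 0.
  apply: deriv_at_eq; first by apply: derivB; [exact: is_derive_oint|exact: dF].
  by rewrite subrr.
have := deriv_zero_const d0 x a.
by rewrite oint0 sub0r => /eqP; rewrite subr_eq addrC => /eqP.
Qed.

Lemma contM f g : continuous f -> continuous g -> continuous (fun x => f x * g x).
Proof. by move=> cf cg x; exact: (continuousM (cf x) (cg x)). Qed.

Lemma contD f g : continuous f -> continuous g -> continuous (fun x => f x + g x).
Proof. by move=> cf cg x; exact: (continuousD (cf x) (cg x)). Qed.

Lemma contC c : continuous (fun _ : R => c).
Proof. by move=> x; exact: cvg_cst. Qed.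

Lemma contZ c f : continuous f -> continuous (fun x => c * f x).
Proof. by move=> cf; apply: contM => //; exact: contC. Qed.

Lemma oint_ge0 f x : 0 <= x -> (forall t, 0 <= t -> t <= x -> 0 <= f t) -> 0 <= oint 0 x f.
Proof.
move=> x0 f0; rewrite /oint x0; apply: Rintegral_ge0 => t /=.
by rewrite in_itv /= => /andP[t0 tx]; exact: f0.
Qed.

Lemma ointD f g x : continuous f -> continuous g ->
  oint 0 x (fun t => f t + g t) = oint 0 x f + oint 0 x g.
Proof.
move=> cf cg; rewrite (oint_antideriv (F := fun y => oint 0 y f + oint 0 y g) _ _ (contD cf cg)).
  by rewrite !oint0 addr0 subr0.
by move=> y; apply: derivD; exact: is_derive_oint.
Qed.

Lemma ointZ f c x : continuous f -> oint 0 x (fun t => c * f t) = c * oint 0 x f.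
Proof.
move=> cf; rewrite (oint_antideriv (F := fun y => c * oint 0 y f) _ _ (contZ (c := c) cf)).
  by rewrite !oint0 mulr0 subr0.
move=> y; apply: deriv_at_eq.
  by apply: derivM; [exact: deriv_cst|exact: is_derive_oint].
by rewrite /= mulr0 addr0.
Qed.

Lemma eq_oint f g x : (forall t, f t = g t) -> oint 0 x f = oint 0 x g.
Proof. by move=> /funext ->. Qed.

Lemma pihalf_gt0 : 0 < pi / 2 :> R.
Proof. by rewrite divr_gt0 ?pi_gt0. Qed.

Section FixedQ.
Variable q : R.
Hypothesis q01 : 0 < q < 1.
Let q01' : 0 <= q < 1. Proof. by have /andP[/ltW -> ->] := q01. Qed.

Lemma continuous_sin2 : continuous (fun t : R => sin t ^+ 2).
Proof.
apply: (@continuous_deriv R _ (fun t => 2 * sin t * cos t)) => t.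
by apply: deriv_at_eq; [apply: derivX; exact: is_derive_sin|rewrite /= expr1].
Qed.

Lemma continuous_sin2_modul n : continuous (fun t : R => sin t ^+ 2 / modul q t ^+ n).
Proof.
apply: contM; first exact: continuous_sin2.
move=> t; apply: cvgV; first by rewrite expf_neq0// gt_eqF// modul_gt0.
by apply: (@continuous_comp _ _ _ (modul q) (fun x => x ^+ n));
  [exact: continuous_modul|exact: exprn_continuous].
Qed.

(** Differentiation in the modulus produces these integrals: [- q] times the one with [n = 1] for
    [E], and [q] times the one with [n = 3] for [K]. The identities below express them back through
    [E] and [K]. *)
Definition int_sin2_modul n := oint 0 (pi / 2) (fun t : R => sin t ^+ 2 / modul q t ^+ n).

Lemma modul_n0 t : modul q t != 0.
Proof. by rewrite gt_eqF// modul_gt0. Qed.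

Lemma int_sin2_modul1 : q ^+ 2 * int_sin2_modul 1 = EllK q - EllEc q.
Proof.
rewrite /int_sin2_modul -ointZ; last exact: continuous_sin2_modul.
rewrite /EllK /EllEc /EllF /EllE.
apply/eqP; rewrite eq_sym subr_eq; apply/eqP.
rewrite -ointD.
- apply: eq_oint => t; rewrite -/(modul q t); have m0 := modul_n0 t.
  have -> : q ^+ 2 * (sin t ^+ 2 / modul q t ^+ 1) = (1 - modul q t ^+ 2) / modul q t.
    by rewrite sqr_modul//; field.
  by field.
- by apply: contZ; exact: continuous_sin2_modul.
- exact: continuous_modul.
Qed.

Lemma int_sin2_modul3 : q ^+ 2 * (1 - q ^+ 2) * int_sin2_modul 3 = EllEc q - (1 - q ^+ 2) * EllK q.
Proof.
have q2 := q2_lt1 q01'.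
(* This function vanishes at 0 and at [pi / 2], so its derivative integrates to zero; expanding the
   derivative gives the relation. *)
pose F t := - (q ^+ 2 * sin t * cos t / modul q t).
pose dF t := q ^+ 2 * (1 - q ^+ 2) * (sin t ^+ 2 / modul q t ^+ 3) + (- 1 * modul q t + (1 - q ^+ 2) * (modul q t)^-1).
have cV := continuous_modulV q01'; have cm := continuous_modul q01'.
have c1 : continuous (fun t => q ^+ 2 * (1 - q ^+ 2) * (sin t ^+ 2 / modul q t ^+ 3)).
  by apply: contZ; exact: continuous_sin2_modul.
have c2 : continuous (fun t => - 1 * modul q t).
  by apply: contZ; exact: cm.
have c3 : continuous (fun t => (1 - q ^+ 2) * (modul q t)^-1).
  by apply: contZ; exact: cV.
have c23 : continuous (fun t => - 1 * modul q t + (1 - q ^+ 2) * (modul q t)^-1).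
  exact: contD.
have cdF : continuous dF by exact: contD.
have dFE t : deriv_at F t (dF t).
  apply: deriv_at_eq.
    apply: derivN; apply: derivM; last by apply: derivV; [exact: modul_n0|exact: deriv_modul].
    apply: derivM; last exact: is_derive_cos.
    by apply: derivM; [exact: deriv_cst|exact: is_derive_sin].
  have m0 := modul_n0 t.
  transitivity (- (q ^+ 2 * (((1 - sin t ^+ 2) - sin t ^+ 2) * modul q t ^+ 2 + q ^+ 2 * sin t ^+ 2 * (1 - sin t ^+ 2))) / modul q t ^+ 3).
    by rewrite -cos2sin2 /=; field.
  rewrite /dF; transitivity ((q ^+ 2 * (1 - q ^+ 2) * sin t ^+ 2 - (modul q t ^+ 2) ^+ 2 + (1 - q ^+ 2) * modul q t ^+ 2) / modul q t ^+ 3); last by field.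
  by rewrite sqr_modul//; congr (_ / _); ring.
have := oint_antideriv 0 (pi / 2) cdF dFE.
rewrite /F sin0 cos_pihalf !mulr0 !mul0r subrr /dF ointD// ointD// !ointZ//; last exact: continuous_sin2_modul.
rewrite -/(int_sin2_modul 3) -/(EllEc q) -/(EllK q).
by rewrite -[oint 0 _ (modul q)]/(EllEc q) -[oint 0 _ (fun t => (modul q t)^-1)]/(EllK q) => H; lra.
Qed.

Lemma int_sin2_modul_ge0 n : 0 <= int_sin2_modul n.
Proof.
apply: oint_ge0 => [|t _ _]; first exact/ltW/pihalf_gt0.
by rewrite divr_ge0 ?sqr_ge0// exprn_ge0// ltW// modul_gt0.
Qed.

Lemma oint_sin2 : oint 0 (pi / 2) (fun t : R => sin t ^+ 2) = pi / 4.
Proof.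
rewrite (oint_antideriv (F := fun t => (t - sin t * cos t) / 2)).
- by rewrite sin0 cos_pihalf mulr0 mul0r !subr0 mul0r subr0; field.
- exact: continuous_sin2.
move=> t; apply: deriv_at_eq.
  apply: derivM; last exact: deriv_cst.
  apply: derivB; first exact: deriv_id.
  by apply: derivM; [exact: is_derive_sin|exact: is_derive_cos].
transitivity ((1 - (1 - sin t ^+ 2) + sin t ^+ 2) / 2); last by field.
by rewrite -cos2sin2 /=; field.
Qed.

(** Since [modul <= 1], the integral is at least that of [sin ^ 2], which is [pi / 4]. *)
Lemma int_sin2_modul1_gt0 : 0 < int_sin2_modul 1.
Proof.
apply: (@lt_le_trans _ _ (pi / 4)); first by rewrite divr_gt0 ?pi_gt0.
rewrite -oint_sin2 -subr_ge0.
have -> : int_sin2_modul 1 - oint 0 (pi / 2) (fun t => sin t ^+ 2) =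
    oint 0 (pi / 2) (fun t => sin t ^+ 2 / modul q t ^+ 1 + -1 * sin t ^+ 2).
  rewrite ointD ?ointZ ?mulN1r//; first exact: continuous_sin2.
  - exact: continuous_sin2_modul.
  - by apply: contZ; exact: continuous_sin2.
apply: oint_ge0 => [|t _ _]; first exact/ltW/pihalf_gt0.
rewrite mulN1r subr_ge0 expr1 ler_pdivlMr ?modul_gt0//.
by rewrite ler_piMr ?sqr_ge0// modul_le1.
Qed.

Lemma EllEc_gt0 : 0 < EllEc q.
Proof.
have := @deriv_pos_increasing R (fun x => EllE x q) (modul q) (deriv_EllE q01') (modul_gt0 q01') 0 (pi / 2).
by rewrite [EllE 0 q]oint0; apply; exact: pihalf_gt0.
Qed.

Lemma EllEc_le : EllEc q <= pi / 2.
Proof.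
rewrite -subr_ge0.
have -> : pi / 2 - EllEc q = oint 0 (pi / 2) (fun t => 1 + -1 * modul q t).
  rewrite ointD ?ointZ//; first last.
  - by apply: contZ; exact: continuous_modul.
  - by move=> t; exact: cvg_cst.
  - exact: continuous_modul.
  rewrite (oint_antideriv (F := id)); first by rewrite /= subr0 mulN1r.
    by move=> t; exact: cvg_cst.
  by move=> t; exact: deriv_id.
apply: oint_ge0 => [|t _ _]; first exact/ltW/pihalf_gt0.
by rewrite mulN1r subr_ge0 modul_le1.
Qed.

End FixedQ.

Lemma modul_ge b e t : 0 <= b < 1 -> 0 <= e <= b -> Num.sqrt (1 - b ^+ 2) <= modul e t.
Proof.
move=> b01 /andP[e0 eb]; apply: ler_wsqrtr; rewrite lerD2l lerN2.
have b0 : 0 <= b by have /andP[] := b01.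
apply: (@le_trans _ _ (e ^+ 2)); first by rewrite ler_piMr ?sqr_ge0// sin2_le1.
by rewrite lerXn2r.
Qed.

Lemma deriv_modul_q q t : 0 <= q < 1 ->
  deriv_at (fun q => modul q t) q (- (q * sin t ^+ 2) / modul q t).
Proof.
move=> q01; apply: deriv_at_eq.
  apply: deriv_sqrt; first exact: modul_sq_gt0.
  apply: derivB; first exact: deriv_cst.
  apply: derivM; last exact: deriv_cst.
  by apply: derivX; exact: deriv_id.
rewrite /= expr1 -/(modul q t); field.
by rewrite gt_eqF// modul_gt0.
Qed.

Lemma EllK_itv q : EllK q = \int[mu]_(t in `[0, pi / 2]) (modul q t)^-1.
Proof. by rewrite /EllK /EllF /oint (ltW pihalf_gt0). Qed.

Lemma EllEc_itv q : EllEc q = \int[mu]_(t in `[0, pi / 2]) modul q t.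
Proof. by rewrite /EllEc /EllE /oint (ltW pihalf_gt0). Qed.

End Modulus.

(** * Derivatives and monotonicity of the complete integrals, and the sign of [2 E - K] *)

Section ModulusDerivative.
Variable R : realType.
Local Notation mu := (@lebesgue_measure R).
Implicit Types (f g h F : R -> R) (a b c e x y t q p : R).

Lemma int_sin2_modul_scale q n : 0 < q < 1 ->
  \int[mu]_(t in `[0, pi / 2]) (q * (sin t ^+ 2 / modul q t ^+ n)) = q * int_sin2_modul q n.
Proof.
move=> q01; rewrite /int_sin2_modul -ointZ; last exact: continuous_sin2_modul.
by rewrite /oint (ltW (pihalf_gt0 R)).
Qed.

Lemma oint_le f g x : 0 <= x -> continuous f -> continuous g ->
  (forall t, 0 <= t -> t <= x -> f t <= g t) -> oint 0 x f <= oint 0 x g.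
Proof.
move=> x0 cf cg fg; rewrite /oint x0; apply: le_Rintegral.
- exact: measurable_itv.
- exact: continuous_integrable_itv.
- exact: continuous_integrable_itv.
- by move=> t /=; rewrite in_itv /= => /andP[]; exact: fg.
Qed.

Lemma half_itv q : 0 < q < 1 -> 0 <= (1 + q) / 2 < 1 /\ 0 < q < (1 + q) / 2.
Proof. by move=> /andP[q0 q1]; split; apply/andP; split; lra. Qed.

(** For parameters up to the midpoint [b] of [q] and 1, [modul] stays above [dl = sqrt (1 - b ^ 2)]
    at every angle, which provides a constant dominating function. *)
Lemma deriv_EllK q : 0 < q < 1 -> deriv_at (@EllK R) q (q * int_sin2_modul q 3).
Proof.
move=> q01; have [b01 qb] := half_itv q01; set b := (1 + q) / 2 in b01 qb.
have e01 e : 0 < e < b -> 0 <= e < 1.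
  by move=> /andP[e0 eb]; rewrite ltW//; have /andP[_ b1] := b01; exact: lt_trans b1.
have -> : @EllK R = (fun e => \int[mu]_(t in `[0, pi / 2]) (modul e t)^-1).
  by apply/funext => e; exact: EllK_itv.
rewrite -int_sin2_modul_scale//.
pose dl := Num.sqrt (1 - b ^+ 2).
have dl0 : 0 < dl by rewrite sqrtr_gt0 subr_gt0 q2_lt1.
have mge e t : 0 < e < b -> dl <= modul e t.
  by move=> /andP[e0 eb]; apply: modul_ge => //; rewrite (ltW e0) ltW.
apply: (@is_derive_under_integral R `[0, pi / 2]%classic (fun e t => (modul e t)^-1)
  (fun e t => e * (sin t ^+ 2 / modul e t ^+ 3)) (fun=> (dl ^+ 3)^-1) 0 b q).
- exact: measurable_itv.
- exact: qb.
- move=> e eb; apply: continuous_integrable_itv; exact: continuous_modulV (e01 e eb).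
- move=> e t eb _; have m0 := modul_gt0 (e01 e eb) t.
  apply: deriv_at_eq.
    by apply: derivV; [rewrite gt_eqF|exact: deriv_modul_q (e01 e eb)].
  by rewrite /=; field; rewrite gt_eqF.
- by move=> t; rewrite invr_ge0 exprn_ge0// ltW.
- apply: continuous_integrable_itv; exact: contC.
move=> e t eb _; have /andP[e0 e1] := e01 e eb.
have mt := mge e t eb; have m0 := lt_le_trans dl0 mt.
have m3 : 0 < modul e t ^+ 3 by rewrite exprn_gt0.
have i0 : 0 <= (modul e t ^+ 3)^-1 by rewrite invr_ge0 ltW.
have s0 := sqr_ge0 (sin t); have s1 := sin2_le1 t.
rewrite mulrA ger0_norm; last by rewrite mulr_ge0// mulr_ge0.
apply: (@le_trans _ _ (1 * (modul e t ^+ 3)^-1)).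
  by apply: ler_wpM2r => //; rewrite mulr_ile1// ltW.
by rewrite mul1r lef_pV2 ?posrE ?exprn_gt0// lerXn2r// nnegrE ltW.
Qed.

Lemma deriv_EllEc q : 0 < q < 1 -> deriv_at (@EllEc R) q (- (q * int_sin2_modul q 1)).
Proof.
move=> q01; have [b01 qb] := half_itv q01; set b := (1 + q) / 2 in b01 qb.
have e01 e : 0 < e < b -> 0 <= e < 1.
  by move=> /andP[e0 eb]; rewrite ltW//; have /andP[_ b1] := b01; exact: lt_trans b1.
have -> : @EllEc R = (fun e => \int[mu]_(t in `[0, pi / 2]) modul e t).
  by apply/funext => e; exact: EllEc_itv.
have -> : - (q * int_sin2_modul q 1) = \int[mu]_(t in `[0, pi / 2]) (- q * (sin t ^+ 2 / modul q t ^+ 1)).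
  have := @ointZ R (fun t => sin t ^+ 2 / modul q t ^+ 1) (- q) (pi / 2) (continuous_sin2_modul q01 (n := 1%N)).
  by rewrite {1}/oint (ltW (pihalf_gt0 R)) => ->; rewrite mulNr.
pose dl := Num.sqrt (1 - b ^+ 2).
have dl0 : 0 < dl by rewrite sqrtr_gt0 subr_gt0 q2_lt1.
have mge e t : 0 < e < b -> dl <= modul e t.
  by move=> /andP[e0 eb]; apply: modul_ge => //; rewrite (ltW e0) ltW.
apply: (@is_derive_under_integral R `[0, pi / 2]%classic (fun e t => modul e t)
  (fun e t => - e * (sin t ^+ 2 / modul e t ^+ 1)) (fun=> dl^-1) 0 b q).
- exact: measurable_itv.
- exact: qb.
- move=> e eb; apply: continuous_integrable_itv; exact: continuous_modul (e01 e eb).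
- move=> e t eb _; have m0 := modul_gt0 (e01 e eb) t.
  apply: deriv_at_eq; first exact: deriv_modul_q (e01 e eb).
  by field; rewrite gt_eqF.
- by move=> t; rewrite invr_ge0 ltW.
- apply: continuous_integrable_itv; exact: contC.
move=> e t eb _; have /andP[e0 e1] := e01 e eb.
have mt := mge e t eb; have m0 := lt_le_trans dl0 mt.
have i0 : 0 <= (modul e t)^-1 by rewrite invr_ge0 ltW.
have s0 := sqr_ge0 (sin t); have s1 := sin2_le1 t.
rewrite expr1 mulNr normrN mulrA ger0_norm; last by rewrite mulr_ge0// mulr_ge0.
apply: (@le_trans _ _ (1 * (modul e t)^-1)).
  by apply: ler_wpM2r => //; rewrite mulr_ile1// ltW.
by rewrite mul1r lef_pV2 ?posrE.
Qed.

(** The horizontal advance of [arc_curve] over one half-period is [2 / al] times this quantity; its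
    sign separates arcs from loops. *)
Definition EllGap q : R := 2 * EllEc q - EllK q.

Lemma deriv_EllGap q : 0 < q < 1 -> deriv_at EllGap q (2 * - (q * int_sin2_modul q 1) - q * int_sin2_modul q 3).
Proof.
move=> q01; apply: deriv_at_eq.
  apply: derivB; last exact: deriv_EllK.
  by apply: derivM; [exact: deriv_cst|exact: deriv_EllEc].
by rewrite /= mulr0 addr0.
Qed.

Lemma strict_incr_itv f (df : R -> R) a b : (forall x, a <= x <= b -> deriv_at f x (df x)) ->
  (forall x, a < x < b -> 0 < df x) -> forall x y, a <= x -> x < y -> y <= b -> f x < f y.
Proof.
move=> d d0; apply: (@gtr0_derive1_incr R f a b).
- by move=> x; rewrite in_itv /= => /andP[ax xb]; have [] := d x _; rewrite ?(ltW ax) ?(ltW xb).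
- move=> x; rewrite in_itv /= => /andP[ax xb]; rewrite derive1E.
  by have [|_ ->] := d x _; [rewrite (ltW ax) (ltW xb)|apply: d0; rewrite ax].
- apply: continuous_in_subspaceT => x; rewrite inE /= in_itv /= => xab.
  exact: is_derive_continuous (d x xab).
Qed.

Lemma strict_decr_itv f (df : R -> R) a b : (forall x, a <= x <= b -> deriv_at f x (df x)) ->
  (forall x, a < x < b -> df x < 0) -> forall x y, a <= x -> x < y -> y <= b -> f y < f x.
Proof.
move=> d d0 x y ax xy yb; rewrite -ltrN2.
apply: (@strict_incr_itv (fun x => - f x) (fun x => - df x) a b) => //.
- by move=> z zab; apply: derivN; exact: d.
- by move=> z zab; rewrite oppr_gt0 d0.
Qed.

Lemma sub_itv p q x : 0 < p -> q < 1 -> p <= x <= q -> 0 < x < 1.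
Proof.
move=> p0 q1 /andP[px xq].
by rewrite (lt_le_trans p0 px) (le_lt_trans xq q1).
Qed.

Lemma EllGap_decr p q : 0 < p -> p < q -> q < 1 -> EllGap q < EllGap p.
Proof.
move=> p0 pq q1.
apply: (@strict_decr_itv EllGap (fun q => 2 * - (q * int_sin2_modul q 1) - q * int_sin2_modul q 3) p q) => //.
  by move=> x /(sub_itv p0 q1); exact: deriv_EllGap.
move=> x /andP[/ltW px /ltW xq].
have x01 : 0 < x < 1 by apply: (sub_itv p0 q1); rewrite px.
have /andP[x0 _] := x01.
have h1 := mulr_gt0 x0 (int_sin2_modul1_gt0 x01); have h3 := mulr_ge0 (ltW x0) (int_sin2_modul_ge0 x01 3).
lra.
Qed.

Lemma EllK_le p q : 0 < p -> p < q -> q < 1 -> EllK p <= EllK q.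
Proof.
move=> p0 pq q1.
have d x : p <= x <= q -> deriv_at (@EllK R) x (x * int_sin2_modul x 3).
  by move=> /(sub_itv p0 q1); exact: deriv_EllK.
apply: (@ger0_derive1_ndecr R (@EllK R) p q) => //; try exact: ltW.
- by move=> x; rewrite in_itv /= => /andP[/ltW a /ltW b]; have [] := d x _; rewrite ?a ?b.
- move=> x; rewrite in_itv /= => /andP[/ltW a /ltW b]; rewrite derive1E.
  have ab : p <= x <= q by rewrite a b.
  have [_ ->] := d x ab; have x01 := sub_itv p0 q1 ab; have /andP[x0 _] := x01.
  exact: mulr_ge0 (ltW x0) (int_sin2_modul_ge0 x01 3).
- apply: continuous_in_subspaceT => x; rewrite inE /= in_itv /= => xab.
  exact: is_derive_continuous (d x xab).
Qed.

Lemma EllEc_decr p q : 0 < p -> p < q -> q < 1 -> EllEc q < EllEc p.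
Proof.
move=> p0 pq q1.
apply: (@strict_decr_itv (@EllEc R) (fun q => - (q * int_sin2_modul q 1)) p q) => //.
  by move=> x /(sub_itv p0 q1); exact: deriv_EllEc.
move=> x /andP[/ltW px /ltW xq].
have x01 : 0 < x < 1 by apply: (sub_itv p0 q1); rewrite px.
have /andP[x0 _] := x01.
by rewrite oppr_lt0 mulr_gt0// int_sin2_modul1_gt0.
Qed.

Lemma sin_le_id x : 0 <= x -> sin x <= x.
Proof.
move=> x0.
have d y : deriv_at (fun y => y - sin y) y (1 - cos y).
  by apply: derivB; [exact: deriv_id|exact: is_derive_sin].
have : 0 - sin 0 <= x - sin x.
  apply: (@ger0_derive1_ndecr R (fun y => y - sin y) 0 x) => //.
  - by move=> y _; rewrite derive1E; have [_ ->] := d y; rewrite subr_ge0 cos_le1.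
  - exact: continuous_subspaceT (continuous_deriv d).
by rewrite sin0 subrr subr_ge0.
Qed.

(* [modul q t <= d + (pi / 2 - t)], so [K(q)] grows like [- ln d]. *)
Lemma EllK_ge_ln q (d : R) : 0 <= q < 1 -> 0 < d -> 1 - q ^+ 2 = d ^+ 2 ->
  ln (d + pi / 2) - ln d <= EllK q.
Proof.
move=> q01 d0 qd.
have arg0 y : y <= pi / 2 -> 0 < d + (pi / 2 - y) by lra.
have dh y : y <= pi / 2 -> deriv_at (fun y => EllF y q + ln (d + (pi / 2 - y))) y
    ((modul q y)^-1 - (d + (pi / 2 - y))^-1).
  move=> y1; apply: deriv_at_eq.
    apply: derivD; first exact: deriv_EllF.
    apply: (deriv_comp (g := fun y => d + (pi / 2 - y)) (is_derive1_ln (arg0 y y1))).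
    apply: derivD; first exact: deriv_cst.
    by apply: derivB; [exact: deriv_cst|exact: deriv_id].
  by rewrite /= add0r sub0r mulrN1.
have : EllF 0 q + ln (d + (pi / 2 - 0)) <= EllF (pi / 2) q + ln (d + (pi / 2 - pi / 2)).
  apply: (@ger0_derive1_ndecr R (fun y => EllF y q + ln (d + (pi / 2 - y))) 0 (pi / 2)) => //.
  - by move=> y; rewrite in_itv /= => /andP[_ /ltW y1]; have [] := dh y y1.
  - move=> y; rewrite in_itv /= => /andP[y0 /ltW y1]; rewrite derive1E; have [_ ->] := dh y y1.
    rewrite subr_ge0 lef_pV2 ?posrE ?modul_gt0 ?arg0//.
    rewrite -(@ler_pXn2r _ 2)// ?nnegrE ?(ltW (arg0 y y1)) ?(ltW (modul_gt0 q01 y))//.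
    rewrite sqr_modul//.
    have -> : 1 - q ^+ 2 * sin y ^+ 2 = d ^+ 2 + q ^+ 2 * cos y ^+ 2.
      by rewrite -qd cos2sin2; ring.
    have c1 : cos y <= pi / 2 - y.
      have -> : cos y = sin (pi / 2 - y).
        by rewrite sinB sin_pihalf cos_pihalf mul1r mul0r subr0.
      by apply: sin_le_id; lra.
    have c0 : 0 <= cos y by apply: cos_ge0_pihalf; apply/andP; split; have := pihalf_gt0 R; lra.
    have q2 := q2_lt1 q01.
    have cc : cos y ^+ 2 <= (pi / 2 - y) ^+ 2 by rewrite lerXn2r// nnegrE; lra.
    have := sqr_ge0 (cos y); have := mulr_ge0 (ltW d0) c0.
    have h := ler_wpM2r (sqr_ge0 (cos y)) (ltW q2); rewrite mul1r in h.
    have := ler_wpM2l (ltW d0) c1.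
    by move: cc h; rewrite !expr2 => *; nra.
  - apply: continuous_in_subspaceT => y; rewrite inE /= in_itv /= => /andP[_ y1].
    exact: is_derive_continuous (dh y y1).
  - exact/ltW/pihalf_gt0.
by rewrite [EllF 0 q]oint0 subrr subr0 addr0 add0r -/(EllK q) => H; lra.
Qed.

Lemma exists_EllGap_lt0 : exists2 q, isqrt2 R < q < 1 & EllGap q < 0.
Proof.
(* With this value [- ln d = 4], so [K] is at least 4, while [2 E <= pi < 4]. *)
pose d : R := expR (- 4).
have d0 : 0 < d by exact: expR_gt0.
have d2 : d < 2^-1.
  rewrite /d expRN ltf_pV2 ?posrE ?expR_gt0//.
  by apply: lt_le_trans (expR_ge1Dx 4); lra.
have dd : d ^+ 2 < 4^-1.
  have -> : 4^-1 = 2^-1 ^+ 2 :> R by rewrite expr2; field.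
  by rewrite ltr_pXn2r// nnegrE ltW.
pose q := Num.sqrt (1 - d ^+ 2).
have dp : 0 < d ^+ 2 by rewrite exprn_gt0.
have q2 : q ^+ 2 = 1 - d ^+ 2 by rewrite sqr_sqrtr//; lra.
have q0 : 0 < q by rewrite sqrtr_gt0; lra.
have q1 : q < 1 by rewrite -(@ltr_pXn2r _ 2)// ?nnegrE ?ltW// q2 expr1n; lra.
exists q.
  by rewrite q1 andbT isqrt2_ltE ?ltW// q2; lra.
have q01 : 0 <= q < 1 by rewrite ltW.
have q01' : 0 < q < 1 by rewrite q0.
have := @EllK_ge_ln q d q01 d0; rewrite q2 => /(_ _)/[1!subKr]; move=> /(_ erefl).
rewrite {2}/d expRK => h.
have l0 : 0 <= ln (d + pi / 2).
  by apply: ln_ge0; have := pi_ge2 R; lra.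
have e := EllEc_le q01'; have p2 := pihalf_lt2 R.
by rewrite /EllGap; lra.
Qed.

Lemma EllGap_isqrt2 : 0 < EllGap (isqrt2 R).
Proof.
have i0 := isqrt2_gt0 R; have i2 := isqrt2_sq R.
have q1 : isqrt2 R < 1 by rewrite -(@ltr_pXn2r _ 2)// ?nnegrE ?ltW// i2 expr1n; lra.
have q01 : 0 < isqrt2 R < 1 by rewrite i0.
(* Since [q ^ 2 = 1/2], [2 E - K = int cos^2 / modul]. *)
have q01' : 0 <= isqrt2 R < 1 by rewrite ltW.
have cv := continuous_modulV q01'; have cm := continuous_modul q01'.
have -> : EllGap (isqrt2 R) = oint 0 (pi / 2) (fun t => 2 * modul (isqrt2 R) t + -1 * (modul (isqrt2 R) t)^-1).
  by rewrite ointD ?ointZ ?mulN1r//; exact: contZ.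
(* The integrand [cos ^ 2 / modul] dominates [cos ^ 2], whose integral is [pi / 4]. *)
apply: (@lt_le_trans _ _ (pi / 4)); first by rewrite divr_gt0 ?pi_gt0.
have cc : continuous (fun t : R => 1 + -1 * sin t ^+ 2).
  by apply: contD; [exact: contC|apply: contZ; exact: continuous_sin2].
have -> : pi / 4 = oint 0 (pi / 2) (fun t : R => 1 + -1 * sin t ^+ 2).
  rewrite ointD ?ointZ//; first last.
  - exact/contZ/continuous_sin2.
  - exact: contC.
  - exact: continuous_sin2.
  rewrite oint_sin2 (oint_antideriv (F := id) _ _ (contC (c := 1))); last by move=> t; exact: deriv_id.
  by rewrite /= subr0; field.
apply: oint_le => [|//||t _ _]; [exact/ltW/pihalf_gt0|by apply: contD; exact: contZ|].
have m0 := modul_gt0 q01' t.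
have s : sin t ^+ 2 <= 1 by exact: sin2_le1.
have -> : 2 * modul (isqrt2 R) t + -1 / modul (isqrt2 R) t = (1 - sin t ^+ 2) / modul (isqrt2 R) t.
  transitivity ((2 * modul (isqrt2 R) t ^+ 2 - 1) / modul (isqrt2 R) t).
    by field; rewrite gt_eqF.
  by rewrite sqr_modul// i2; congr (_ / _); field.
by rewrite !mulN1r ler_pdivlMr// ler_piMr// ?modul_le1.
Qed.

End ModulusDerivative.

(** * The zeros [qstar] and [qhat], and the three monotone branches of [gpol] *)

Section Branches.
Variable R : realType.
Local Notation i2 := (isqrt2 R).
Local Notation qs := (qstar R).
Local Notation qh := (qhat R).
Implicit Types (q p c : R).

Lemma isqrt2_lt1 : i2 < 1.
Proof.
by rewrite -(@ltr_pXn2r _ 2)// ?nnegrE ?(ltW (isqrt2_gt0 R))// isqrt2_sq expr1n; lra.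
Qed.

Lemma cont_itv (f df : R -> R) a b : 0 < a -> b < 1 ->
  (forall q, 0 < q < 1 -> deriv_at f q (df q)) ->
  {within `[a, b]%classic, continuous f}%classic.
Proof.
move=> a0 b1 d; apply: continuous_in_subspaceT => x; rewrite inE /= in_itv /= => xab.
exact: is_derive_continuous (d x (sub_itv a0 b1 xab)).
Qed.

(** The sign change of [EllGap] produces a zero, so the choice behind [qstar] is a genuine zero and
    not the default 0; monotonicity then places it above [1 / sqrt 2]. *)
Lemma qstar_spec : i2 < qs < 1 /\ EllGap qs = 0.
Proof.
have [b /andP[ib b1] Pb] := exists_EllGap_lt0 R.
have [|c] := @IVT R (@EllGap R) i2 b 0 (ltW ib) (cont_itv (isqrt2_gt0 R) b1 (@deriv_EllGap R)).
  by rewrite ge_min le_max (ltW Pb) (ltW (EllGap_isqrt2 R)) orbT.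
rewrite in_itv /= => /andP[ic cb] Pc.
have c0 : 0 < c by exact: lt_le_trans (isqrt2_gt0 R) ic.
have [/andP[s0 s1] Ps] : 0 < qs < 1 /\ 2 * EllEc qs - EllK qs = 0.
  have := @xgetPex _ 0 [set q | 0 < q < 1 /\ 2 * EllEc q - EllK q = 0]; apply.
  by exists c; split=> //; rewrite c0 (le_lt_trans cb).
split=> //; rewrite s1 andbT ltNge; apply/negP => si.
have : 0 < EllGap qs.
  move: si; rewrite le_eqVlt => /predU1P[->|si]; first exact: EllGap_isqrt2.
  exact: lt_trans (EllGap_isqrt2 R) (EllGap_decr s0 si isqrt2_lt1).
by rewrite [EllGap qs]Ps ltxx.
Qed.

Lemma EllGap_gt0 q : 0 < q < 1 -> (0 < EllGap q) = (q < qs).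
Proof.
move=> /andP[q0 q1]; have [/andP[si s1] Ps] := qstar_spec.
have s0 : 0 < qs by apply: lt_trans si; exact: isqrt2_gt0.
case: (ltgtP q qs) => [qq|qq|->]; last by rewrite Ps ltxx.
  by rewrite -Ps EllGap_decr.
by apply/negbTE; rewrite -leNgt -Ps ltW// EllGap_decr.
Qed.

Lemma EllGap_lt0 q : 0 < q < 1 -> (EllGap q < 0) = (qs < q).
Proof.
move=> /andP[q0 q1]; have [/andP[si s1] Ps] := qstar_spec.
have s0 : 0 < qs by apply: lt_trans si; exact: isqrt2_gt0.
case: (ltgtP qs q) => [qq|qq|<-]; last by rewrite Ps ltxx.
  by rewrite -Ps EllGap_decr.
by apply/negbTE; rewrite -leNgt -Ps ltW// EllGap_decr.
Qed.

(** The origin of [fpol]: it remains when a factor [2 E - K] is taken out of the derivative, whose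
    sign is therefore that of [EllGap q * fpol q]. *)
Lemma deriv_gpol q : 0 < q < 1 ->
  deriv_at (@gpol R) q (16 * EllGap q * fpol q / (q * (1 - q ^+ 2))).
Proof.
move=> q01; have /andP[q0 q1] := q01.
have qn : q != 0 by rewrite gt_eqF.
have q2n : 1 - q ^+ 2 != 0 by rewrite gt_eqF// subr_gt0 q2_lt1// ltW.
apply: deriv_at_eq.
  apply: derivM; last first.
    apply: derivB; last exact: deriv_cst.
    by apply: derivM; [exact: deriv_cst|apply: derivX; exact: deriv_id].
  apply: derivM; first exact: deriv_cst.
  apply: derivX; exact: deriv_EllGap.
have h1 : q * int_sin2_modul q 1 = (EllK q - EllEc q) / q by rewrite -int_sin2_modul1//; field.
have h3 : q * int_sin2_modul q 3 = (EllEc q - (1 - q ^+ 2) * EllK q) / (q * (1 - q ^+ 2)).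
  by rewrite -int_sin2_modul3//; field; rewrite qn q2n.
rewrite h1 h3 /EllGap /fpol /=.
by field; rewrite qn q2n.
Qed.

(* The sign of [f] is that of [E / K - rho], where [rho = n / D] increases and [E / K] decreases. *)
Lemma fpol_lt0 p q : i2 <= p -> p < q -> q < 1 -> fpol p <= 0 -> fpol q < 0.
Proof.
move=> ip pq q1.
have p0 : 0 < p by exact: lt_le_trans (isqrt2_gt0 R) ip.
have q0 := lt_trans p0 pq; have p1 := lt_trans pq q1.
have p01 : 0 < p < 1 by rewrite p0. have q01 : 0 < q < 1 by rewrite q0.
have a_ge : 2^-1 <= p ^+ 2.
  by rewrite -isqrt2_sq lerXn2r// nnegrE ltW// isqrt2_gt0.
have ab : p ^+ 2 < q ^+ 2 by rewrite ltr_pXn2r// nnegrE ltW.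
have b1 : q ^+ 2 < 1 by apply: q2_lt1; rewrite (ltW q0).
have Kp := EllK_gt0 (q := p) (ltac:(by rewrite (ltW p0))).
have Kq := EllK_gt0 (q := q) (ltac:(by rewrite (ltW q0))).
have Ep := EllEc_gt0 p01; have Eq := EllEc_gt0 q01.
have Kle := EllK_le p0 pq q1; have Ele := ltW (EllEc_decr p0 pq q1).
pose n t : R := (4 * t - 1) * (1 - t); pose D t : R := - 8 * t ^+ 2 + 8 * t - 1.
have fE r : fpol r = D (r ^+ 2) * EllEc r - n (r ^+ 2) * EllK r.
  by rewrite /fpol /D /n; ring.
rewrite !fE; set a := p ^+ 2 in a_ge ab *; set b := q ^+ 2 in ab b1 *.
have na : 0 < n a by rewrite /n mulr_gt0; lra.
have nb : 0 < n b by rewrite /n mulr_gt0; lra.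
rewrite subr_le0 subr_lt0 => fp.
(* When [D b] is not positive one cannot divide by it, but then the [E] term is already
   nonpositive. *)
case: (leP (D b) 0) => [Db|Db].
  apply: (@le_lt_trans _ _ 0); last exact: mulr_gt0.
  by rewrite mulr_le0_ge0// ltW.
have Da : D b < D a.
  rewrite -subr_gt0 (_ : D a - D b = 8 * (b - a) * (a + b - 1)); last by rewrite /D; ring.
  by rewrite !mulr_gt0//; lra.
have Dap := lt_trans Db Da.
(* The increase of [rho] from [a] to [b], cross-multiplied. *)
have key : n a * D b < n b * D a.
  rewrite -subr_gt0 (_ : _ - _ = (b - a) * (8 * (a - 2^-1) * (b - 2^-1) + 1)).
    have : 0 <= 8 * (a - 2^-1) * (b - 2^-1) by rewrite !mulr_ge0//; lra.
    by move=> h; rewrite mulr_gt0//; lra.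
  by rewrite /n /D; field.
rewrite -(ltr_pM2l Dap).
have h1 : D a * (D b * EllEc q) <= D b * (D a * EllEc p).
  by rewrite mulrCA; do 2 (apply: ler_wpM2l; first exact: ltW).
have h2 : D b * (D a * EllEc p) <= D b * (n a * EllK p).
  by apply: ler_wpM2l => //; exact: ltW.
have h3 : D b * (n a * EllK p) < n b * D a * EllK p.
  by rewrite mulrA (mulrC (D b)) ltr_pM2r.
have h4 : n b * D a * EllK p <= D a * (n b * EllK q).
  rewrite mulrA (mulrC (D a)); apply: ler_wpM2l => //.
  exact/ltW/mulr_gt0.
exact: le_lt_trans h1 (le_lt_trans h2 (lt_le_trans h3 h4)).
Qed.

Lemma cont_fpol : {within `[i2, qs]%classic, continuous (@fpol R)}%classic.
Proof.
have [/andP[si s1] _] := qstar_spec.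
apply: continuous_in_subspaceT => x; rewrite inE /= in_itv /= => xab.
have x01 := sub_itv (isqrt2_gt0 R) s1 xab.
have [df d] : exists df, deriv_at (@fpol R) x df.
  eexists; apply: derivD; apply: derivM.
  - apply: derivD; last exact: deriv_cst.
    by apply: derivB; apply: derivM;
      [exact: deriv_cst|apply: derivX; exact: deriv_id|exact: deriv_cst|apply: derivX; exact: deriv_id].
  - exact: deriv_EllK.
  - apply: derivB; last exact: deriv_cst.
    by apply: derivD; apply: derivM;
      [exact: deriv_cst|apply: derivX; exact: deriv_id|exact: deriv_cst|apply: derivX; exact: deriv_id].
  - exact: deriv_EllEc.
exact: is_derive_continuous d.
Qed.

(** At [q ^ 2 = 1 / 2] the coefficients of [K] and [E] are [- 1 / 2] and 1, so [fpol] is half of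
    [EllGap]. *)
Lemma fpol_isqrt2 : 0 < fpol i2.
Proof.
have := EllGap_isqrt2 R; rewrite /EllGap /fpol.
have -> : i2 ^+ 4 = 4^-1 by rewrite (exprM _ 2 2) isqrt2_sq expr2; field.
by rewrite isqrt2_sq; lra.
Qed.

(** Putting [K = 2 E] collapses [fpol] to [- (2 q ^ 2 - 1) E]. *)
Lemma fpol_qstar : fpol qs < 0.
Proof.
have [/andP[si s1] Ps] := qstar_spec.
have s0 : 0 < qs by apply: lt_trans si; exact: isqrt2_gt0.
have s01 : 0 < qs < 1 by rewrite s0.
have K2E : EllK qs = 2 * EllEc qs by apply/eqP; rewrite eq_sym -subr_eq0 -/(EllGap qs) Ps.
rewrite /fpol K2E.
have -> : (4 * qs ^+ 4 - 5 * qs ^+ 2 + 1) * (2 * EllEc qs) + (- 8 * qs ^+ 4 + 8 * qs ^+ 2 - 1) * EllEc qs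
  = - (2 * qs ^+ 2 - 1) * EllEc qs by ring.
rewrite mulNr oppr_lt0 mulr_gt0 ?EllEc_gt0//.
by move: si; rewrite isqrt2_ltE ?ltW// => h; lra.
Qed.

(** The sign change of [fpol] between [i2] and [qs] gives existence. The choice ranges over all of
    [[i2, 1)], and the single crossing stated by [fpol_lt0] keeps it below [qs]. *)
Lemma qhat_spec : i2 < qh < qs /\ fpol qh = 0.
Proof.
have [/andP[si s1] Ps] := qstar_spec.
have [|c] := @IVT R (@fpol R) i2 qs 0 (ltW si) cont_fpol.
  by rewrite ge_min le_max (ltW fpol_qstar) (ltW fpol_isqrt2) orbT.
rewrite in_itv /= => /andP[ic cs] fc.
have [/andP[h0 h1] fh] : i2 <= qh < 1 /\ fpol qh = 0.
  have := @xgetPex _ 0 [set q | i2 <= q < 1 /\ fpol q = 0]; apply.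
  by exists c; split=> //; rewrite ic (le_lt_trans cs).
split=> //; apply/andP; split.
  by rewrite lt_neqAle h0 andbT; apply/eqP => E; move: fh; rewrite -E => E'; have := fpol_isqrt2; rewrite E' ltxx.
rewrite ltNge; apply/negP; rewrite le_eqVlt => /predU1P[E|lt].
  by have := fpol_qstar; rewrite E fh ltxx.
by have := fpol_lt0 (ltW si) lt h1 (ltW fpol_qstar); rewrite fh ltxx.
Qed.

(** [fpol] turns negative at [qh] and [EllGap] at [qs], so their product is positive, then negative,
    then positive. *)
Lemma gpol_mono p q : i2 <= p -> p < q -> q < 1 ->
  [/\ q <= qh -> gpol p < gpol q, qh <= p -> q <= qs -> gpol q < gpol p &
      qs <= p -> gpol p < gpol q].
Proof.
move=> ip pq q1.
have [/andP[ih hs] fh] := qhat_spec; have [/andP[si s1] Ps] := qstar_spec.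
have p0 : 0 < p by exact: lt_le_trans (isqrt2_gt0 R) ip.
have d x : p <= x <= q -> deriv_at (@gpol R) x (16 * EllGap x * fpol x / (x * (1 - x ^+ 2))).
  by move=> /(sub_itv p0 q1); exact: deriv_gpol.
have X x : p < x < q -> [/\ 0 < x < 1, i2 < x & 0 < (x * (1 - x ^+ 2))^-1].
  move=> /andP[px xq].
  have x01 : 0 < x < 1 by apply: (sub_itv p0 q1); rewrite !ltW.
  split=> //; first exact: le_lt_trans px.
  have /andP[x0 x1] := x01.
  by rewrite invr_gt0 mulr_gt0// subr_gt0 q2_lt1// (ltW x0).
have fneg x : qh < x -> x < 1 -> fpol x < 0.
  by move=> hx x1; apply: fpol_lt0 hx x1 _; [exact: ltW|rewrite fh].
have fpos x : i2 < x -> x < qh -> 0 < fpol x.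
  move=> ix xh; rewrite ltNge; apply/negP => fx.
  have h1 : qh < 1 by exact: lt_trans s1.
  by have := fpol_lt0 (ltW ix) xh h1 fx; rewrite fh ltxx.
split.
- move=> qh'; apply: (strict_incr_itv d) => // x xpq.
  have [x01 ix i0] := X x xpq; have /andP[px xq] := xpq.
  have xh : x < qh by exact: lt_le_trans qh'.
  apply: mulr_gt0 i0; apply: mulr_gt0; last exact: fpos.
  by rewrite mulr_gt0// EllGap_gt0// (lt_trans xh).
- move=> hp qq; apply: (strict_decr_itv d) => // x xpq.
  have [x01 ix i0] := X x xpq; have /andP[px xq] := xpq; have /andP[_ x1] := x01.
  rewrite nmulr_rlt0//.
  have fx := fneg x (le_lt_trans hp px) x1.
  by rewrite pmulr_rlt0// mulr_gt0// EllGap_gt0// (lt_le_trans xq).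
- move=> sp; apply: (strict_incr_itv d) => // x xpq.
  have [x01 ix i0] := X x xpq; have /andP[px xq] := xpq; have /andP[_ x1] := x01.
  have sx : qs < x by exact: le_lt_trans px.
  have fx := fneg x (lt_trans hs sx) x1.
  apply: mulr_gt0 i0; rewrite nmulr_rgt0//.
  by rewrite pmulr_rlt0// EllGap_lt0.
Qed.

Lemma lamhat_gt0 : 0 < lamhat R.
Proof.
have [/andP[ih hs] fh] := qhat_spec; have [/andP[si s1] Ps] := qstar_spec.
have h0 : 0 < qh by exact: lt_trans (isqrt2_gt0 R) ih.
have P0 : 0 < EllGap qh by rewrite EllGap_gt0// h0 (lt_trans hs).
rewrite /lamhat /gpol mulr_gt0//; first by rewrite mulr_gt0// exprn_gt0.
by move: ih; rewrite isqrt2_ltE ?ltW// => h; lra.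
Qed.

Lemma gpol_le_lamhat q : i2 < q < qs -> gpol q <= lamhat R.
Proof.
move=> /andP[iq qq].
have [/andP[ih hs] fh] := qhat_spec; have [/andP[si s1] Ps] := qstar_spec.
rewrite /lamhat; case: (ltgtP q qh) => [lt|gt|->//].
  by have [h _ _] := gpol_mono (ltW iq) lt (lt_trans hs s1); exact/ltW/h.
have [_ h _] := gpol_mono (ltW ih) gt (lt_trans qq s1).
by apply/ltW/h => //; exact: ltW.
Qed.

(** The elastica supplies its own modulus [q]; strict monotonicity of [gpol] on the branch shows
    that the choice in [q1] returns it. The other two branches are treated alike. *)
Lemma q1_gpol q : i2 < q <= qh -> q1 (gpol q) = q.
Proof.
move=> /andP[iq qq].
have [/andP[ih hs] fh] := qhat_spec; have [/andP[si s1] Ps] := qstar_spec.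
have h1 := lt_trans hs s1.
apply: xget_unique => [|p [/andP[ip pp] E]]; first by rewrite /= iq.
case: (ltgtP p q) => // [lt|gt].
  by have [h _ _] := gpol_mono (ltW ip) lt (le_lt_trans qq h1); move: (h qq); rewrite E ltxx.
by have [h _ _] := gpol_mono (ltW iq) gt (le_lt_trans pp h1); move: (h pp); rewrite E ltxx.
Qed.

Lemma q2_gpol q : qh <= q < qs -> q2 (gpol q) = q.
Proof.
move=> /andP[hq qq].
have [/andP[ih hs] fh] := qhat_spec; have [/andP[si s1] Ps] := qstar_spec.
apply: xget_unique => [|p [/andP[hp pp] E]]; first by rewrite /= hq.
case: (ltgtP p q) => // [lt|gt].
  have [_ h _] := gpol_mono (le_trans (ltW ih) hp) lt (lt_trans qq s1).
  by move: (h hp (ltW qq)); rewrite E ltxx.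
have [_ h _] := gpol_mono (le_trans (ltW ih) hq) gt (lt_trans pp s1).
by move: (h hq (ltW pp)); rewrite E ltxx.
Qed.

Lemma q3_gpol q : qs < q < 1 -> q3 (gpol q) = q.
Proof.
move=> /andP[sq q1].
have [/andP[si s1] Ps] := qstar_spec.
apply: xget_unique => [|p [/andP[sp p1] E]]; first by rewrite /= sq.
case: (ltgtP p q) => // [lt|gt].
  have [_ _ h] := gpol_mono (ltW (lt_trans si sp)) lt q1.
  by move: (h (ltW sp)); rewrite E ltxx.
have [_ _ h] := gpol_mono (ltW (lt_trans si sq)) gt p1.
by move: (h (ltW sq)); rewrite E ltxx.
Qed.

(** The bound says that [sqrt (lam l ^ 2 / lamhat)] is at most [n], and an integer above a number is
    above its ceiling. *)
Lemma nlam_le (lam l : R) (n : nat) : 0 < lam -> 0 < l -> (0 < n)%N ->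
  lam * l ^+ 2 / n%:R ^+ 2 <= lamhat R -> (nlam lam l <= n%:Z)%R.
Proof.
move=> lam0 l0 n0 le.
have n0' : 0 < n%:R :> R by rewrite ltr0n.
have L0 := lamhat_gt0.
rewrite /nlam ceil_le_int.
have -> : n%:Z%:~R = Num.sqrt (n%:R ^+ 2) :> R by rewrite sqrtr_sqr ger0_norm// ltW.
apply: ler_wsqrtr; rewrite ler_pdivrMr//.
by move: le; rewrite ler_pdivrMr ?exprn_gt0// (mulrC (lamhat R)).
Qed.

End Branches.

Theorem theorem1p1 (R : realType) (lam l : R) (g : R -> R * R) :
  0 < lam -> 0 < l -> pen_pinned_elastica lam l g ->
  reparam_of (@segment R) l g \/
  (exists n : nat, (nlam lam l <= n%:Z)%R /\ reparam_refl (gam_sarc lam l n) (sarc_len lam l n) g) \/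
  (exists n : nat, (nlam lam l <= n%:Z)%R /\ reparam_refl (gam_larc lam l n) (larc_len lam l n) g) \/
  (exists n : nat, (1 <= n)%N /\ reparam_refl (gam_loop lam l n) (loop_len lam l n) g).
Proof.
move=> lam0 l0 crit.
have [seg|[n [q [n0 /andP[iq q1] gq H]]]] := elastica_shape lam0 l0 crit; first by left.
right.
have q01 : 0 < q < 1 by rewrite (lt_trans (isqrt2_gt0 R) iq).
case: H => [[P0 rg]|[P0 rg]].
- have qs : q < qstar R by rewrite -EllGap_gt0.
  have nn : (nlam lam l <= n%:Z)%R.
    by apply: nlam_le => //; rewrite -gq; apply: gpol_le_lamhat; rewrite iq.
  (* The modulus [qhat], common to both kinds of arc, is counted as a shorter arc. *)
  case: (leP q (qhat R)) => [qh|/ltW qh].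
    left; exists n; split; first exact: nn.
    have qE : sarc_q lam l n = q by rewrite /sarc_q -gq q1_gpol// iq.
    by rewrite /gam_sarc /sarc_len qE.
  right; left; exists n; split; first exact: nn.
  have qE : larc_q lam l n = q by rewrite /larc_q -gq q2_gpol// qh.
  by rewrite /gam_larc /larc_len qE.
- right; right; exists n; split; first exact: n0.
  have qs : qstar R < q by rewrite -EllGap_lt0.
  have qE : loop_q lam l n = q by rewrite /loop_q -gq q3_gpol// qs.
  by rewrite /gam_loop /loop_len qE.
Qed.
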